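(* Let $G=(V,E,\mu,w)$ be a connected, locally finite and stochastically complete graph. Let $s\in(0,1)$, $p\in[2,+\infty)$ and assume $\inf_{x\in V}\mu(x)>0$. Suppose $h:V\to\mathbb R$ satisfies $h_0=\inf_{x\in V}h(x)>0$ and, for any fixed $x_0\in V$, $h(x)\to+\infty$ as $\mathrm d(x,x_0)\to+\infty$. Suppose $f:V\times\mathbb R\to\mathbb R$, with $F(x,y)=\int_0^yf(x,t)\,dt$, satisfies: (A1) $f(x,y)$ is continuous with respect to $y\ge0$, and $f(x,0)=0$ for any $x\in V$; (A2) for any constant $M>0$ there exists a constant $C_M$ such that $f(x,y)\le C_M$ for any $(x,y)\in V\times[0,M]$; (A3) there exists a constant $\alpha>p$ such that $0<\alpha F(x,y)\le yf(x,y)$ for any $x\in V$ and $y>0$; (A4) $\displaystyle\limsup_{y\to0^+}\frac{f(x,y)}{y^{p-1}}<\lambda_p=\inf_{u\in\mathcal H_{s,p}(V),\,u\not\equiv0}\frac{\int_V(|\nabla^su|^p+h|u|^p)\,d\mu}{\int_V|u|^p\,d\mu}$ uniformly in $x\in V$. Then the fractional $p$-Laplace equation $$(-\Delta)_p^su+h|u|^{p-2}u=f(x,u)\quad\text{in }V$$ has a strictly positive solution in $\mathcal H_{s,p}(V)$.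
   Context: $G=(V,E,\mu,w)$ is a weighted graph with countable vertex set $V$, edge set $E$, positive vertex measure $\mu:V\to(0,+\infty)$ and positive symmetric edge weight $w_{xy}=w_{yx}>0$ ($xy\in E$); locally finite means every vertex has finitely many neighbours. $\mathrm d(x,x_0)$ is the minimal number of edges of a path between $x$ and $x_0$. Write $\int_V g\,d\mu=\sum_{x\in V}g(x)\mu(x)$. Let $p(t,x,y)$ be the (minimal) heat kernel of $G$, i.e. of the Laplacian $\Delta u(x)=\frac1{\mu(x)}\sum_{y\sim x}w_{xy}(u(y)-u(x))$. $G$ is stochastically complete if $\sum_{y\in V}p(t,x,y)\mu(y)=1$ for all $t>0$, $x\in V$. (The exponent $p$ is unrelated to the heat kernel.) For $x\ne y\in V$, set $$W_s(x,y)=\frac{s}{\Gamma(1-s)}\mu(x)\mu(y)\int_0^{+\infty}p(t,x,y)\,t^{-1-s}\,dt,$$ where $\Gamma(\cdot)$ is the Gamma function. For bounded $u,v:V\to\mathbb R$, $$\nabla^su\nabla^sv(x)=\frac1{2\mu(x)}\sum_{y\in V,\,y\ne x}W_s(x,y)(u(x)-u(y))(v(x)-v(y)),\qquad |\nabla^su|(x)=\sqrt{\nabla^su\nabla^su(x)},$$ and the fractional $p$-Laplace operator is $$(-\Delta)_p^su(x)=\frac1{2\mu(x)}\sum_{y\in V,\,y\ne x}W_s(x,y)\big(|\nabla^su|^{p-2}(x)+|\nabla^su|^{p-2}(y)\big)(u(x)-u(y)).$$ $C_c(V)$ is the set of functions $V\to\mathbb R$ with finite support. $\mathcal H_{s,p}(V)$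 is the completion of $C_c(V)$ under the norm $\|u\|_{\mathcal H_{s,p}(V)}=(\int_V(|\nabla^su|^p+h|u|^p)\,d\mu)^{1/p}$, regarded as a space of bounded functions on $V$ (this norm dominates a multiple of the sup norm). $u\in\mathcal H_{s,p}(V)$ is a (weak) solution of the equation if $$\int_V\big(|\nabla^su|^{p-2}\nabla^su\nabla^s\varphi+h|u|^{p-2}u\varphi\big)d\mu=\int_Vf(x,u)\varphi\,d\mu\quad\forall\varphi\in\mathcal H_{s,p}(V);$$ such a $u$ is also a point-wise solution. Strictly positive means $u(x)>0$ for all $x\in V$. *)

(* Defs.v *)
From HB Require Import structures.
From mathcomp Require Import all_boot all_order all_algebra.
From mathcomp Require Import all_classical all_reals all_analysis.
Import Order.TTheory GRing.Theory Num.Theory.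
Import numFieldNormedType.Exports.

Set Implicit Arguments.
Unset Strict Implicit.
Unset Printing Implicit Defensive.

Local Open Scope classical_set_scope.
Local Open Scope ring_scope.

(* Weights are only meaningful on edges: the value of [weight] off the edge
   relation is unconstrained and never used. Loops are not excluded; they
   change neither the Laplacian nor the distance. *)
Record weighted_graph (R : realType) (V : countType) := WeightedGraph {
  edge : rel V;
  edge_sym : symmetric edge;
  vmeas : V -> R;
  vmeas_gt0 : forall x, 0 < vmeas x;
  weight : V -> V -> R;
  weight_sym : forall x y, edge x y -> weight x y = weight y x;
  weight_gt0 : forall x y, edge x y -> 0 < weight x y }.

Definition Gamma {R : realType} (z : R) : R :=
  \int[lebesgue_measure]_(t in `]0, +oo[) (t `^ (z - 1) * expR (- t)).

(* The integral of f x from 0 to y; only meant for 0 <= y. *)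
Definition primitive {R : realType} {V : Type} (f : V -> R -> R)
    (x : V) (y : R) : R :=
  \int[lebesgue_measure]_(t in `[0, y]) f x t.

Section Sums.
Context {R : realType} {V : countType}.

(* Unordered sum of a real family. It has its usual meaning when the family is
   absolutely summable on [D]. *)
Definition rsum (D : set V) (g : V -> R) : R :=
  fine (esum D (EFin \o g)^\+ - esum D (EFin \o g)^\-)%E.

End Sums.

Section Graph.
Context {R : realType} {V : countType}.
Variable G : weighted_graph R V.
Local Notation mu := (vmeas G).

Definition connected_graph : Prop :=
  forall x y, exists q : seq V, path (edge G) x q /\ last x q = y.

Definition locally_finite : Prop :=
  forall x, finite_set [set y | edge G x y].

Definition has_walk (x y : V) (n : nat) : Prop :=
  exists q : seq V, [/\ path (edge G) x q, last x q = y & size q = n].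

(* The value is 0 by convention if [x] and [y] are not joined by a path. *)
Definition gdist (x y : V) : nat :=
  if pselect (exists n, `[< has_walk x y n >]) is left e then ex_minn e else 0%N.

Definition integrableV (g : V -> R) : Prop :=
  summable [set: V] (fun x => (g x * mu x)%:E).

Definition intV (g : V -> R) : R := rsum [set: V] (fun x => g x * mu x).

Definition laplacian (u : V -> R) (x : V) : R :=
  (mu x)^-1 * \sum_(y \in [set y | edge G x y]) weight G x y * (u y - u x).

(* Laplacian with Dirichlet condition outside [Om], extended by zero. *)
Definition dirichlet_laplacian (Om : set V) (u : V -> R) (x : V) : R :=
  \1_Om x * laplacian (fun y => \1_Om y * u y) x.

(* Kernel, with respect to the vertex measure, of the semigroup
   exp (t Delta_Om) = \sum_k t^k / k! Delta_Om^k
   on functions supported in the finite set [Om]. *)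
Definition dirichlet_heat_kernel (Om : set V) (t : R) (x y : V) : R :=
  limn (series (fun k =>
    exp_coeff t k *
    iter k (dirichlet_laplacian Om) \1_(Om `&` [set y]) x)) / mu y.

(* Minimal heat kernel, constructed by exhaustion. The Dirichlet kernels are
   nonnegative, nondecreasing in [Om] and bounded by 1 / mu y, so this supremum
   is their limit along any exhaustion of V by finite sets. *)
Definition heat_kernel (t : R) (x y : V) : R :=
  sup [set dirichlet_heat_kernel Om t x y | Om in @finite_set V].

Definition stochastically_complete : Prop :=
  forall (t : R) (x : V), 0 < t ->
    (\esum_(y in [set: V]) (heat_kernel t x y * mu y)%:E = 1)%E.

Section Fractional.
Variable s : R.

Definition frac_weight (x y : V) : R :=
  s / Gamma (1 - s) * mu x * mu y *
  \int[lebesgue_measure]_(t in `]0, +oo[) (heat_kernel t x y * t `^ (- 1 - s)).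

Definition frac_grad_prod (u v : V -> R) (x : V) : R :=
  (2 * mu x)^-1 *
  rsum [set~ x] (fun y => frac_weight x y * (u x - u y) * (v x - v y)).

Definition frac_grad_norm (u : V -> R) (x : V) : R :=
  Num.sqrt (frac_grad_prod u u x).

(* [a `^ 0 = 1] also for [a = 0], so for p = 2 the factors
   |grad u|^(p-2) and |u|^(p-2) are identically 1. *)
Definition frac_plaplacian (p : R) (u : V -> R) (x : V) : R :=
  (2 * mu x)^-1 *
  rsum [set~ x] (fun y => frac_weight x y *
    (frac_grad_norm u x `^ (p - 2) + frac_grad_norm u y `^ (p - 2)) *
    (u x - u y)).

Section Space.
Variables (p : R) (h : V -> R).

Definition finitely_supported (u : V -> R) : Prop :=
  finite_set [set x | u x != 0].

Definition Hsp_density (u : V -> R) (x : V) : R :=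
  frac_grad_norm u x `^ p + h x * `|u x| `^ p.

Definition Hsp_norm (u : V -> R) : \bar R :=
  ((\esum_(x in [set: V]) (Hsp_density u x * mu x)%:E) `^ p^-1)%E.

(* Completion of the finitely supported functions, each Cauchy sequence being
   identified with its uniform limit. *)
Definition Hsp (u : V -> R) : Prop :=
  exists u_ : nat -> V -> R,
    [/\ forall n, finitely_supported (u_ n),
        forall e : R, 0 < e ->
          \forall m & n \near \oo, (Hsp_norm (fun x => u_ m x - u_ n x)%R < e%:E)%E
      & {uniform, u_ @ \oo --> u}].

Definition lambda_p : R :=
  inf [set intV (Hsp_density u) / intV (fun x => `|u x| `^ p)
      | u in [set u | Hsp u /\ exists x, u x != 0]].

(* Both integrands are required to be absolutely integrable, so that the
   identity is never one between default values. *)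
Definition weak_solution (f : V -> R -> R) (u : V -> R) : Prop :=
  Hsp u /\
  forall phi, Hsp phi ->
    let lhs x := frac_grad_norm u x `^ (p - 2) * frac_grad_prod u phi x
                 + h x * `|u x| `^ (p - 2) * u x * phi x in
    let rhs x := f x (u x) * phi x in
    [/\ integrableV lhs, integrableV rhs & intV lhs = intV rhs].

Definition pointwise_solution (f : V -> R -> R) (u : V -> R) : Prop :=
  forall x, frac_plaplacian p u x + h x * `|u x| `^ (p - 2) * u x = f x (u x).

End Space.
End Fractional.
End Graph.

(* Main.v *)
Require Import Defs.
From HB Require Import structures.
From mathcomp Require Import all_boot all_order all_algebra.
From mathcomp Require Import finmap.
From mathcomp Require Import all_classical all_reals all_analysis.
From mathcomp Require Import measurable_realfun.
From mathcomp Require Import ring lra zify.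
Import Order.TTheory GRing.Theory Num.Theory.
Import numFieldNormedType.Exports.

Set Implicit Arguments.
Unset Strict Implicit.
Unset Printing Implicit Defensive.

Local Open Scope classical_set_scope.
Local Open Scope ring_scope.

(** The solution is a mountain pass point of the functional
    [energy u / p - \sum_x mu x * Fpos x (u x)], obtained by exhaustion.

    Heat kernel. The weight [W] is an improper integral of the heat kernel
    against [t^(-1-s) dt]. Stochastic completeness bounds the probability of
    being away from [x] at time [t] by [min 1 (d t)] ([heat_kernel_off_diag]), hence
    [W x] is summable away from [x] ([asum_frac_weight]), and [W] is symmetric
    and positive along edges. On bounded functions the fractional gradient is
    then the norm of a nonnegative bilinear form, for which the Cauchy-Schwarz
    inequality holds.

    Energy. The [p]-th power of the norm lies above its tangents
    ([energy_convex]), satisfies Clarkson's inequality ([energy_clarkson]),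
    dominates the sup norm ([energy_sup]) and is lower semicontinuous for uniform
    convergence ([energy_lsc]). Its derivative at [u] is [p] times
    [energy_form u].

    Finite problems. The nonlinearity is replaced by 0 on negative values. For
    functions supported in a finite set [r] the functional is differentiable,
    positive on a small sphere because [f] is subcritical near 0, and negative
    far away in the direction of a unit function because [alpha > p]. Descent
    from a segment that crosses the sphere ([mountain_pass_descent]) gives an
    almost critical point on [r], with energy bounded below and above
    independently of [r] ([palais_smale_exists]).

    Compactness. As [h] tends to infinity, bounded energy gives compactness in
    [l^p] ([weighted_lp_compact]). Let [n <= m]: the almost critical point [v m]
    tests admissibly against [v n - v m], and the tangent inequality at [v m]
    combined with Clarkson's inequality bounds the energy of [v n - v m] by the
    difference of the energies and by an [l^p] distance
    ([energy_dist_almost_critical]). A subsequence therefore converges in energy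
    ([strong_limit]), its limit [u] lies in the space, has positive energy, and
    is a weak solution of the truncated equation ([critical_limit]).

    Positivity. Testing with unit functions yields the pointwise equation. As
    [u] vanishes at infinity it attains a negative minimum if it takes a negative
    value, which the equation excludes ([solution_ge0]). A zero propagates
    along edges ([zero_propagates]), and by connectedness [u] would vanish
    identically, against its positive energy. So [u > 0], and the truncation
    is invisible. *)

(** * Absolutely summable families *)

(** Absolute summability, the domain on which [rsum] is linear. *)
Definition asum {R : realType} {V : countType} (D : set V) (g : V -> R) : Prop :=
  summable D (EFin \o g).

Section SumToolkit.
Context {R : realType} {V : countType}.
Implicit Types (D : set V) (f g : V -> R) (r : seq V) (c : R).

Lemma asum_norm D g : asum D g <-> asum D (fun x => `|g x|).
Proof.
by rewrite /asum /summable; split; apply: le_lt_trans; apply: le_esum => x _ /=;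
   rewrite normr_id.
Qed.

Lemma le_asum D f g : (forall x, D x -> `|f x| <= `|g x|) -> asum D g -> asum D f.
Proof.
by move=> fg; apply: le_lt_trans; apply: le_esum => x Dx; rewrite /= lee_fin fg.
Qed.

Lemma le_esum_bound D g (c : R) :
  (forall r, uniq r -> (forall x, x \in r -> D x) -> \sum_(x <- r) g x <= c) ->
  (\esum_(x in D) (g x)%:E <= c%:E)%E.
Proof.
move=> H; apply: ge_ereal_sup => _ [F [finF FD] <-].
rewrite fsbig_finite//= sumEFin lee_fin; apply: H; first exact: fset_uniq.
by move=> x; rewrite in_fset_set// => /set_mem /FD.
Qed.

Lemma sum_le_esum D g r : uniq r -> (forall x, x \in r -> D x) ->
  ((\sum_(x <- r) g x)%:E <= \esum_(x in D) (g x)%:E)%E.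
Proof.
move=> ur rD; apply: ereal_sup_ubound; exists [set` r].
  by split; [exact: finite_seq|move=> x /= /rD].
by rewrite -fsbig_seq// sumEFin.
Qed.

Lemma asum_bound D g (c : R) :
  (forall r, uniq r -> (forall x, x \in r -> D x) -> \sum_(x <- r) `|g x| <= c) ->
  asum D g.
Proof. by move=> /le_esum_bound H; apply: le_lt_trans (ltry c); exact: H. Qed.

Lemma rsum_ge0E D g : (forall x, D x -> 0 <= g x) -> asum D g ->
  (rsum D g)%:E = (\esum_(x in D) (g x)%:E)%E.
Proof.
move=> g0 sg; rewrite /rsum (esum1 (a := (EFin \o g)^\-%E)); last first.
  by move=> i Di; rewrite funenegE/=; apply/max_idPr; rewrite ?lee_fin oppr_le0 g0.
rewrite sube0.
rewrite (@eq_esum _ _ _ _ (fun x => (g x)%:E)); last first.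
  by move=> i Di /=; rewrite funeposE/=; apply/max_idPl; rewrite lee_fin g0.
rewrite fineK// fin_numElt (lt_le_trans (ltNyr 0)) ?esum_ge0//.
apply: le_lt_trans sg; apply: le_esum => x _ /=.
by rewrite lee_fin ler_norm.
Qed.

(** The sum does not depend on the way in which a family is written as a
    difference of nonnegative summable families; linearity follows by splitting
    into positive and negative parts. *)
Lemma rsum_subE D f g : (forall x, D x -> 0 <= f x) -> (forall x, D x -> 0 <= g x) ->
  asum D f -> asum D g ->
  rsum D (fun x => f x - g x) = rsum D f - rsum D g.
Proof.
move=> f0 g0 sf sg.
have := @esumB _ _ D (EFin \o f) (EFin \o g) sf sg f0 g0.
rewrite -!rsum_ge0E// -EFinB => /(congr1 fine) /= <-.
by rewrite /rsum.
Qed.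

Lemma eq_rsum D f g : (forall x, D x -> f x = g x) -> rsum D f = rsum D g.
Proof.
move=> fg; rewrite /rsum; congr (fine (_ - _)); apply: eq_esum => x Dx.
  by rewrite !funeposE/= fg.
by rewrite !funenegE/= fg.
Qed.

Lemma eq_asum D f g : (forall x, D x -> f x = g x) -> asum D f -> asum D g.
Proof. by move=> fg; apply: le_asum => x /fg ->. Qed.

Lemma asumD D f g : asum D f -> asum D g -> asum D (fun x => f x + g x).
Proof. exact: summableD. Qed.

Lemma asumN D f : asum D f -> asum D (fun x => - f x).
Proof. by apply: le_asum => x _; rewrite normrN. Qed.

Lemma asumB D f g : asum D f -> asum D g -> asum D (fun x => f x - g x).
Proof. by move=> sf sg; apply: asumD => //; exact: asumN. Qed.

Lemma sum_le_rsum D g r : (forall x, D x -> 0 <= g x) -> asum D g -> uniq r ->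
  (forall x, x \in r -> D x) -> \sum_(x <- r) g x <= rsum D g.
Proof. by move=> g0 sg ur rD; rewrite -lee_fin rsum_ge0E//; exact: sum_le_esum. Qed.

Lemma term_le_rsum D g x : (forall x, D x -> 0 <= g x) -> asum D g -> D x ->
  g x <= rsum D g.
Proof.
move=> g0 sg Dx; have := @sum_le_rsum D g [:: x] g0 sg.
by rewrite big_seq1; apply=> // y; rewrite inE => /eqP ->.
Qed.

Lemma rsum_le_bound D g c : (forall x, D x -> 0 <= g x) ->
  (forall r, uniq r -> (forall x, x \in r -> D x) -> \sum_(x <- r) g x <= c) ->
  asum D g /\ rsum D g <= c.
Proof.
move=> g0 H; have sg : asum D g.
  apply: (@asum_bound _ _ c) => r ur rD.
  rewrite big_seq_cond (eq_bigr g); first by rewrite -big_seq_cond; exact: H.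
  by move=> x /andP[/rD Dx _]; rewrite ger0_norm// g0.
by split => //; rewrite -lee_fin rsum_ge0E//; exact: le_esum_bound.
Qed.

Let pos g x := Num.max (g x) 0.
Let neg g x := Num.max (- g x) 0.

Let posneg g x : g x = pos g x - neg g x.
Proof.
rewrite /pos /neg; have [g0|g0] := leP 0 (g x).
  by rewrite (max_idPr _) ?subr0// oppr_le0.
by rewrite (max_idPl _) ?sub0r ?opprK// oppr_ge0 ltW.
Qed.

Let pos0 g x : 0 <= pos g x. Proof. by rewrite le_max lexx orbT. Qed.
Let neg0 g x : 0 <= neg g x. Proof. by rewrite le_max lexx orbT. Qed.

Let asum_pos D g : asum D g -> asum D (pos g).
Proof.
apply: le_asum => x _; rewrite ger0_norm// ge_max normr_ge0 andbT.
exact: ler_norm.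
Qed.

Let asum_neg D g : asum D g -> asum D (neg g).
Proof.
apply: le_asum => x _; rewrite ger0_norm// ge_max normr_ge0 andbT.
by rewrite -normrN ler_norm.
Qed.

Let rsumE D g : asum D g -> rsum D g = rsum D (pos g) - rsum D (neg g).
Proof.
move=> sg; rewrite -rsum_subE//; [|exact: asum_pos|exact: asum_neg].
by apply: eq_rsum => x _; rewrite -posneg.
Qed.

Let rsumD0 D f g : (forall x, 0 <= f x) -> (forall x, 0 <= g x) ->
  asum D f -> asum D g -> rsum D (fun x => f x + g x) = rsum D f + rsum D g.
Proof.
move=> f0 g0 sf sg; apply: EFin_inj; rewrite EFinD !rsum_ge0E//.
- by rewrite -esumD// => x _; rewrite lee_fin.
- by move=> x _; rewrite addr_ge0.
- exact: asumD.
Qed.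

Lemma rsumD D f g : asum D f -> asum D g ->
  rsum D (fun x => f x + g x) = rsum D f + rsum D g.
Proof.
move=> sf sg; rewrite (rsumE sf) (rsumE sg).
have -> : rsum D (fun x => f x + g x) =
    rsum D (fun x => (pos f x + pos g x) - (neg f x + neg g x)).
  by apply: eq_rsum => x _; rewrite [in LHS](posneg f) [in LHS](posneg g); ring.
have [pf pg] := (asum_pos sf, asum_pos sg).
have [nf ng] := (asum_neg sf, asum_neg sg).
rewrite rsum_subE ?rsumD0//; first by ring.
- by move=> x _; rewrite addr_ge0.
- by move=> x _; rewrite addr_ge0.
- exact: asumD.
- exact: asumD.
Qed.

Lemma rsumN D f : asum D f -> rsum D (fun x => - f x) = - rsum D f.
Proof.
move=> sf; have [pf nf] := (asum_pos sf, asum_neg sf).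
rewrite (rsumE sf) opprB -rsum_subE//.
by apply: eq_rsum => x _; rewrite (posneg f); ring.
Qed.

Lemma rsumB D f g : asum D f -> asum D g ->
  rsum D (fun x => f x - g x) = rsum D f - rsum D g.
Proof. by move=> sf sg; rewrite rsumD ?rsumN//; exact: asumN. Qed.

Lemma rsum_ge0 D g : (forall x, D x -> 0 <= g x) -> 0 <= rsum D g.
Proof.
move=> g0; rewrite /rsum (esum1 (a := (EFin \o g)^\-%E)); last first.
  by move=> i Di; rewrite funenegE/=; apply/max_idPr; rewrite ?lee_fin oppr_le0 g0.
by rewrite sube0; apply: fine_ge0; apply: esum_ge0.
Qed.

Lemma ler_rsum D f g : asum D f -> asum D g -> (forall x, D x -> f x <= g x) ->
  rsum D f <= rsum D g.
Proof.
move=> sf sg fg; rewrite -subr_ge0 -rsumB//; apply: rsum_ge0 => x Dx.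
by rewrite subr_ge0 fg.
Qed.

Lemma rsum_seq D g r : uniq r -> (forall x, x \in r -> D x) ->
  (forall x, D x -> x \notin r -> g x = 0) ->
  asum D g /\ rsum D g = \sum_(x <- r) g x.
Proof.
move=> ur rD gr.
have sE f : (forall x, D x -> x \notin r -> f x = 0) -> (forall x, 0 <= f x) ->
    asum D f /\ rsum D f = \sum_(x <- r) f x.
  move=> fr f0.
  have H s : uniq s -> (forall x, x \in s -> D x) -> \sum_(x <- s) f x <= \sum_(x <- r) f x.
    move=> us sD; rewrite (bigID (mem r))/= [X in _ + X]big1_seq ?addr0; last first.
      by move=> x /andP[xr /sD Dx]; rewrite fr.
    rewrite -big_filter.
    rewrite [leRHS](bigID (mem s))/=.
    rewrite -[leLHS]addr0 lerD ?sumr_ge0// -[leRHS]big_filter.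
    rewrite (perm_big [seq i <- r | i \in s])//.
    apply: uniq_perm; rewrite ?filter_uniq// => x.
    by rewrite !mem_filter andbC.
  have [//|sf le] := @rsum_le_bound D f (\sum_(x <- r) f x) _ H.
  by split=> //; apply: le_anti; rewrite le sum_le_rsum.
have sp : asum D (pos g) /\ rsum D (pos g) = \sum_(x <- r) pos g x.
  by apply: sE => // x Dx xr; rewrite /pos gr// maxxx.
have sn : asum D (neg g) /\ rsum D (neg g) = \sum_(x <- r) neg g x.
  by apply: sE => // x Dx xr; rewrite /neg gr// oppr0 maxxx.
have sg : asum D g.
  apply: (@eq_asum _ (fun x => pos g x - neg g x)) => [x _|]; first by rewrite -posneg.
  by apply: asumB; [case: sp|case: sn].
split => //; rewrite (rsumE sg) sp.2 sn.2 -sumrB.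
by apply: eq_bigr => x _; rewrite -posneg.
Qed.

Lemma asumZ D c f : asum D f -> asum D (fun x => c * f x).
Proof.
move=> /asum_norm sf; apply: (@asum_bound _ _ (`|c| * rsum D (fun x => `|f x|))) => r ur rD.
under eq_bigr do rewrite normrM.
by rewrite -mulr_sumr ler_wpM2l// sum_le_rsum.
Qed.

Let rsumZ0 D c f : 0 <= c -> (forall x, 0 <= f x) -> asum D f ->
  rsum D (fun x => c * f x) <= c * rsum D f.
Proof.
move=> c0 f0 sf; apply: (@rsum_le_bound _ _ _ _ _).2 => [x _|r ur rD].
  by rewrite mulr_ge0.
by rewrite -mulr_sumr ler_wpM2l// sum_le_rsum.
Qed.

Lemma rsumZ D c f : asum D f -> rsum D (fun x => c * f x) = c * rsum D f.
Proof.
have H0 c' f' : 0 < c' -> (forall x, 0 <= f' x) -> asum D f' ->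
    rsum D (fun x => c' * f' x) = c' * rsum D f'.
  move=> c0 f0 sf; apply: le_anti; rewrite rsumZ0 ?(ltW c0)//= .
  rewrite -ler_pdivlMl//.
  have := @rsumZ0 D c'^-1 (fun x => c' * f' x).
  rewrite invr_ge0 (ltW c0) => /(_ isT); under eq_rsum do rewrite mulKf ?gt_eqF//.
  by apply; [move=> x; rewrite mulr_ge0// ltW|exact: asumZ].
have H1 c' : 0 < c' -> asum D f -> rsum D (fun x => c' * f x) = c' * rsum D f.
  move=> c0 sf; have [pf nf] := (asum_pos sf, asum_neg sf).
  rewrite (rsumE sf) mulrBr -!H0// -rsumB; [|exact: asumZ|exact: asumZ].
  by apply: eq_rsum => x _; rewrite {1}(posneg f) mulrBr.
move=> sf; have [c0|c0|->] := ltgtP c 0.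
- rewrite -[c]opprK mulNr -H1 ?oppr_gt0// -rsumN; last exact: asumZ.
  by apply: eq_rsum => x _; rewrite mulNr.
- exact: H1.
- rewrite mul0r; have [|||_] := @rsum_seq D (fun x => 0 * f x) [::] => //.
    by move=> x _ _; rewrite mul0r.
  by rewrite big_nil.
Qed.

Lemma ler_norm_rsum D f : asum D f -> `|rsum D f| <= rsum D (fun x => `|f x|).
Proof.
move=> sf; have nf := (asum_norm D f).1 sf.
rewrite ler_norml -rsumN//; apply/andP; split; apply: ler_rsum => //.
- exact: asumN.
- by move=> x _; rewrite lerNl -normrN ler_norm.
- by move=> x _; rewrite ler_norm.
Qed.

Lemma asumE D f : asum D f = summable D (EFin \o f). Proof. by []. Qed.

Lemma rsum_setC1 g (z : V) :
  asum [set: V] g -> asum [set~ z] g /\ rsum [set: V] g = g z + rsum [set~ z] g.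
Proof.
move=> sg; pose g1 x := if x == z then g z else 0; pose g2 x := if x == z then 0 else g x.
have H (t : V -> \bar R) : (\esum_(x in [set~ z]) t x =
    \esum_(x in [set: V]) if x == z then 0 else t x)%E.
  rewrite esum_mkcond; apply: eq_esum => x _.
  case: eqVneq => [->|xz]; first by rewrite memNset//=; apply.
  by rewrite mem_set//=; apply/eqP.
have sg2 : asum [set: V] g2.
  by apply: (le_asum _ sg) => x _; rewrite /g2; case: eqP; rewrite ?normr0.
have [sg1 g1E] : asum [set: V] g1 /\ rsum [set: V] g1 = \sum_(x <- [:: z]) g1 x.
  by apply: rsum_seq => // x _; rewrite inE /g1 => /negbTE ->.
split.
  move: sg2; rewrite /asum /summable H; congr (_ < _)%E; apply: eq_esum => x _ /=.
  by rewrite /g2; case: eqP; rewrite ?normr0.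
have -> : rsum [set: V] g = rsum [set: V] (fun x => g1 x + g2 x).
  by apply: eq_rsum => x _; rewrite /g1 /g2; case: eqVneq => [->|]; rewrite ?addr0 ?add0r.
rewrite (rsumD sg1 sg2) g1E big_seq1 /g1 eqxx; congr (_ + _).
rewrite /rsum !H; congr (fine (_ - _)%E); apply: eq_esum => x _.
  by rewrite !funeposE /= /g2; case: eqP => // _; rewrite maxxx.
by rewrite !funenegE /= /g2; case: eqP => // _; rewrite oppr0 maxxx.
Qed.

End SumToolkit.

#[global] Opaque asum rsum.

(** * Inequalities for real powers *)

Section PowerInequalities.
Context {R : realType}.
Implicit Types p r th a b x y M e : R.

Lemma powR_pred p x : 1 <= p -> 0 <= x -> x * x `^ (p - 1) = x `^ p.
Proof. by move=> p1 x0; rewrite mulr_powRB1//; lra. Qed.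

Lemma le_powR p x y : 0 <= p -> 0 <= x -> x <= y -> x `^ p <= y `^ p.
Proof. by move=> p0 x0 xy; rewrite ge0_ler_powR ?nnegrE// (le_trans x0). Qed.

(** Young's inequality for the product of [y] and [x^(p-1)], with the conjugate
    exponents [p] and [p / (p-1)]. *)
Lemma powR_tangent p x y : 1 <= p -> 0 <= x -> 0 <= y ->
  x `^ p + p * x `^ (p - 1) * (y - x) <= y `^ p.
Proof.
move=> p1 x0 y0; have [<-|p_neq1] := eqVneq 1 p.
  by rewrite subrr powRr0 !powRr1//; lra.
have p1' : 1 < p by rewrite lt_neqAle p_neq1.
have p0 : 0 < p by lra.
have pm : 0 < p - 1 by lra.
pose q := p / (p - 1).
have q0 : 0 < q by rewrite divr_gt0.
have := @conjugate_powR R y (x `^ (p - 1)) p q y0 (powR_ge0 _ _) p0 q0.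
have -> : p^-1 + q^-1 = 1 by rewrite /q invf_div; field; rewrite gt_eqF.
move=> /(_ erefl); rewrite -powRrM.
have -> : (p - 1) * q = p by rewrite /q mulrC divfK// gt_eqF.
rewrite -(powR_pred p1 x0) /q.
move: (x `^ (p - 1)) (y `^ p) => X Y H.
have : p * (y * X) <= p * (Y / p + x * X / (p / (p - 1))) by rewrite ler_pM2l.
have -> : p * (Y / p + x * X / (p / (p - 1))) = Y + x * X * (p - 1).
  by field; rewrite !gt_eqF.
by lra.
Qed.

Lemma powR_midpoint r a b : 1 <= r -> 0 <= a -> 0 <= b ->
  ((a + b) / 2) `^ r <= (a `^ r + b `^ r) / 2.
Proof.
move=> r1 a0 b0; have m0 : 0 <= (a + b) / 2 by lra.
have := powR_tangent r1 m0 a0; have := powR_tangent r1 m0 b0.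
move: (((a + b) / 2) `^ r) (((a + b) / 2) `^ (r - 1)) (a `^ r) (b `^ r) => P Q A B.
by lra.
Qed.

Lemma powR_superadd r a b : 1 <= r -> 0 <= a -> 0 <= b ->
  a `^ r + b `^ r <= (a + b) `^ r.
Proof.
move=> r1 a0 b0; rewrite -(powR_pred r1 a0) -(powR_pred r1 b0).
rewrite -(powR_pred r1 (addr_ge0 a0 b0)) mulrDl.
by apply: lerD; rewrite ler_wpM2l// le_powR// ?subr_ge0// ?lerDl ?lerDr.
Qed.

Lemma sqr_powR_half p x : 0 <= x -> x `^ p = (x ^+ 2) `^ (p / 2).
Proof. by move=> x0; rewrite -powR_mulrn// -powRrM; congr (_ `^ _); field. Qed.

(** For [p / 2 >= 1] the power [t^(p/2)] is superadditive and midpoint convex,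
    which carries the parallelogram identity over to Clarkson's inequality. *)
Lemma powR_clarkson p X Y a b : 2 <= p -> 0 <= X -> 0 <= Y -> 0 <= a -> 0 <= b ->
  X ^+ 2 + Y ^+ 2 = (a ^+ 2 + b ^+ 2) / 2 ->
  X `^ p + Y `^ p <= (a `^ p + b `^ p) / 2.
Proof.
move=> p2 X0 Y0 a0 b0 XY.
have r1 : 1 <= p / 2 by lra.
rewrite (@sqr_powR_half p X)// (@sqr_powR_half p Y)//.
rewrite (@sqr_powR_half p a)// (@sqr_powR_half p b)//.
apply: le_trans (powR_superadd r1 (sqr_ge0 _) (sqr_ge0 _)) _.
by rewrite XY; apply: powR_midpoint => //; exact: sqr_ge0.
Qed.

(** The factor [x] compensates the unbounded derivative of [t^th] at 0 for
    [th < 1]: the bound is the tangent inequality for [t^(1+th)]. *)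
Lemma powR_lip M th x y : 0 <= th -> 0 <= x -> 0 <= y -> x <= M -> y <= M ->
  x * `|y `^ th - x `^ th| <= (1 + th) * M `^ th * `|x - y|.
Proof.
move=> th0 x0 y0 xM yM.
have p1 : 1 <= 1 + th by lra.
have E z : 0 <= z -> z * z `^ th = z `^ (1 + th).
  by move=> z0; rewrite -(powR_pred p1 z0); congr (_ * _ `^ _); ring.
have thE : 1 + th - 1 = th by ring.
have [xy|yx] := leP x y.
- have := le_powR th0 x0 xy; have := le_powR th0 y0 yM.
  have := powR_tangent p1 y0 x0; rewrite thE -(E _ x0) -(E _ y0).
  move: (x `^ th) (y `^ th) (M `^ th) (powR_ge0 y th) => A B C B0 H1 H2 H3.
  rewrite ger0_norm ?subr_ge0// ler0_norm ?subr_le0//.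
  apply: (@le_trans _ _ ((1 + th) * B * (y - x))).
    by have : 0 <= B * (y - x); [rewrite mulr_ge0 ?subr_ge0|lra].
  by rewrite opprB ler_wpM2r ?subr_ge0// ler_wpM2l// (le_trans _ p1).
- have yx' := ltW yx; have := le_powR th0 y0 yx'; have := le_powR th0 x0 xM.
  have := powR_tangent p1 x0 y0; rewrite thE -(E _ x0) -(E _ y0).
  move: (x `^ th) (y `^ th) (M `^ th) (powR_ge0 y th) => A B C B0 H1 H2 H3.
  rewrite ler0_norm ?subr_le0// ger0_norm ?subr_ge0//.
  apply: (@le_trans _ _ ((1 + th) * A * (x - y))).
    by have : 0 <= B * (x - y); [rewrite mulr_ge0 ?subr_ge0|lra].
  by rewrite ler_wpM2r ?subr_ge0// ler_wpM2l// (le_trans _ p1).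
Qed.

(** The two terms correspond to the cases [y <= e x] and [e x < y]. *)
Lemma powR_young p e x y : 1 <= p -> 0 < e -> 0 <= x -> 0 <= y ->
  x `^ (p - 1) * y <= e * x `^ p + e^-1 `^ (p - 1) * y `^ p.
Proof.
move=> p1 e0 x0 y0; have pm : 0 <= p - 1 by lra.
have [yx|xy] := leP y (e * x).
  apply: (@le_trans _ _ (e * x `^ p)); last first.
    by rewrite lerDl mulr_ge0 ?powR_ge0.
  by rewrite -(powR_pred p1 x0) mulrA [leLHS]mulrC ler_wpM2r ?powR_ge0.
apply: (@le_trans _ _ (e^-1 `^ (p - 1) * y `^ p)); last first.
  by rewrite lerDr mulr_ge0 ?powR_ge0// ltW.
have -> : e^-1 `^ (p - 1) * y `^ p = (e^-1 * y) `^ (p - 1) * y.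
  by rewrite -(powR_pred p1 y0) [in RHS]powRM ?invr_ge0 ?(ltW e0)//; ring.
by rewrite ler_wpM2r// le_powR// ler_pdivlMl// ltW.
Qed.

Lemma powR_add_le p a b : 0 <= p -> 0 <= a -> 0 <= b ->
  (a + b) `^ p <= 2 `^ p * (a `^ p + b `^ p).
Proof.
move=> p0; wlog ab : a b / a <= b.
  move=> H a0 b0; have [ab|/ltW ba] := leP a b; first exact: H.
  by rewrite addrC [_ `^ p + _]addrC; exact: H.
move=> a0 b0; apply: (@le_trans _ _ ((2 * b) `^ p)).
  by rewrite le_powR ?addr_ge0//; lra.
by rewrite powRM// ler_wpM2l ?powR_ge0// lerDr powR_ge0.
Qed.

(** [na], [nb], ... stand for norms of vectors of a Hilbert space and [ab],
    [a'b] for inner products: the map [a |-> |a|^th a] is locally Lipschitz. *)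
Lemma powR_weighted_inner_lip th M na na' nd nb ab a'b : 0 <= th ->
  0 <= na -> 0 <= na' -> 0 <= nd -> 0 <= nb -> na <= M -> na' <= M ->
  `|na - na'| <= nd -> `|ab - a'b| <= nd * nb -> `|a'b| <= na' * nb ->
  `|na `^ th * ab - na' `^ th * a'b| <= (2 + th) * M `^ th * nd * nb.
Proof.
move=> th0 a0 a0' d0 b0 aM aM' dn dab da'b.
have -> : na `^ th * ab - na' `^ th * a'b =
  na `^ th * (ab - a'b) + (na `^ th - na' `^ th) * a'b by ring.
apply: le_trans (ler_normD _ _) _; rewrite !normrM [X in X * _ + _]ger0_norm ?powR_ge0//.
have H1 : na `^ th * `|ab - a'b| <= M `^ th * (nd * nb).
  by rewrite ler_pM ?powR_ge0// le_powR.
have H2 : `|na `^ th - na' `^ th| * `|a'b| <= (1 + th) * M `^ th * nd * nb.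
  apply: (@le_trans _ _ (`|na `^ th - na' `^ th| * (na' * nb))); first by rewrite ler_wpM2l.
  rewrite mulrA ler_wpM2r// mulrC.
  apply: le_trans (powR_lip th0 a0' a0 aM' aM) _.
  by rewrite distrC ler_wpM2l// mulr_ge0 ?powR_ge0//; lra.
by lra.
Qed.

End PowerInequalities.

(** * Exponential series with geometrically bounded coefficients *)

Section ExponentialSeries.
Context {R : realType}.
Implicit Types (b : nat -> R) (t : R).

(** The exponential of [t] times a linear map at one coordinate, where [b k] is
    that coordinate of the [k]-th iterate. *)
Definition expser b t : R := limn (series (fun k => exp_coeff t k * b k)).

(** Satisfied by the iterates of a finite matrix; it makes the exponential series
    and all its derivatives converge. *)
Definition geom_bounded b := exists M C : R, [/\ 0 <= M, 0 <= C & forall k, `|b k| <= M * C ^+ k].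

Lemma geom_bounded_shift b : geom_bounded b -> geom_bounded (fun k => b k.+1).
Proof.
move=> [M [C [M0 C0 H]]]; exists (M * C), C; split=> [|//|k]; first exact: mulr_ge0.
by apply: le_trans (H _) _; rewrite exprS mulrA.
Qed.

Lemma expser_normed_cvg b t : geom_bounded b ->
  cvgn [normed series (fun k => exp_coeff t k * b k)].
Proof.
move=> [M [C [M0 C0 H]]].
apply: (@series_le_cvg _ _ (fun k => M * exp_coeff (`|t| * C) k)).
- by move=> k; exact: normr_ge0.
- by move=> k; rewrite mulr_ge0// exp_coeff_ge0// mulr_ge0.
- move=> k /=; rewrite normrM /exp_coeff/= normrM normrX exprMn.
  rewrite [X in _ * X * _]ger0_norm ?invr_ge0//.
  have := H k; move: (b k) => x /(ler_wpM2l (_ : 0 <= `|t| ^+ k / k`!%:R)).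
  rewrite mulr_ge0 ?invr_ge0 ?exprn_ge0// => /(_ isT)/le_trans; apply.
  by rewrite le_eqVlt; apply/orP; left; apply/eqP; ring.
- have := @is_cvg_seriesZ _ (exp_coeff (`|t| * C)) M (is_cvg_series_exp_coeff _).
  by [].
Qed.

Lemma expser_cvg b t : geom_bounded b -> cvgn (series (fun k => exp_coeff t k * b k)).
Proof. by move=> bb; apply: normed_cvg; exact: expser_normed_cvg. Qed.

Let expser_pseries b t : series (fun k => exp_coeff t k * b k) =
  pseries (fun k => b k / k`!%:R) t.
Proof.
by apply/funext => n; rewrite /pseries /series/=; apply: eq_bigr => k _; rewrite /exp_coeff/=; ring.
Qed.

Let expser_diffs b : pseries_diffs (fun k => b k / k`!%:R) = fun k => b k.+1 / k`!%:R.
Proof.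
apply/funext => k; rewrite /pseries_diffs factS natrM.
have : k.+1%:R != 0 :> R by rewrite pnatr_eq0.
have : k`!%:R != 0 :> R by rewrite pnatr_eq0 -lt0n fact_gt0.
by move: k.+1%:R k`!%:R => x y x0 y0; field; rewrite x0 y0.
Qed.

(** As for any exponential generating function, differentiation shifts the
    coefficients. *)
Lemma expser_is_derive b t : geom_bounded b ->
  is_derive t 1 (expser b) (expser (fun k => b k.+1) t).
Proof.
move=> bb; have bb1 := geom_bounded_shift bb; have bb2 := geom_bounded_shift bb1.
have := @pseries_snd_diffs R (fun k => b k / k`!%:R) (`|t| + 1) t.
rewrite !expser_diffs -!expser_pseries => /(_ (expser_cvg bb) (expser_cvg bb1) (expser_cvg bb2)).
rewrite (ger0_norm (addr_ge0 (normr_ge0 t) ler01)) ltrDl ltr01 => /(_ isT).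
congr (is_derive _ _ _ _).
by apply/funext => x; rewrite -expser_pseries.
Qed.

Lemma expser0 b : expser b 0 = b 0%N.
Proof.
apply: lim_near_cst => //; near=> m; rewrite -[m]prednK; last by near: m.
rewrite /series /= big_nat_recl//= big1 ?addr0.
  by rewrite /exp_coeff/= expr0 fact0 divr1 mul1r.
by move=> i _; rewrite /exp_coeff /= expr0n/= !mul0r.
Unshelve. all: by end_near. Qed.

Lemma expserD b b' t : geom_bounded b -> geom_bounded b' ->
  expser (fun k => b k + b' k) t = expser b t + expser b' t.
Proof.
move=> bb bb'; rewrite /expser -lim_seriesD; [|exact: expser_cvg|exact: expser_cvg].
by congr (limn (series _)); apply/funext => k /=; rewrite mulrDr.
Qed.

Lemma expserZ c b t : geom_bounded b -> expser (fun k => c * b k) t = c * expser b t.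
Proof.
move=> bb; rewrite /expser -[RHS]/(c *: _) -lim_seriesZ; last exact: expser_cvg.
by congr (limn (series _)); apply/funext => k /=; rewrite mulrCA.
Qed.

Lemma geom_boundedD b b' : geom_bounded b -> geom_bounded b' ->
  geom_bounded (fun k => b k + b' k).
Proof.
move=> [M [C [M0 C0 H]]] [M' [C' [M0' C0' H']]].
exists (M + M'), (Num.max C C'); split=> [||k]; first exact: addr_ge0.
  by rewrite le_max C0.
apply: le_trans (ler_normD _ _) _; rewrite mulrDl; apply: lerD.
  by apply: le_trans (H k) _; rewrite ler_wpM2l// lerXn2r ?nnegrE// le_max ?C0 ?lexx.
by apply: le_trans (H' k) _; rewrite ler_wpM2l// lerXn2r ?nnegrE// le_max ?C0 ?lexx ?orbT.
Qed.

Lemma geom_boundedZ c b : geom_bounded b -> geom_bounded (fun k => c * b k).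
Proof.
move=> [M [C [M0 C0 H]]]; exists (`|c| * M), C; split=> [|//|k]; first exact: mulr_ge0.
by rewrite normrM -mulrA ler_wpM2l.
Qed.

Lemma geom_bounded_sum (V : Type) (s : seq V) (w : V -> R) (b : V -> nat -> R) :
  (forall y, geom_bounded (b y)) ->
  geom_bounded (fun k => \sum_(y <- s) w y * b y k).
Proof.
move=> bb; elim: s => [|y s IH].
  by exists 0, 0; split => // k; rewrite big_nil normr0 mul0r.
have -> : (fun k => \sum_(z <- y :: s) w z * b z k) =
    (fun k => w y * b y k + \sum_(z <- s) w z * b z k).
  by apply/funext => k; rewrite big_cons.
by apply: geom_boundedD => //; exact: geom_boundedZ.
Qed.

Lemma expser_sum (V : Type) (s : seq V) (w : V -> R) (b : V -> nat -> R) t :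
  (forall y, geom_bounded (b y)) ->
  expser (fun k => \sum_(y <- s) w y * b y k) t = \sum_(y <- s) w y * expser (b y) t.
Proof.
move=> bb; elim: s => [|y s IH].
  have b0 : geom_bounded (fun _ : nat => 0 : R).
    by exists 0, 0; split => // k; rewrite normr0 mul0r.
  under eq_fun do rewrite big_nil.
  rewrite big_nil -[RHS](mul0r (expser (fun=> 0) t)) -expserZ//.
  by congr expser; apply/funext => k; rewrite mul0r.
have -> : (fun k => \sum_(z <- y :: s) w z * b z k) =
    (fun k => w y * b y k + \sum_(z <- s) w z * b z k).
  by apply/funext => k; rewrite big_cons.
rewrite expserD ?big_cons ?IH ?expserZ//; first exact: geom_boundedZ.
exact: geom_bounded_sum.
Qed.

Lemma expser_geom c t : expser (fun k => c ^+ k) t = expR (c * t).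
Proof.
rewrite /expser /expR; congr (limn (series _)); apply/funext => k.
by rewrite /exp_coeff/= exprMn; ring.
Qed.

End ExponentialSeries.

(** * Dirichlet heat kernels of finite sets *)

Section Dirichlet.
Context {R : realType} {V : countType} (G : weighted_graph R V).
Hypothesis Glf : locally_finite G.
Local Notation mu := (vmeas G).
Implicit Types (x y : V) (u v : V -> R) (t : R).

Let mu0 x : 0 < mu x := vmeas_gt0 G x.

Definition edge_weight x y : R := if edge G x y then weight G x y else 0.
Definition degree x : R := \sum_(y \in [set y | edge G x y]) weight G x y.

Let edge_weight_sym x y : edge_weight x y = edge_weight y x.
Proof.
rewrite /edge_weight (edge_sym G y x).
by case: ifP => // xy; rewrite weight_sym.
Qed.

Let edge_weight_ge0 x y : 0 <= edge_weight x y.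
Proof. by rewrite /edge_weight; case: ifP => // xy; exact: ltW (weight_gt0 xy). Qed.

Let sum_edges_restr (r : seq V) x (F : V -> R) : uniq r ->
  (forall y, y \notin r -> F y = 0) ->
  \sum_(y \in [set y | edge G x y]) F y = \sum_(y <- r) (if edge G x y then F y else 0).
Proof.
move=> ur Fr; rewrite fsbig_mkcond -(fsbig_widen [set` r] setT)//=.
  rewrite -fsbig_seq//; apply: eq_bigr => y _.
  by rewrite patchE mem_setE.
move=> y [_ /=] /negP yr; rewrite /preimage /= patchE Fr//.
by case: ifP.
Qed.

Lemma edge_weight_degree (r : seq V) x : uniq r ->
  \sum_(y <- r) edge_weight x y <= degree x.
Proof.
move=> ur; have finE := Glf x.
pose s := undup (r ++ fset_set [set y | edge G x y]).
have -> : degree x = \sum_(y <- s) edge_weight x y.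
  rewrite /degree (_ : \sum_(y \in _) _ = \sum_(y \in [set y | edge G x y])
      (if y \in s then weight G x y else 0)).
    rewrite (@sum_edges_restr s) ?undup_uniq//.
      by rewrite big_seq [RHS]big_seq; apply: eq_bigr => y ->.
    by move=> y /negbTE ->.
  apply: eq_fsbigr => y xy; have -> // : y \in s.
  by rewrite /s mem_undup mem_cat in_fset_set// xy orbT.
rewrite [leRHS](bigID (mem r))/= -[leLHS]addr0 lerD ?sumr_ge0//.
rewrite -[leRHS]big_filter (perm_big [seq y <- s | y \in r])//.
apply: uniq_perm; rewrite ?filter_uniq ?undup_uniq// => y.
by rewrite mem_filter mem_undup mem_cat; case: (y \in r).
Qed.

(** The rows outside [r] vanish; edges from [r] to its complement still count in
    the degree, which is the killing of the process at the boundary. *)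
Definition dirichlet_matrix (r : seq V) x y : R :=
  if x \in r then (mu x)^-1 * (edge_weight x y - (x == y)%:R * degree x) else 0.

Lemma dirichlet_laplacianE (r : seq V) u x : uniq r ->
  dirichlet_laplacian G [set` r] u x = \sum_(y <- r) dirichlet_matrix r x y * u y.
Proof.
move=> ur; rewrite /dirichlet_laplacian /laplacian /dirichlet_matrix.
rewrite indicE mem_setE; have [xr|xr] := boolP (x \in r); last first.
  by rewrite mul0r big1// => y _; rewrite mul0r.
rewrite !mul1r; under [RHS]eq_bigr do rewrite -mulrA; rewrite -mulr_sumr; congr (_ * _).
under [RHS]eq_bigr do rewrite mulrBl; rewrite [RHS]sumrB.
rewrite [X in _ = _ - X](_ : _ = degree x * u x); last first.
  rewrite (big_rem x)//= eqxx mul1r big1_seq ?addr0// => y /andP[_].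
  by rewrite rem_filter// mem_filter /= eq_sym => /andP[/negbTE -> _]; rewrite !mul0r.
transitivity (\sum_(y \in [set y | edge G x y])
    (weight G x y * (\1_[set` r] y * u y) - weight G x y * u x)).
  by apply: eq_fsbigr => y _; rewrite mulrBr.
rewrite !fsbig_finite//; try exact: Glf.
rewrite sumrB -!fsbig_finite//; try exact: Glf.
congr (_ - _); last by rewrite /degree !fsbig_finite//; try exact: Glf; rewrite mulr_suml.
rewrite (@sum_edges_restr r)//.
  apply: eq_big_seq => y yr; rewrite /edge_weight indicE mem_setE yr mul1r.
  by case: ifP; rewrite ?mul0r.
by move=> y /negbTE yr; rewrite indicE mem_setE yr mul0r mulr0.
Qed.

Section Fixed.
Variable r : seq V.
Hypothesis ur : uniq r.
Let L u x : R := \sum_(y <- r) dirichlet_matrix r x y * u y.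
Let dot u v : R := \sum_(x <- r) mu x * u x * v x.

Let matrix_sym x y : x \in r -> y \in r ->
  mu x * dirichlet_matrix r x y = mu y * dirichlet_matrix r y x.
Proof.
move=> xr yr; rewrite /dirichlet_matrix xr yr !mulVKf ?gt_eqF// edge_weight_sym eq_sym.
by case: eqVneq => [->//|_]; rewrite !mul0r.
Qed.

Let L_sym u v : dot (L u) v = dot u (L v).
Proof.
rewrite /dot /L; under eq_bigr do rewrite mulr_sumr mulr_suml.
under [RHS]eq_bigr do rewrite mulr_sumr.
rewrite exchange_big/=; apply: eq_big_seq => y yr; apply: eq_big_seq => x xr.
by rewrite mulrA (matrix_sym xr yr); ring.
Qed.

(** By symmetry, [2 u x u y <= u x ^ 2 + u y ^ 2] summed over the edges inside [r]
    is bounded by the degrees, which also count the edges leaving [r]. *)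
Let L_neg u : dot (L u) u <= 0.
Proof.
have -> : dot (L u) u = \sum_(x <- r) \sum_(y <- r) edge_weight x y * u y * u x
    - \sum_(x <- r) degree x * u x ^+ 2.
  rewrite /dot -sumrB; apply: eq_big_seq => x xr.
  rewrite /L /dirichlet_matrix xr.
  under eq_bigr do rewrite -mulrA; rewrite -mulr_sumr mulVKf ?gt_eqF//.
  under eq_bigr do rewrite mulrBl; rewrite sumrB mulrBl; congr (_ - _).
    by rewrite mulr_suml.
  rewrite (big_rem x)//= eqxx mul1r big1_seq ?addr0//.
    by rewrite expr2 mulrA.
  move=> y /andP[_].
  by rewrite rem_filter// mem_filter /= eq_sym => /andP[/negbTE -> _]; rewrite !mul0r.
rewrite subr_le0.
apply: (@le_trans _ _ (\sum_(x <- r) \sum_(y <- r) edge_weight x y * (u x ^+ 2 + u y ^+ 2) / 2)).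
  apply: ler_sum => x _; apply: ler_sum => y _.
  rewrite -!mulrA ler_wpM2l//; have := sqr_ge0 (u x - u y); lra.
have -> : \sum_(x <- r) \sum_(y <- r) edge_weight x y * (u x ^+ 2 + u y ^+ 2) / 2 =
    \sum_(x <- r) \sum_(y <- r) edge_weight x y * u x ^+ 2.
  have E : \sum_(x <- r) \sum_(y <- r) edge_weight x y * u y ^+ 2 =
      \sum_(x <- r) \sum_(y <- r) edge_weight x y * u x ^+ 2.
    by rewrite exchange_big/=; apply: eq_bigr => x _; apply: eq_bigr => y _;
       rewrite edge_weight_sym.
  transitivity ((\sum_(x <- r) \sum_(y <- r) edge_weight x y * u x ^+ 2 +
      \sum_(x <- r) \sum_(y <- r) edge_weight x y * u y ^+ 2) / 2); last by rewrite E; lra.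
  rewrite -big_split/= mulr_suml; apply: eq_bigr => x _.
  by rewrite -big_split/= mulr_suml; apply: eq_bigr => y _; ring.
apply: ler_sum => x _; rewrite -mulr_suml ler_wpM2r ?sqr_ge0//.
exact: edge_weight_degree.
Qed.

Let delta y : V -> R := \1_([set` r] `&` [set y]).
Let a y k x : R := iter k L (delta y) x.

Let deltaE y x : delta y x = ((x \in r) && (x == y))%:R.
Proof.
rewrite /delta indicE; congr (nat_of_bool _)%:R; apply/idP/idP.
  by move=> /set_mem[/= -> ->]; rewrite eqxx.
by move=> /andP[xr /eqP xy]; apply/mem_set; split.
Qed.

Lemma dirichlet_iter_bounded y x : geom_bounded (fun k => iter k L (delta y) x).
Proof.
pose C := \sum_(z <- r) \sum_(w <- r) `|dirichlet_matrix r z w|.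
have C0 : 0 <= C by apply: sumr_ge0 => z _; apply: sumr_ge0.
exists 1, C; split => // k; rewrite mul1r.
elim: k x => [|k IH] x; first by rewrite /= deltaE expr0; case: (_ && _); rewrite ?normr1 ?normr0.
rewrite iterS /L exprS; apply: le_trans (ler_norm_sum _ _ _) _.
apply: (@le_trans _ _ (\sum_(w <- r) `|dirichlet_matrix r x w| * C ^+ k)).
  by apply: ler_sum => w _; rewrite normrM ler_wpM2l.
rewrite -mulr_suml ler_wpM2r ?exprn_ge0//.
have [xr|xr] := boolP (x \in r).
  by rewrite /C [leRHS](big_rem x)//= lerDl; apply: sumr_ge0 => z _; apply: sumr_ge0.
by rewrite big1// => w _; rewrite /dirichlet_matrix (negbTE xr) normr0.
Qed.

Let a_bound y x : geom_bounded (fun k => a y k x) := dirichlet_iter_bounded y x.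

Let iter_dirichlet k u : iter k (dirichlet_laplacian G [set` r]) u = iter k L u.
Proof.
by elim: k => [//|k IH]; rewrite !iterS IH; apply/funext => x; rewrite dirichlet_laplacianE.
Qed.

Lemma dirichlet_heat_kernelE t x y :
  dirichlet_heat_kernel G [set` r] t x y =
  expser (fun k => iter k L (delta y) x) t / mu y.
Proof.
rewrite /dirichlet_heat_kernel /expser -/(delta y).
by under eq_fun do rewrite iter_dirichlet.
Qed.

Let D y t x := expser (fun k => a y k x) t.

Let D_derive y t x : is_derive t 1 (fun t => D y t x) (L (D y t) x).
Proof.
have := @expser_is_derive R (fun k => a y k x) t (a_bound y x).
have -> // : expser (fun k => a y k.+1 x) t = L (D y t) x.
rewrite /L /D -(@expser_sum R V r (dirichlet_matrix r x) (fun z k => a y k z) t)//.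
Qed.

Lemma dirichlet_heat_kernel_derive t x y :
  is_derive t 1 (fun t => dirichlet_heat_kernel G [set` r] t x y)
    ((mu y)^-1 * L (D y t) x).
Proof.
have -> : (fun t => dirichlet_heat_kernel G [set` r] t x y) =
    (fun t => (mu y)^-1 *: D y t x).
  by apply/funext => t'; rewrite dirichlet_heat_kernelE mulrC.
exact: is_deriveZ.
Qed.

Lemma dirichlet_heat_kernel_out t x y : (x \notin r) || (y \notin r) ->
  dirichlet_heat_kernel G [set` r] t x y = 0.
Proof.
move=> xyr; rewrite dirichlet_heat_kernelE.
have -> : (fun k => iter k L (delta y) x) = (fun k => 0 * 0 ^+ k).
  apply/funext => k; rewrite mul0r.
  have [yr|yr] := boolP (y \in r).
    move: xyr; rewrite yr orbF => xr; case: k => [|k]/=; first by rewrite deltaE (negbTE xr).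
    by rewrite /L big1// => w _; rewrite /dirichlet_matrix (negbTE xr) mul0r.
  elim: k {xyr} x => [|k IH] x /=.
    by rewrite deltaE; case: eqVneq => [->|_]; rewrite ?(negbTE yr)// andbF.
  by rewrite /L big1// => w _; rewrite IH mulr0.
by rewrite expserZ ?mul0r//; exists 1, 0; split=> // k; rewrite mul1r ger0_norm// exprn_ge0.
Qed.

(** The matrix is self-adjoint for [mu], hence so are its powers. *)
Let mu_a k x y : x \in r -> y \in r -> mu x * a y k x = mu y * a x k y.
Proof.
have dotd z u : z \in r -> dot (delta z) u = mu z * u z.
  move=> zr; rewrite /dot (big_rem z)//= big1_seq ?addr0; first by rewrite deltaE zr eqxx mulr1.
  move=> w /andP[_]; rewrite rem_filter// mem_filter/= deltaE => /andP[/negbTE -> _].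
  by rewrite andbF mulr0 mul0r.
have dotC u v : dot u v = dot v u by apply: eq_bigr => z _; ring.
have iterL u v : dot (iter k L u) v = dot u (iter k L v).
  by elim: k u v => [//|k IH] u v; rewrite iterSr IH [in RHS]iterS L_sym.
by move=> xr yr; rewrite /a -dotd// -iterL dotC dotd// dotC.
Qed.

Lemma dirichlet_heat_kernel_sym t x y :
  dirichlet_heat_kernel G [set` r] t x y = dirichlet_heat_kernel G [set` r] t y x.
Proof.
have [/andP[xr yr]|] := boolP ((x \in r) && (y \in r)); last first.
  by rewrite negb_and => h; rewrite !dirichlet_heat_kernel_out// orbC.
rewrite !dirichlet_heat_kernelE.
have -> : (fun k => iter k L (delta y) x) = (fun k => (mu y / mu x) * a x k y).
  apply/funext => k; have := mu_a k xr yr; rewrite -/(a y k x).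
  move=> h; apply: (@mulfI _ (mu x)); rewrite ?gt_eqF// h.
  by field; rewrite gt_eqF.
rewrite expserZ//; rewrite -/(D x t y); move: (D x t y) => d.
by field; rewrite !gt_eqF.
Qed.

(** The l2 energy of the Dirichlet heat flow is nonincreasing. This bounds the
    Dirichlet kernels independently of the finite set. *)
Lemma dirichlet_heat_kernel_le t x y : 0 <= t ->
  dirichlet_heat_kernel G [set` r] t x y <= Num.sqrt (mu y / mu x) / mu y.
Proof.
move=> t0; have [/andP[xr yr]|] := boolP ((x \in r) && (y \in r)); last first.
  rewrite negb_and => h; rewrite dirichlet_heat_kernel_out//.
  by rewrite divr_ge0 ?sqrtr_ge0// ltW.
rewrite dirichlet_heat_kernelE ler_wpM2r ?invr_ge0 ?(ltW (mu0 _))// -/(D y t x).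
pose E t := dot (D y t) (D y t).
have EE : E = \sum_(z <- r) (fun t => mu z * D y t z * D y t z).
  by apply/funext => t'; rewrite fct_sumE.
have dE (s : R) : is_derive s 1 E (2 * dot (L (D y s)) (D y s)).
  have -> : 2 * dot (L (D y s)) (D y s) = \sum_(z <- r) 2 * (mu z * L (D y s) z * D y s z).
    by rewrite /dot mulr_sumr.
  rewrite EE; elim: (r) => [|z s' IH].
    by rewrite !big_nil; exact: is_derive_cst.
  rewrite !big_cons; apply: is_deriveD.
  have dz := D_derive y s z.
  have -> : (fun t => mu z * D y t z * D y t z) =
     mu z *: ((fun t => D y t z) * (fun t => D y t z)).
    by apply/funext => t'; rewrite -mulrA.
  have := is_deriveZ (mu z) (is_deriveM dz dz).
  congr (is_derive _ _ _ _).
  by rewrite /GRing.scale/=; ring.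
have Et : E t <= E 0.
  have [|c _ Ec] := @MVT_segment R E (fun s => 2 * dot (L (D y s)) (D y s)) 0 t t0
      (fun s _ => dE s).
    apply: continuous_subspaceT => s; apply/differentiable_continuous.
    by apply/derivable1_diffP; have [] := dE s.
  rewrite -subr_le0 Ec subr0; apply: mulr_le0_ge0 => //.
  by apply: mulr_ge0_le0 => //; exact: L_neg.
have D0 z : D y 0 z = delta y z by rewrite /D expser0.
have E0 : E 0 = mu y.
  rewrite /E /dot (big_rem y)//= big1_seq ?addr0; first by rewrite !D0 deltaE yr eqxx !mulr1.
  move=> w /andP[_]; rewrite rem_filter// mem_filter/= !D0 deltaE => /andP[/negbTE -> _].
  by rewrite andbF mulr0.
have : mu x * D y t x ^+ 2 <= mu y.
  rewrite -E0; apply: le_trans Et; rewrite /E /dot (big_rem x)//= -mulrA lerDl.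
  by apply: sumr_ge0 => z _; rewrite -mulrA mulr_ge0 ?(ltW (mu0 z))// -expr2 sqr_ge0.
rewrite mulrC -ler_pdivlMr// => H.
apply: le_trans (ler_norm _) _; rewrite -sqrtr_sqr ler_wsqrtr//.
Qed.

End Fixed.

End Dirichlet.

(** * Integrals of powers *)

Section PowerIntegrals.
Context {R : realType}.
Local Notation leb := (@lebesgue_measure R).
Implicit Types (a b c s t : R).

Lemma continuous_powR c t : 0 < t -> {for t, continuous (fun x => x `^ c)}.
Proof.
move=> t0; apply: differentiable_continuous; apply/derivable1_diffP.
by apply: derivable_powR; rewrite in_itv/= t0.
Qed.

Lemma integral_powR a b c : 0 < a -> a < b -> c != 0 ->
  (\int[leb]_(t in `[a, b]) (t `^ (c - 1))%:E = ((b `^ c - a `^ c) / c)%:E)%E.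
Proof.
move=> a0 ab c0.
rewrite (@continuous_FTC2 _ _ (fun t => c^-1 * t `^ c) a b ab).
- by rewrite -EFinB -mulrBr mulrC.
- apply: continuous_in_subspaceT => t; rewrite inE/= in_itv/= => /andP[at1 _].
  by apply: continuous_powR; exact: lt_le_trans at1.
- have cF t : 0 < t -> {for t, continuous (fun t => c^-1 * t `^ c)}.
    by move=> t0; apply: cvgM; [exact: cvg_cst|exact: continuous_powR].
  split.
  + move=> t; rewrite in_itv/= => /andP[at1 _].
    apply: derivableM; first exact: derivable_cst.
    by apply: derivable_powR; rewrite in_itv/= (lt_trans a0).
  + by apply: cvg_at_right_filter; exact: cF.
  + by apply: cvg_at_left_filter; apply: cF; exact: lt_trans ab.
- move=> t; rewrite in_itv/= => /andP[at1 _].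
  have t0 : 0 < t by exact: lt_trans at1.
  rewrite derive1E.
  have -> : (fun t : R => c^-1 * t `^ c) = c^-1 *: (fun t : R => t `^ c) by [].
  rewrite deriveZ; last by have [] := @is_derive1_powR R c t t0.
  have [_ ->] := @is_derive1_powR R c t t0.
  by rewrite /GRing.scale/= mulKf.
Qed.

(** Monotone convergence along an exhaustion, for integrals improper at one end. *)
Lemma ge0_integral_bigcup_le (F : (set R)^nat) (D : set R) (f : R -> R) (M : \bar R) :
  D = \bigcup_n F n -> nondecreasing_seq F -> (forall n, measurable (F n)) ->
  measurable_fun D f -> (forall x, D x -> 0 <= f x) ->
  (forall n, \int[leb]_(x in F n) (f x)%:E <= M)%E ->
  (\int[leb]_(x in D) (f x)%:E <= M)%E.
Proof.
move=> DE ndF mF mf f0 FM.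
have FD n : F n `<=` D by rewrite DE; exact: bigcup_sup.
have mD : measurable D by rewrite DE; exact: bigcup_measurable.
have mfE : measurable_fun D (EFin \o f) by exact/measurable_EFinP.
have h := @ge0_nondecreasing_set_cvg_integral _ (measurableTypeR R) R F (EFin \o f) leb ndF mF
  (fun n => measurable_funS mD (FD n) mfE) (fun n x Fx => f0 x (FD n x Fx)).
rewrite DE; rewrite -(cvg_lim _ h)//; apply: lime_le.
  by apply/cvg_ex; eexists; exact: h.
by apply: nearW.
Qed.

Let mpow D c : measurable_fun D (fun t : R => (t `^ c)%:E).
Proof. by apply/measurable_EFinP; apply: measurable_funTS; exact: measurable_powR. Qed.

Lemma integral_powR_01 c : 0 < c ->
  (\int[leb]_(t in `]0%R, 1%R]) (t `^ (c - 1))%:E <= c^-1%:E)%E.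
Proof.
move=> c0; apply: (@ge0_integral_bigcup_le (fun n => `[n.+2%:R^-1, 1%R]%classic)).
- apply/seteqP; split=> [t|t [n _]] /=.
    rewrite in_itv/= => /andP[t0 t1].
    have [n Hn] : exists n : nat, t^-1 < n%:R by eexists; apply: archi_boundP; rewrite invr_ge0 ltW.
    exists n => //=; rewrite in_itv/= t1 andbT.
    rewrite -[leRHS]invrK lef_pV2 ?posrE ?invr_gt0//.
    by apply: le_trans (ltW Hn) _; rewrite ler_nat; lia.
  rewrite !in_itv/= => /andP[h1 ->]; rewrite andbT.
  by apply: lt_le_trans h1; rewrite invr_gt0.
- apply/nondecreasing_seqP => n; rewrite subsetEset => t /=; rewrite !in_itv/= => /andP[h1 ->].
  by rewrite andbT; apply: le_trans h1; rewrite lef_pV2 ?posrE// ler_nat.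
- by [].
- by apply: measurable_funTS; exact: measurable_powR.
- by move=> t _; exact: powR_ge0.
- move=> n; rewrite integral_powR ?gt_eqF ?invr_gt0//; last first.
    by rewrite invf_lt1// ltr1n.
  by rewrite lee_fin powR1 ler_pdivrMr// mulVf ?gt_eqF// lerBlDr lerDl powR_ge0.
Qed.

Lemma integral_powR_1y c : c < 0 ->
  (\int[leb]_(t in `[1%R, +oo[) (t `^ (c - 1))%:E <= (- c)^-1%:E)%E.
Proof.
move=> c0; apply: (@ge0_integral_bigcup_le (fun n => `[1%R, n.+2%:R]%classic)).
- apply/seteqP; split=> [t|t [n _]] /=.
    rewrite in_itv/= andbT => t1.
    have [n Hn] : exists n : nat, t < n%:R.
      by eexists; apply: archi_boundP; apply: le_trans t1.
    exists n => //=; rewrite in_itv/= t1/=.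
    by apply: le_trans (ltW Hn) _; rewrite ler_nat; lia.
  by rewrite !in_itv/= => /andP[-> _].
- apply/nondecreasing_seqP => n; rewrite subsetEset => t /=; rewrite !in_itv/= => /andP[-> h1].
  by apply: le_trans h1 _; rewrite ler_nat.
- by [].
- by apply: measurable_funTS; exact: measurable_powR.
- by move=> t _; exact: powR_ge0.
- move=> n; rewrite integral_powR ?lt_eqF ?ltr1n//.
  rewrite lee_fin powR1.
  have -> : (n.+2%:R `^ c - 1) / c = (1 - n.+2%:R `^ c) * (- c)^-1.
    by field; rewrite lt_eqF.
  by rewrite ler_piMl ?invr_ge0 ?oppr_ge0 ?(ltW c0)// lerBlDr lerDl powR_ge0.
Qed.

(** As [0 < s < 1], the power [t^(-s)] is integrable at 0 and [t^(-1-s)] at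
    infinity. *)
Lemma integral_powR_majorized (s : R) (f : R -> R) (c c' : R) : 0 < s < 1 ->
  0 <= c -> 0 <= c' ->
  measurable_fun (`]0, +oo[%classic : set R) f -> (forall t, 0 < t -> 0 <= f t) ->
  (forall t, 0 < t -> f t <= c * t `^ (- s)) ->
  (forall t, 1 <= t -> f t <= c' * t `^ (- 1 - s)) ->
  (\int[leb]_(t in `]0%R, +oo[) (f t)%:E < +oo)%E.
Proof.
move=> /andP[s0 s1] c0 c'0 mf f0 f1 f2.
have mfE : measurable_fun (`]0, +oo[%classic : set R) (EFin \o f) by exact/measurable_EFinP.
have -> : `]0%R, +oo[%classic = `]0%R, 1%R] `|` `]1%R, +oo[ :> set R.
  by rewrite -itv_bndbnd_setU// bnd_simp.
rewrite ge0_integral_setU//=; last 3 first.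
- by rewrite -itv_bndbnd_setU// bnd_simp.
- move=> t [|]/=; rewrite in_itv/= => /andP[h _]; rewrite lee_fin f0//.
  exact: lt_trans h.
- apply/disj_setPRL => t /=; rewrite !in_itv/= => /andP[t1 _] /andP[_].
  by rewrite leNgt t1.
apply: lte_add_pinfty.
  apply: (@le_lt_trans _ _ (\int[leb]_(t in `]0%R, 1%R]) (c%:E * (t `^ ((1 - s) - 1))%:E))%E).
    apply: ge0_le_integral => //=.
    - by move=> t; rewrite in_itv/= => /andP[h _]; rewrite lee_fin f0.
    - by apply: measurable_funS mfE => //; apply: subset_itvl.
    - apply/measurable_EFinP; apply: measurable_funM; first exact: measurable_cst.
      by apply: measurable_funTS; exact: measurable_powR.
    - move=> t; rewrite in_itv/= => /andP[h _].
      rewrite -EFinM lee_fin; apply: le_trans (f1 t h) _.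
      by rewrite le_eqVlt; apply/orP; left; apply/eqP; congr (_ * _ `^ _); ring.
  rewrite ge0_integralZl//; last 2 first.
  - exact: mpow.
  - by move=> t _; rewrite lee_fin powR_ge0.
  rewrite lte_mul_pinfty//.
  by apply: le_lt_trans (integral_powR_01 _) (ltry _); lra.
apply: (@le_lt_trans _ _ (\int[leb]_(t in `]1%R, +oo[) (c'%:E * (t `^ ((- s) - 1))%:E))%E).
  apply: ge0_le_integral => //=.
  - by move=> t; rewrite in_itv/= andbT => h; rewrite lee_fin f0// (lt_trans _ h).
  - by apply: measurable_funS mfE => //; apply: subset_itvr; rewrite bnd_simp.
  - apply/measurable_EFinP; apply: measurable_funM; first exact: measurable_cst.
    by apply: measurable_funTS; exact: measurable_powR.
  - move=> t; rewrite in_itv/= andbT => h.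
    rewrite -EFinM lee_fin; apply: le_trans (f2 t (ltW h)) _.
    by rewrite le_eqVlt; apply/orP; left; apply/eqP; congr (_ * _ `^ _); ring.
rewrite ge0_integralZl//; last 2 first.
- exact: mpow.
- by move=> t _; rewrite lee_fin powR_ge0.
rewrite lte_mul_pinfty//.
apply: le_lt_trans (ltry (- - s)^-1); apply: le_trans (integral_powR_1y _); last by lra.
apply: ge0_subset_integral => //; first exact: mpow.
  by move=> t _; rewrite lee_fin powR_ge0.
by apply: subset_itvr; rewrite bnd_simp.
Qed.

Lemma integral_gt0_itv (f : R -> R) (a b c : R) : 0 <= a -> a < b -> 0 < c ->
  measurable_fun (`]0, +oo[%classic : set R) f -> (forall t, 0 < t -> 0 <= f t) ->
  (forall t, a < t < b -> c <= f t) ->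
  (0 < \int[leb]_(t in `]0%R, +oo[) (f t)%:E)%E.
Proof.
move=> a0 ab c0 mf f0 fc.
have mfE : measurable_fun (`]0, +oo[%classic : set R) (EFin \o f) by exact/measurable_EFinP.
have sub : `]a, b[ `<=` (`]0, +oo[ : set R).
  by move=> t /=; rewrite !in_itv/= andbT => /andP[h _]; exact: le_lt_trans h.
apply: (@lt_le_trans _ _ (\int[leb]_(t in `]a, b[) (cst c%:E) t)%E).
  rewrite integral_cst//= lebesgue_measure_itv/= lte_fin ab -EFinB -EFinM lte_fin.
  by rewrite mulr_gt0// subr_gt0.
apply: (@le_trans _ _ (\int[leb]_(t in `]a, b[) (f t)%:E)%E).
  apply: ge0_le_integral => //=.
  - by move=> t _; rewrite lee_fin ltW.
  - exact: measurable_funS mfE.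
apply: ge0_subset_integral => //.
by move=> t /=; rewrite in_itv/= andbT lee_fin => h; exact: f0.
Qed.

Lemma Gamma_gt0 (s : R) : 0 < s < 1 -> 0 < Gamma (1 - s).
Proof.
move=> s01; have /andP[s0 s1] := s01; rewrite /Gamma /Rintegral.
pose f t := t `^ (1 - s - 1) * expR (- t).
have mf : measurable_fun (`]0, +oo[ : set R) f.
  apply: measurable_funM; apply: measurable_funTS; first exact: measurable_powR.
  by apply: measurableT_comp => //; exact: measurable_oppr.
have f0 t : 0 < t -> 0 <= f t by move=> _; rewrite mulr_ge0 ?powR_ge0 ?expR_ge0.
apply: fine_gt0; apply/andP; split.
  apply: (@integral_gt0_itv f 1 2 (2 `^ (1 - s - 1) * expR (- 2))) => //; try by (rewrite ?mulr_gt0 ?powR_gt0 ?expR_gt0//; lra).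
  move=> t /andP[t1 t2]; apply: ler_pM; rewrite ?powR_ge0 ?expR_ge0//.
    rewrite (_ : 1 - s - 1 = - s); last by ring.
    rewrite !powRN lef_pV2 ?posrE ?powR_gt0//; try lra.
    by apply: ge0_ler_powR; rewrite ?nnegrE; lra.
  by rewrite ler_expR; lra.
apply: (@integral_powR_majorized s f 1 1 s01) => // t t0; rewrite mul1r.
  rewrite /f (_ : 1 - s - 1 = - s); last by ring.
  by rewrite ler_piMr ?powR_ge0// -expR0 ler_expR; lra.
have tp : 0 < t by lra.
rewrite /f (_ : 1 - s - 1 = - s); last by ring.
rewrite (_ : - 1 - s = - s - 1); last by ring.
have -> : t `^ (- s - 1) = t `^ (- s) * t^-1.
  rewrite (@powRD _ t (- s) (- 1)); first by rewrite powR_inv1// ltW.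
  by rewrite (gt_eqF tp) implybT.
rewrite ler_wpM2l ?powR_ge0//.
rewrite expRN lef_pV2 ?posrE ?expR_gt0//.
by have := expR_ge1Dx t; lra.
Qed.

End PowerIntegrals.

(** * The heat kernel and the fractional weights *)

Section HeatKernel.
Context {R : realType} {V : countType} (G : weighted_graph R V).
Hypothesis Glf : locally_finite G.
Hypothesis Gsc : stochastically_complete G.
Local Notation mu := (vmeas G).
Implicit Types (x y : V) (u v : V -> R) (t : R).

Let mu0 x : 0 < mu x := vmeas_gt0 G x.

Lemma finite_set_seq (A : set V) : finite_set A -> exists2 r : seq V, uniq r & A = [set` r].
Proof.
move=> fA; exists (fset_set A); first exact: fset_uniq.
by rewrite fset_setK.
Qed.

Let has_sup_dirichlet t x y : 0 <= t ->
  has_sup [set dirichlet_heat_kernel G Om t x y | Om in @finite_set V].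
Proof.
move=> t0; split; first by exists (dirichlet_heat_kernel G set0 t x y), set0 => //; exact: finite_set0.
exists (Num.sqrt (mu y / mu x) / mu y) => _ [Om /finite_set_seq[r ur ->] <-].
exact: dirichlet_heat_kernel_le.
Qed.

Lemma dirichlet_le_heat_kernel t x y (r : seq V) : 0 <= t -> uniq r ->
  dirichlet_heat_kernel G [set` r] t x y <= heat_kernel G t x y.
Proof.
move=> t0 ur; apply: (ub_le_sup (has_sup_dirichlet x y t0).2).
by exists [set` r] => //; exact: finite_seq.
Qed.

Lemma heat_kernel_ge0 t x y : 0 <= t -> 0 <= heat_kernel G t x y.
Proof.
move=> t0; have := @dirichlet_le_heat_kernel t x y [::] t0 isT.
by rewrite dirichlet_heat_kernel_out.
Qed.

Lemma heat_kernel_sym t x y : heat_kernel G t x y = heat_kernel G t y x.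
Proof.
rewrite /heat_kernel; congr sup; apply/seteqP; split=> _ [Om fOm <-]; exists Om => //.
  by have [r ur ->] := finite_set_seq fOm; exact: dirichlet_heat_kernel_sym.
by have [r ur ->] := finite_set_seq fOm; exact: dirichlet_heat_kernel_sym.
Qed.

(** The Dirichlet problem on the single vertex [x] is solved by an exponential,
    and it bounds the kernel from below. *)
Lemma heat_kernel_diag x : exists2 d : R, 0 <= d &
  forall t, 0 <= t -> expR (- (d * t)) <= heat_kernel G t x x * mu x.
Proof.
pose m := dirichlet_matrix G [:: x] x x.
have m0 : m <= 0.
  rewrite /m /dirichlet_matrix mem_seq1 eqxx mul1r mulr_ge0_le0 ?invr_ge0 ?(ltW (mu0 x))//.
  have := @edge_weight_degree R V G Glf [:: x] x isT.
  by rewrite big_seq1 subr_le0.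
exists (- m); first by rewrite oppr_ge0.
move=> t t0; rewrite -ler_pdivrMr//.
apply: le_trans (dirichlet_le_heat_kernel x x t0 (r := [:: x]) isT).
rewrite dirichlet_heat_kernelE// mulNr opprK -expser_geom ler_wpM2r ?invr_ge0 ?(ltW (mu0 x))//.
rewrite le_eqVlt; apply/orP; left; apply/eqP; congr expser; apply/funext => k.
have H (j : nat) : iter j (fun u z => \sum_(w <- [:: x]) dirichlet_matrix G [:: x] z w * u w)
    \1_([set` [:: x]] `&` [set x]) x = m ^+ j.
  elim: j => [|j IH]; last by rewrite iterS big_seq1 IH exprS.
  by rewrite /= indicE expr0 mem_set//; split => //=; rewrite mem_seq1.
by rewrite H.
Qed.

(** Stochastic completeness turns the lower bound on the return probability
    into an upper bound on the probability of being elsewhere. *)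
Lemma heat_kernel_off_diag x : exists2 d : R, 0 <= d &
  forall t (r : seq V), 0 < t -> uniq r -> x \notin r ->
    \sum_(y <- r) heat_kernel G t x y * mu y <= Num.min 1 (d * t).
Proof.
have [d d0 H] := heat_kernel_diag x; exists d => // t r t0 ur xr.
have uxr : uniq (x :: r) by rewrite /= xr.
have := @sum_le_esum R V setT (fun y => heat_kernel G t x y * mu y) _ uxr (fun _ _ => I).
rewrite (Gsc x t0) lee_fin big_cons => H1.
have H2 := H t (ltW t0); have := expR_ge1Dx (- (d * t)); have := expR_gt0 (- (d * t)).
rewrite le_min; move: H1 H2; set S := \sum_(y <- r) _.
by move=> *; apply/andP; split; lra.
Qed.

(** Finite subsets of a countable set can be enumerated, so the kernel is a
    countable supremum of functions that are smooth in [t]. *)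
Lemma measurable_heat_kernel x y :
  measurable_fun (`]0, +oo[%classic : set R) (fun t => heat_kernel G t x y).
Proof.
pose Om (n : nat) : seq V := undup (odflt [::] (choice.unpickle n)).
pose h (n : nat) t := dirichlet_heat_kernel G [set` (Om n : seq V)] t x y.
have hE t : heat_kernel G t x y = sups (h ^~ t) 0.
  rewrite /heat_kernel /sups /=; congr sup; apply/seteqP; split.
    move=> _ [A /finite_set_seq[r ur ->] <-]; exists (choice.pickle r) => //=.
    by rewrite /h /Om choice.pickleK /= undup_id.
  by move=> _ [n _ <-]; exists [set` (Om n : seq V)] => //; exact: finite_seq.
apply: (eq_measurable_fun (fun t => sups (h ^~ t) 0)) => [t _|]; first by rewrite hE.
apply: measurable_fun_sups.
  move=> t; rewrite /= in_itv/= andbT => t0.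
  exists (Num.sqrt (mu y / mu x) / mu y) => _ [n _ <-].
  by apply: dirichlet_heat_kernel_le; rewrite ?undup_uniq// ltW.
move=> n; apply: measurable_funTS; apply: continuous_measurable_fun => t.
apply: differentiable_continuous; apply/derivable1_diffP.
by have [] := @dirichlet_heat_kernel_derive R V G Glf (Om n) (undup_uniq _) t x y.
Qed.

(** The Dirichlet kernel of the pair [{x, y}] vanishes at time 0 with the positive
    derivative [weight x y / (mu x * mu y)]. *)
Lemma heat_kernel_edge x y : edge G x y -> x != y ->
  exists a b c : R, [/\ 0 < a, a < b, 0 < c & forall t, a < t < b -> c <= heat_kernel G t x y].
Proof.
move=> xy xney.
have ur : uniq [:: x; y] by rewrite /= mem_seq1 xney.
pose f t := dirichlet_heat_kernel G [set` [:: x; y]] t x y.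
have dl y' z : \1_([set` [:: x; y]] `&` [set y']) z = ((z \in [:: x; y]) && (z == y'))%:R :> R.
  rewrite indicE; congr (nat_of_bool _)%:R; apply/idP/idP.
    by move=> /set_mem[/= -> ->]; rewrite eqxx.
  by move=> /andP[zr /eqP zy]; apply/mem_set; split.
have gb : forall z : V, geom_bounded (fun k => iter k (fun u z =>
    \sum_(w <- [:: x; y]) dirichlet_matrix G [:: x; y] z w * u w)
    \1_([set` [:: x; y]] `&` [set y]) z) by move=> z; exact: dirichlet_iter_bounded.
have f0 : f 0 = 0.
  by rewrite /f dirichlet_heat_kernelE// expser0 /= dl (negbTE xney) andbF mul0r.
have df := @dirichlet_heat_kernel_derive R V G Glf _ ur 0 x y.
set l := _ * _ in df.
have l0 : 0 < l.
  have dy : ((y \in [:: x; y]) && (y == y)) = true by rewrite !inE eqxx orbT.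
  have dx : ((x \in [:: x; y]) && (x == y)) = false by rewrite (negbTE xney) andbF.
  rewrite /l !big_cons big_nil !expser0 /= !dl dx dy mulr0 add0r addr0 mulr1.
  rewrite /dirichlet_matrix mem_head (negbTE xney) mul0r subr0.
  by rewrite /edge_weight xy !mulr_gt0 ?invr_gt0//; exact: weight_gt0.
have [cf lf] := df.
have cvl : (fun h : R => h^-1 *: ((f \o shift 0) (h *: 1) - f 0)) @ 0^' --> l.
  by rewrite -lf; exact: cf.
have l20 : 0 < l / 2 by lra.
have ll : l / 2 < l by lra.
have [e /= e0 H] := cvgr_ge _ cvl _ ll.
exists (e / 2), e, (l / 2 * (e / 2)); split; [lra|lra|by rewrite mulr_gt0//; lra|].
move=> t /andP[t1 t2]; have tp : 0 < t by lra.
apply: le_trans (dirichlet_le_heat_kernel x y (ltW tp) ur).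
have := H t; rewrite /= sub0r normrN gtr0_norm// => /(_ t2).
rewrite gt_eqF// => /(_ isT); rewrite f0 subr0 addr0 /GRing.scale/= mulr1.
rewrite ler_pdivlMl// -/(f t) => h.
by apply: le_trans h; rewrite [leRHS]mulrC ler_wpM2l ?(ltW l20)// ltW.
Qed.

Section Weight.
Variable s : R.
Hypothesis s01 : 0 < s < 1.
Local Notation W := (frac_weight G s).

Let K0 : 0 < s / Gamma (1 - s).
Proof. by have /andP[s0 _] := s01; rewrite divr_gt0// Gamma_gt0. Qed.

Let integrand x y t := heat_kernel G t x y * t `^ (- 1 - s).

Let integrand_ge0 x y t : 0 < t -> 0 <= integrand x y t.
Proof. by move=> t0; rewrite mulr_ge0 ?powR_ge0// heat_kernel_ge0// ltW. Qed.

Let measurable_integrand x y : measurable_fun (`]0, +oo[%classic : set R) (integrand x y).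
Proof.
apply: measurable_funM; first exact: measurable_heat_kernel.
by apply: measurable_funTS; exact: measurable_powR.
Qed.

Let measurable_integrandE x y :
  measurable_fun (`]0, +oo[%classic : set R) (EFin \o integrand x y).
Proof. exact/measurable_EFinP. Qed.

Let measurable_mu_integrandE x y :
  measurable_fun (`]0, +oo[%classic : set R) (fun t => (mu y * integrand x y t)%:E).
Proof. by apply/measurable_EFinP; exact: measurable_funM. Qed.

Lemma frac_weight_ge0 x y : 0 <= W x y.
Proof.
rewrite /frac_weight; apply: mulr_ge0.
  exact: ltW (mulr_gt0 (mulr_gt0 K0 (mu0 x)) (mu0 y)).
apply: Rintegral_ge0 => t; rewrite /= in_itv/= andbT => t0; exact: integrand_ge0.
Qed.

Lemma frac_weight_sym x y : W x y = W y x.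
Proof.
rewrite /frac_weight; congr (_ * _); first by ring.
by congr fine; apply: eq_integral => t _; rewrite heat_kernel_sym.
Qed.

Let integrand_fin x y : x != y ->
  (\int[@lebesgue_measure R]_(t in `]0%R, +oo[) (integrand x y t)%:E < +oo)%E.
Proof.
move=> xy; have [d d0 H] := heat_kernel_off_diag x.
have H1 t : 0 < t -> heat_kernel G t x y * mu y <= Num.min 1 (d * t).
  by move=> t0; have := H t [:: y] t0 isT; rewrite big_seq1 mem_seq1; exact.
apply: (@integral_powR_majorized R s _ (d / mu y) (mu y)^-1 s01) => //.
- by rewrite divr_ge0// ltW.
- by rewrite invr_ge0 ltW.
- exact: integrand_ge0.
- move=> t t0; rewrite /integrand.
  have -> : t `^ (- s) = t * t `^ (- 1 - s).
    rewrite -{2}(powRr1 (ltW t0)) -powRD ?(gt_eqF t0) ?implybT//.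
    by congr (_ `^ _); ring.
  rewrite mulrA ler_wpM2r ?powR_ge0// mulrAC ler_pdivlMr//.
  by apply: le_trans (H1 t t0) _; rewrite ge_min lexx orbT.
- move=> t t1; have t0 : 0 < t by lra.
  rewrite /integrand ler_wpM2r ?powR_ge0// -[leRHS]mul1r ler_pdivlMr//.
  by apply: le_trans (H1 t t0) _; rewrite ge_min lexx.
Qed.

Let RintegralE x y : x != y ->
  (\int[@lebesgue_measure R]_(t in `]0%R, +oo[) (integrand x y t))%:E =
  (\int[@lebesgue_measure R]_(t in `]0%R, +oo[) (integrand x y t)%:E)%E.
Proof.
move=> xy; rewrite /Rintegral fineK// fin_numElt integrand_fin// andbT.
apply: lt_le_trans (ltNyr 0) _; apply: integral_ge0 => t; rewrite /= in_itv/= andbT lee_fin.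
exact: integrand_ge0.
Qed.

Lemma frac_weight_gt0 x y : edge G x y -> x != y -> 0 < W x y.
Proof.
move=> xy xney; have [a [b [c [a0 ab c0 H]]]] := heat_kernel_edge xy xney.
rewrite /frac_weight; apply: mulr_gt0; first exact: (mulr_gt0 (mulr_gt0 K0 (mu0 x)) (mu0 y)).
rewrite -lte_fin RintegralE//.
apply: (@integral_gt0_itv R _ a b (c * b `^ (- 1 - s))) => //.
- exact: ltW.
- by rewrite mulr_gt0// powR_gt0// (lt_trans a0).
- exact: integrand_ge0.
- move=> t tab; have /andP[t1 t2] := tab.
  have t0 : 0 < t by lra.
  have b0 : 0 < b by lra.
  apply: ler_pM; rewrite ?powR_ge0 ?(ltW c0)//; first exact: H.
  have -> : - 1 - s = - (1 + s) by ring.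
  have /andP[s0 _] := s01.
  by rewrite !powRN lef_pV2 ?posrE ?powR_gt0// ge0_ler_powR ?nnegrE; lra.
Qed.

(** Summation under the integral sign: the total weight is bounded by the integral
    of [min 1 (d t) * t^(-1-s)], up to a constant. *)
Lemma asum_frac_weight x : asum [set~ x] (W x).
Proof.
have [d d0 H] := heat_kernel_off_diag x.
pose g t := Num.min 1 (d * t) * t `^ (- 1 - s).
have mg : measurable_fun (`]0, +oo[%classic : set R) g.
  apply: measurable_funTS; apply: measurable_funM; last exact: measurable_powR.
  by apply: measurable_minr => //; exact: mulrl_measurable.
have g0 t : 0 < t -> 0 <= g t.
  by move=> t0; rewrite mulr_ge0 ?powR_ge0// le_min ler01 mulr_ge0// ltW.
have gfin : (\int[@lebesgue_measure R]_(t in `]0%R, +oo[) (g t)%:E < +oo)%E.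
  apply: (@integral_powR_majorized R s _ d 1 s01) => //.
  - move=> t t0; rewrite /g.
    have -> : t `^ (- s) = t * t `^ (- 1 - s).
      rewrite -{2}(powRr1 (ltW t0)) -powRD ?(gt_eqF t0) ?implybT//.
      by congr (_ `^ _); ring.
    by rewrite mulrA ler_wpM2r ?powR_ge0// ge_min lexx orbT.
  - by move=> t t1; rewrite /g ler_wpM2r ?powR_ge0// ge_min lexx.
pose M := fine (\int[@lebesgue_measure R]_(t in `]0%R, +oo[) (g t)%:E)%E.
apply: (@asum_bound _ _ _ _ (s / Gamma (1 - s) * mu x * M)) => r ur rD.
have xr : x \notin r by apply/negP => /rD /=; exact.
have xy y : y \in r -> x != y by move=> yr; apply/eqP => xy; have := rD y yr; rewrite xy; exact.
have -> : \sum_(y <- r) `|W x y| = s / Gamma (1 - s) * mu x *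
    \sum_(y <- r) mu y * (\int[@lebesgue_measure R]_(t in `]0%R, +oo[) integrand x y t).
  rewrite mulr_sumr; apply: eq_bigr => y _; rewrite ger0_norm ?frac_weight_ge0//.
  by rewrite /frac_weight mulrA.
rewrite ler_wpM2l//; first exact: ltW (mulr_gt0 K0 (mu0 x)).
rewrite -lee_fin /M fineK; last first.
  rewrite fin_numElt gfin andbT; apply: lt_le_trans (ltNyr 0) _.
  by apply: integral_ge0 => t; rewrite /= in_itv/= andbT lee_fin; exact: g0.
rewrite -sumEFin.
have -> : (\sum_(y <- r) (mu y * (\int[@lebesgue_measure R]_(t in `]0%R, +oo[) integrand x y t))%:E)%E =
   (\sum_(y <- r) \int[@lebesgue_measure R]_(t in `]0%R, +oo[) (mu y * integrand x y t)%:E)%E.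
  rewrite big_seq [RHS]big_seq; apply: eq_bigr => y yr.
  rewrite EFinM RintegralE ?xy// -ge0_integralZl//.
  - exact: measurable_integrandE.
  - by move=> t; rewrite /= in_itv/= andbT lee_fin; exact: integrand_ge0.
  - by rewrite lee_fin ltW.
rewrite -ge0_integral_sum//; last 2 first.
- move=> y; exact: measurable_mu_integrandE.
- move=> y t; rewrite /= in_itv/= andbT lee_fin => t0.
  by rewrite mulr_ge0 ?(ltW (mu0 _))// integrand_ge0.
apply: ge0_le_integral => //.
- move=> t; rewrite /= in_itv/= andbT => t0; apply: sume_ge0 => y _.
  by rewrite lee_fin mulr_ge0 ?(ltW (mu0 _))// integrand_ge0.
- apply: emeasurable_sum => y; exact: measurable_mu_integrandE.
- exact/measurable_EFinP.
- move=> t; rewrite /= in_itv/= andbT => t0; rewrite sumEFin lee_fin /g.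
  apply: le_trans (ler_wpM2r (powR_ge0 t (- 1 - s)) (H t r t0 ur xr)).
  rewrite mulr_suml le_eqVlt; apply/orP; left; apply/eqP; apply: eq_bigr => y _.
  by rewrite /integrand; ring.
Qed.

End Weight.

End HeatKernel.

(** * The fractional gradient *)

Section Gradient.
Context {R : realType} {V : countType} (G : weighted_graph R V).
Hypothesis Glf : locally_finite G.
Hypothesis Gsc : stochastically_complete G.
Variable s : R.
Hypothesis s01 : 0 < s < 1.
Local Notation mu := (vmeas G).
Local Notation W := (frac_weight G s).
Local Notation B := (frac_grad_prod G s).
Local Notation nabla := (frac_grad_norm G s).
Implicit Types (x y : V) (u v w : V -> R).

Let mu0 x : 0 < mu x := vmeas_gt0 G x.
Let W0 x y : 0 <= W x y. Proof. exact: frac_weight_ge0. Qed.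
Let Wsum x : asum [set~ x] (W x). Proof. exact: asum_frac_weight. Qed.

Definition bnd_fun u := exists M : R, forall x, `|u x| <= M.

Lemma bnd_funD u v : bnd_fun u -> bnd_fun v -> bnd_fun (fun x => u x + v x).
Proof.
move=> [M uM] [M' vM]; exists (M + M') => x.
by apply: le_trans (ler_normD _ _) _; apply: lerD.
Qed.

Lemma bnd_funZ c u : bnd_fun u -> bnd_fun (fun x => c * u x).
Proof. by move=> [M uM]; exists (`|c| * M) => x; rewrite normrM ler_wpM2l. Qed.

Lemma bnd_funB u v : bnd_fun u -> bnd_fun v -> bnd_fun (fun x => u x - v x).
Proof.
move=> [M uM] [M' vM]; exists (M + M') => x.
by apply: le_trans (ler_normB _ _) _; apply: lerD.
Qed.

Lemma bnd_fun_seq (r : seq V) u : (forall x, x \notin r -> u x = 0) -> bnd_fun u.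
Proof.
move=> ur; exists (\sum_(x <- r) `|u x|) => x.
have [xr|xr] := boolP (x \in r); last by rewrite ur// normr0 sumr_ge0.
by rewrite (big_rem x)//= lerDl sumr_ge0.
Qed.

Lemma asum_grad_term x u v : bnd_fun u -> bnd_fun v ->
  asum [set~ x] (fun y => W x y * (u x - u y) * (v x - v y)).
Proof.
move=> [M uM] [M' vM].
have M0 : 0 <= M by exact: le_trans (uM x).
have M0' : 0 <= M' by exact: le_trans (vM x).
apply: le_asum (asumZ ((M + M) * (M' + M')) (Wsum x)) => y _.
have H w (N : R) : (forall x, `|w x| <= N) -> `|w x - w y| <= N + N.
  by move=> wN; apply: le_trans (ler_normB _ _) _; apply: lerD.
rewrite !normrM -mulrA mulrC ler_wpM2r//.
rewrite (ger0_norm (addr_ge0 M0 M0)) (ger0_norm (addr_ge0 M0' M0')).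
by apply: ler_pM => //; exact: H.
Qed.

Lemma frac_grad_prodC u v x : B u v x = B v u x.
Proof. by rewrite /frac_grad_prod; congr (_ * _); apply: eq_rsum => y _; ring. Qed.

Lemma frac_grad_prodDr u v w x : bnd_fun u -> bnd_fun v -> bnd_fun w ->
  B u (fun x => v x + w x) x = B u v x + B u w x.
Proof.
move=> bu bv bw; rewrite /frac_grad_prod -mulrDr -rsumD; [|exact: asum_grad_term..].
by congr (_ * _); apply: eq_rsum => y _; ring.
Qed.

Lemma frac_grad_prodZr c u v x : bnd_fun u -> bnd_fun v ->
  B u (fun x => c * v x) x = c * B u v x.
Proof.
move=> bu bv; rewrite /frac_grad_prod [RHS]mulrCA -(rsumZ c (asum_grad_term x bu bv)).
by congr (_ * _); apply: eq_rsum => y _; ring.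
Qed.

Lemma frac_grad_prodBr u v w x : bnd_fun u -> bnd_fun v -> bnd_fun w ->
  B u (fun x => v x - w x) x = B u v x - B u w x.
Proof.
move=> bu bv bw; rewrite /frac_grad_prod -mulrBr -rsumB; [|exact: asum_grad_term..].
by congr (_ * _); apply: eq_rsum => y _; ring.
Qed.

Lemma frac_grad_prod_ge0 u x : 0 <= B u u x.
Proof.
rewrite /frac_grad_prod mulr_ge0 ?invr_ge0 ?mulr_ge0 ?(ltW (mu0 x))//.
by apply: rsum_ge0 => y _; rewrite -mulrA mulr_ge0// -expr2 sqr_ge0.
Qed.

Lemma frac_grad_norm_ge0 u x : 0 <= nabla u x.
Proof. exact: sqrtr_ge0. Qed.

Lemma sqr_frac_grad_norm u x : nabla u x ^+ 2 = B u u x.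
Proof. by rewrite sqr_sqrtr// frac_grad_prod_ge0. Qed.

(** A nonnegative quadratic polynomial has nonpositive discriminant. *)
Lemma frac_grad_CS u v x : bnd_fun u -> bnd_fun v ->
  `|B u v x| <= nabla u x * nabla v x.
Proof.
move=> bu bv.
have quad t : 0 <= B u u x + 2 * t * B u v x + t ^+ 2 * B v v x.
  have btv := bnd_funZ t bv; have buv := bnd_funD bu btv.
  have := frac_grad_prod_ge0 (fun x => u x + t * v x) x.
  rewrite frac_grad_prodDr// frac_grad_prodZr// frac_grad_prodC frac_grad_prodDr//.
  rewrite frac_grad_prodZr// [B (fun x => u x + t * v x) v x]frac_grad_prodC.
  rewrite frac_grad_prodDr// frac_grad_prodZr// [B v u x]frac_grad_prodC.
  by move/le_trans; apply; rewrite le_eqVlt; apply/orP; left; apply/eqP; ring.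
have a0 := frac_grad_prod_ge0 u x; have c0 := frac_grad_prod_ge0 v x.
rewrite -(@ler_pXn2r _ 2) ?nnegrE ?mulr_ge0 ?frac_grad_norm_ge0//.
rewrite real_normK ?num_real// [leRHS]exprMn !sqr_frac_grad_norm.
move: quad a0 c0; move: (B u u x) (B u v x) (B v v x) => a b c quad a0 c0.
have [c_eq|cn0] := eqVneq c 0.
  have [->|bn0] := eqVneq b 0; first by rewrite expr0n/= mulr_ge0.
  have := quad (- (a + 1) / (2 * b)); rewrite c_eq mulr0 addr0.
  have -> : 2 * (- (a + 1) / (2 * b)) * b = - (a + 1) by field.
  by lra.
have cp : 0 < c by rewrite lt_neqAle eq_sym cn0.
have := quad (- b / c).
have -> : a + 2 * (- b / c) * b + (- b / c) ^+ 2 * c = a - b ^+ 2 / c by field.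
by rewrite subr_ge0 ler_pdivrMr.
Qed.

Lemma frac_grad_normD u v x : bnd_fun u -> bnd_fun v ->
  nabla (fun x => u x + v x) x <= nabla u x + nabla v x.
Proof.
move=> bu bv; have buv := bnd_funD bu bv.
rewrite -(@ler_pXn2r _ 2) ?nnegrE ?addr_ge0 ?frac_grad_norm_ge0//.
rewrite sqr_frac_grad_norm frac_grad_prodDr// frac_grad_prodC frac_grad_prodDr//.
rewrite [B (fun x => u x + v x) v x]frac_grad_prodC frac_grad_prodDr//.
rewrite [B v u x]frac_grad_prodC sqrrD !sqr_frac_grad_norm.
have := le_trans (ler_norm _) (frac_grad_CS x bu bv).
by rewrite mulr2n; lra.
Qed.

Lemma frac_grad_normZ c u x : bnd_fun u ->
  nabla (fun x => c * u x) x = `|c| * nabla u x.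
Proof.
move=> bu; rewrite /frac_grad_norm frac_grad_prodZr//; last exact: bnd_funZ.
rewrite frac_grad_prodC frac_grad_prodZr// mulrA -expr2 sqrtrM ?sqr_ge0//.
by rewrite sqrtr_sqr.
Qed.

Lemma frac_grad_norm_dist u v x : bnd_fun u -> bnd_fun v ->
  `|nabla u x - nabla v x| <= nabla (fun x => u x - v x) x.
Proof.
move=> bu bv.
have H u' v' : bnd_fun u' -> bnd_fun v' ->
    nabla u' x - nabla v' x <= nabla (fun x => u' x - v' x) x.
  move=> bu' bv'; rewrite lerBlDr.
  have := frac_grad_normD x (bnd_funB bu' bv') bv'.
  by have -> : (fun x => u' x - v' x + v' x) = u' by apply/funext => z; ring.
rewrite ler_norml H// andbT lerNl opprB.
apply: le_trans (H _ _ bv bu) _; rewrite le_eqVlt; apply/orP; left; apply/eqP.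
have -> : (fun x => v x - u x) = (fun x => (-1) * (u x - v x)) by apply/funext => z; ring.
by rewrite frac_grad_normZ ?normrN1 ?mul1r//; exact: bnd_funB.
Qed.

(** The total weight at [x] is finite, which makes the gradient at [x] continuous
    for the sup norm. *)
Lemma frac_grad_norm_sup x : exists2 c : R, 0 <= c & forall u M,
  (forall y, `|u y| <= M) -> nabla u x <= c * M.
Proof.
pose S := rsum [set~ x] (W x).
have S0 : 0 <= S by apply: rsum_ge0 => y _.
have k0 : 0 <= 2 * S / mu x by rewrite divr_ge0 ?mulr_ge0// ltW.
exists (Num.sqrt (2 * S / mu x)); first exact: sqrtr_ge0.
move=> u M uM; have M0 : 0 <= M by exact: le_trans (uM x).
have bu : bnd_fun u by exists M.
rewrite -(@ler_pXn2r _ 2) ?nnegrE ?mulr_ge0 ?frac_grad_norm_ge0 ?sqrtr_ge0//.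
rewrite sqr_frac_grad_norm exprMn sqr_sqrtr// /frac_grad_prod.
have : rsum [set~ x] (fun y => W x y * (u x - u y) * (u x - u y)) <= (2 * M) ^+ 2 * S.
  rewrite /S -rsumZ//; apply: ler_rsum; [exact: asum_grad_term|exact: asumZ|].
  move=> y _; rewrite -mulrA mulrC ler_wpM2r// -expr2.
  rewrite -[(u x - u y) ^+ 2]real_normK ?num_real//.
  rewrite ler_pXn2r ?nnegrE ?mulr_ge0//.
  by apply: le_trans (ler_normB _ _) _; have := uM x; have := uM y; lra.
move=> /(ler_wpM2l (_ : 0 <= (2 * mu x)^-1)); rewrite invr_ge0 mulr_ge0 ?(ltW (mu0 x))//.
move=> /(_ isT)/le_trans; apply; rewrite le_eqVlt; apply/orP; left; apply/eqP.
by field; rewrite gt_eqF.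
Qed.

Lemma frac_grad_prod_unit_at u x z : x != z ->
  B u (fun y => (y == z)%:R) x = (2 * mu x)^-1 * (W x z * (u z - u x)).
Proof.
move=> xz; rewrite /frac_grad_prod; congr (_ * _).
have [||_ ->] := @rsum_seq R V [set~ x] (fun y => W x y * (u x - u y) * ((x == z)%:R - (y == z)%:R)) [:: z] isT.
- by move=> y; rewrite mem_seq1 => /eqP -> /= zx; move: xz; rewrite zx eqxx.
- by move=> y _; rewrite mem_seq1 (negbTE xz) => /negbTE ->; rewrite subrr mulr0.
by rewrite big_seq1 (negbTE xz) eqxx sub0r mulrN1 -mulrN opprB.
Qed.

End Gradient.

(** * The energy density and its derivative *)

(* Powers and bilinear terms are independent variables in the linear arithmetic
   below. *)
Ltac gen_atoms := repeat match goal with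
  | |- context [powR ?a ?b] => move: (powR a b) => ?
  | |- context [frac_grad_prod ?G ?s ?u ?v ?x] =>
      move: (frac_grad_prod G s u v x) => ?
  | |- context [frac_grad_norm ?G ?s ?u ?x] =>
      move: (frac_grad_norm G s u x) => ?
  end.

Section Energy.
Context {R : realType} {V : countType} (G : weighted_graph R V).
Hypothesis Glf : locally_finite G.
Hypothesis Gsc : stochastically_complete G.
Variables (s p : R) (h : V -> R).
Hypothesis s01 : 0 < s < 1.
Hypothesis p2 : 2 <= p.
Hypothesis h_gt0 : forall x, 0 < h x.
Local Notation mu := (vmeas G).
Local Notation B := (frac_grad_prod G s).
Local Notation nabla := (frac_grad_norm G s).
Local Notation dens := (Hsp_density G s p h).
Implicit Types (x y z : V) (u v w phi : V -> R) (a b c d e M N : R).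

Let mu0 x : 0 < mu x := vmeas_gt0 G x.
Let p0 : 0 < p. Proof. exact: lt_le_trans p2. Qed.
Let p1 : 1 <= p. Proof. by apply: le_trans p2; rewrite ler1n. Qed.
Let th0 : 0 <= p - 2. Proof. by rewrite subr_ge0. Qed.
Let nab0 u x : 0 <= nabla u x. Proof. exact: frac_grad_norm_ge0. Qed.

(** One [p]-th of the derivative of the energy density at [u], in the direction
    [phi]. *)
Definition dens_form u phi x : R :=
  nabla u x `^ (p - 2) * B u phi x + h x * `|u x| `^ (p - 2) * u x * phi x.

Let sqr_pow a : 0 <= a -> a `^ (p - 2) * a ^+ 2 = a `^ p.
Proof.
move=> a0; rewrite -powR_mulrn// -powRD; first by congr (_ `^ _); ring.
by rewrite subrK (gt_eqF p0).
Qed.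

Let pred_pow a : 0 <= a -> a `^ (p - 2) * a = a `^ (p - 1).
Proof.
move=> a0; have pp : 1 <= p - 1 by move: p2; lra.
by rewrite -(powR_pred pp a0) mulrC; congr (_ * _ `^ _); ring.
Qed.

Let form_le a b (ab : R) : 0 <= a -> 0 <= b -> `|ab| <= a * b ->
  `|a `^ (p - 2) * ab| <= a `^ (p - 1) * b.
Proof.
move=> a0 b0 H; rewrite normrM ger0_norm ?powR_ge0// -pred_pow// -mulrA.
by rewrite ler_wpM2l// powR_ge0.
Qed.

Let form_convex a b (ab : R) : 0 <= a -> 0 <= b -> `|ab| <= a * b ->
  a `^ p + p * (a `^ (p - 2) * (ab - a ^+ 2)) <= b `^ p.
Proof.
move=> a0 b0 H; have := powR_tangent p1 a0 b0; apply: le_trans.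
rewrite lerD2l -mulrA ler_wpM2l ?(ltW p0)// !mulrBr sqr_pow// -(powR_pred p1 a0).
rewrite [a * _]mulrC lerD2r; exact: le_trans (ler_norm _) (form_le a0 b0 H).
Qed.

Let form_young e a b (ab : R) : 0 < e -> 0 <= a -> 0 <= b -> `|ab| <= a * b ->
  `|a `^ (p - 2) * ab| <= e * a `^ p + e^-1 `^ (p - 1) * b `^ p.
Proof. by move=> e0 a0 b0 /(form_le a0 b0)/le_trans; apply; exact: powR_young. Qed.

Let normM_le x u v : `|u x * v x| <= `|u x| * `|v x|. Proof. by rewrite normrM. Qed.

Let h_term x u phi : h x * `|u x| `^ (p - 2) * u x * phi x =
  h x * (`|u x| `^ (p - 2) * (u x * phi x)).
Proof. by ring. Qed.

Lemma dens_ge0 u x : 0 <= dens u x.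
Proof. by rewrite addr_ge0 ?powR_ge0// mulr_ge0 ?powR_ge0// ltW. Qed.

Lemma dens_form_diag u x : dens_form u u x = dens u x.
Proof.
rewrite /dens_form /Hsp_density -sqr_frac_grad_norm// sqr_pow//; congr (_ + _).
by rewrite h_term -expr2 -[u x ^+ 2]real_normK ?num_real// sqr_pow.
Qed.

Lemma dens_formD u v w x : bnd_fun u -> bnd_fun v -> bnd_fun w ->
  dens_form u (fun y => v y + w y) x = dens_form u v x + dens_form u w x.
Proof. by move=> bu bv bw; rewrite /dens_form (frac_grad_prodDr (V := V))//; ring. Qed.

Lemma dens_formB u v w x : bnd_fun u -> bnd_fun v -> bnd_fun w ->
  dens_form u (fun y => v y - w y) x = dens_form u v x - dens_form u w x.
Proof. by move=> bu bv bw; rewrite /dens_form (frac_grad_prodBr (V := V))//; ring. Qed.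

Lemma dens_formZ c u v x : bnd_fun u -> bnd_fun v ->
  dens_form u (fun y => c * v y) x = c * dens_form u v x.
Proof. by move=> bu bv; rewrite /dens_form (frac_grad_prodZr (V := V))//; ring. Qed.

(** The tangent inequality for [t^p] applies to the gradient and to the value; by
    the Cauchy-Schwarz inequality the bilinear terms are at most the products of
    norms that occur in the slopes. *)
Lemma dens_convex u v x : bnd_fun u -> bnd_fun v ->
  dens u x + p * dens_form u (fun y => v y - u y) x <= dens v x.
Proof.
move=> bu bv; rewrite dens_formB// /dens_form -sqr_frac_grad_norm// !h_term.
rewrite /Hsp_density -expr2 -[u x ^+ 2]real_normK ?num_real//.
have := form_convex (nab0 u x) (nab0 v x) (frac_grad_CS Glf Gsc s01 x bu bv).
have := form_convex (normr_ge0 (u x)) (normr_ge0 (v x)) (normM_le x u v).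
move=> /(ler_wpM2l (ltW (h_gt0 x))); move: (h x) => hx; gen_atoms; lra.
Qed.

Lemma dens_form_sup u x : bnd_fun u -> exists2 K : R, 0 <= K &
  forall phi M, (forall y, `|phi y| <= M) -> `|dens_form u phi x| <= K * M.
Proof.
move=> bu; have [c c0 H] := frac_grad_norm_sup Glf Gsc s01 x.
exists (nabla u x `^ (p - 1) * c + h x * `|u x| `^ (p - 1)).
  by rewrite addr_ge0// mulr_ge0 ?powR_ge0// ltW.
move=> phi M phiM; have bphi : bnd_fun phi by exists M.
rewrite /dens_form h_term; apply: le_trans (ler_normD _ _) _; rewrite mulrDl.
apply: lerD.
  apply: le_trans (form_le (nab0 u x) (nab0 phi x) (frac_grad_CS Glf Gsc s01 x bu bphi)) _.
  by rewrite -mulrA ler_wpM2l ?powR_ge0// H.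
rewrite normrM (gtr0_norm (h_gt0 x)) -mulrA ler_wpM2l ?(ltW (h_gt0 x))//.
apply: le_trans (form_le (normr_ge0 (u x)) (normr_ge0 (phi x)) (normM_le x u phi)) _.
by rewrite ler_wpM2l ?powR_ge0.
Qed.

Lemma dens_young e u v x : 0 < e -> bnd_fun u -> bnd_fun v ->
  `|dens_form u v x| <= e * dens u x + e^-1 `^ (p - 1) * dens v x.
Proof.
move=> e0 bu bv; rewrite /dens_form h_term; apply: le_trans (ler_normD _ _) _.
have := form_young e0 (nab0 u x) (nab0 v x) (frac_grad_CS Glf Gsc s01 x bu bv).
have := form_young e0 (normr_ge0 (u x)) (normr_ge0 (v x)) (normM_le x u v).
move=> /(ler_wpM2l (ltW (h_gt0 x))); rewrite -{1}(gtr0_norm (h_gt0 x)) -normrM.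
by rewrite /Hsp_density; move: (h x) => hx; move: `|_| `|_| => ? ?; gen_atoms; lra.
Qed.

Lemma densD u v x : bnd_fun u -> bnd_fun v ->
  dens (fun y => u y + v y) x <= 2 `^ p * (dens u x + dens v x).
Proof.
move=> bu bv; rewrite /Hsp_density.
have H1 : nabla (fun y => u y + v y) x `^ p <= 2 `^ p * (nabla u x `^ p + nabla v x `^ p).
  apply: le_trans (powR_add_le (ltW p0) (nab0 u x) (nab0 v x)).
  by apply: le_powR => //; [exact: ltW|exact: frac_grad_normD].
have H2 : `|u x + v x| `^ p <= 2 `^ p * (`|u x| `^ p + `|v x| `^ p).
  apply: le_trans (powR_add_le (ltW p0) (normr_ge0 _) (normr_ge0 _)).
  by apply: le_powR => //; [exact: ltW|exact: ler_normD].
move: H1 (ler_wpM2l (ltW (h_gt0 x)) H2); move: (h x) => hx; gen_atoms; lra.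
Qed.

Lemma densZ c u x : bnd_fun u -> dens (fun y => c * u y) x = `|c| `^ p * dens u x.
Proof.
by move=> bu; rewrite /Hsp_density frac_grad_normZ// normrM !powRM//; ring.
Qed.

Let parallelogram u v x : bnd_fun u -> bnd_fun v ->
  nabla (fun y => u y + v y) x ^+ 2 + nabla (fun y => u y - v y) x ^+ 2 =
  2 * (nabla u x ^+ 2 + nabla v x ^+ 2).
Proof.
move=> bu bv; have bp := bnd_funD bu bv; have bm := bnd_funB bu bv.
rewrite !sqr_frac_grad_norm//.
have -> : B (fun y => u y + v y) (fun y => u y + v y) x = B u u x + 2 * B u v x + B v v x.
  rewrite (frac_grad_prodDr Glf Gsc)// !(frac_grad_prodC _ _ (fun y => u y + v y)).
  rewrite !(frac_grad_prodDr Glf Gsc)// (frac_grad_prodC _ _ v u); ring.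
have -> : B (fun y => u y - v y) (fun y => u y - v y) x = B u u x - 2 * B u v x + B v v x.
  rewrite (frac_grad_prodBr Glf Gsc)// !(frac_grad_prodC _ _ (fun y => u y - v y)).
  rewrite !(frac_grad_prodBr Glf Gsc)// (frac_grad_prodC _ _ v u); ring.
by ring.
Qed.

(** Gradient and value both satisfy the parallelogram identity, so the scalar
    inequality applies to each of them. *)
Lemma dens_clarkson u v x : bnd_fun u -> bnd_fun v ->
  dens (fun y => 2^-1 * (u y + v y)) x + dens (fun y => 2^-1 * (u y - v y)) x
    <= (dens u x + dens v x) / 2.
Proof.
move=> bu bv; have bp := bnd_funD bu bv; have bm := bnd_funB bu bv.
set a := (fun y => 2^-1 * (u y + v y)); set b := (fun y => 2^-1 * (u y - v y)).
have h2 : 0 <= 2^-1 :> R by lra.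
have H1 : nabla a x `^ p + nabla b x `^ p <= (nabla u x `^ p + nabla v x `^ p) / 2.
  apply: powR_clarkson => //.
  by rewrite /a /b !frac_grad_normZ// ger0_norm// !exprMn -mulrDr parallelogram//; field.
have H2 : `|a x| `^ p + `|b x| `^ p <= (`|u x| `^ p + `|v x| `^ p) / 2.
  apply: powR_clarkson => //.
  by rewrite !real_normK ?num_real// /a /b; field.
move: H1 (ler_wpM2l (ltW (h_gt0 x)) H2); rewrite /Hsp_density.
move: (h x) => hx; gen_atoms; lra.
Qed.

(** The map [a |-> |a|^(p-2) a] of a Hilbert space is locally Lipschitz as
    [p >= 2]; it is used for the gradients and for the values. *)
Lemma dens_form_lip u v phi x M N : bnd_fun u -> bnd_fun v -> bnd_fun phi ->
  nabla u x <= M -> nabla v x <= M -> `|u x| <= N -> `|v x| <= N ->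
  `|dens_form u phi x - dens_form v phi x| <=
    p * (M `^ (p - 2) * nabla (fun y => u y - v y) x * nabla phi x
         + h x * (N `^ (p - 2) * `|u x - v x| * `|phi x|)).
Proof.
move=> bu bv bphi uM vM uN vN; rewrite /dens_form !h_term.
have H1 := @powR_weighted_inner_lip R (p - 2) M (nabla u x) (nabla v x)
  (nabla (fun y => u y - v y) x) (nabla phi x) (B u phi x) (B v phi x) th0
  (nab0 _ _) (nab0 _ _) (nab0 _ _) (nab0 _ _) uM vM (frac_grad_norm_dist Glf Gsc s01 x bu bv).
have H2 := @powR_weighted_inner_lip R (p - 2) N `|u x| `|v x|
  `|u x - v x| `|phi x| (u x * phi x) (v x * phi x) th0
  (normr_ge0 _) (normr_ge0 _) (normr_ge0 _) (normr_ge0 _) uN vN (ler_dist_dist _ _).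
have {}H1 := H1 _ (frac_grad_CS Glf Gsc s01 x bv bphi).
have e1 : `|B u phi x - B v phi x| <= nabla (fun y => u y - v y) x * nabla phi x.
  rewrite ![B _ phi x]frac_grad_prodC -(frac_grad_prodBr Glf Gsc)// mulrC.
  by apply: frac_grad_CS => //; exact: bnd_funB.
have e2 : `|u x * phi x - v x * phi x| <= `|u x - v x| * `|phi x|.
  by rewrite -mulrBl normrM.
have {}H1 := H1 e1; have {}H2 := H2 e2 (normM_le x v phi).
have := ler_wpM2l (ltW (h_gt0 x)) H2; rewrite -{1}(gtr0_norm (h_gt0 x)) -normrM => {}H2.
have -> : nabla u x `^ (p - 2) * B u phi x + h x * (`|u x| `^ (p - 2) * (u x * phi x)) -
   (nabla v x `^ (p - 2) * B v phi x + h x * (`|v x| `^ (p - 2) * (v x * phi x))) =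
   (nabla u x `^ (p - 2) * B u phi x - nabla v x `^ (p - 2) * B v phi x) +
   h x * (`|u x| `^ (p - 2) * (u x * phi x) - `|v x| `^ (p - 2) * (v x * phi x)) by gen_atoms; ring.
apply: le_trans (ler_normD _ _) _; apply: le_trans (lerD H1 H2) _.
by rewrite le_eqVlt; apply/orP; left; apply/eqP; ring.
Qed.

Let max3_pow a b c : 0 <= a -> 0 <= b -> 0 <= c ->
  Num.max (Num.max a b) c `^ p <= a `^ p + b `^ p + c `^ p.
Proof.
move=> a0 b0 c0; have [A [B C]] : 0 <= a `^ p /\ 0 <= b `^ p /\ 0 <= c `^ p.
  by rewrite !powR_ge0.
by have [_|_] := leP a b; have [_|_] := leP _ c; lra.
Qed.

Let lip_young e a (a' : R) d b : 0 < e -> 0 <= a -> 0 <= a' -> 0 <= d -> 0 <= b ->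
  Num.max a a' `^ (p - 2) * d * b <=
  e * (a `^ p + a' `^ p + b `^ p) + e^-1 `^ (p - 1) * d `^ p.
Proof.
move=> e0 a0 a'0 d0 b0; set M := Num.max a a'; set X := Num.max M b.
have M0 : 0 <= M by rewrite le_max a0.
have X0 : 0 <= X by rewrite le_max M0.
apply: (@le_trans _ _ (X `^ (p - 1) * d)).
  rewrite mulrAC ler_wpM2r// -pred_pow//; apply: ler_pM => //; first exact: powR_ge0.
    by apply: le_powR => //; rewrite le_max lexx.
  by rewrite le_max lexx orbT.
apply: le_trans (powR_young p1 e0 X0 d0) _.
by rewrite lerD2r ler_wpM2l ?(ltW e0)// max3_pow.
Qed.

(** Young's inequality separates the Lipschitz bound into a small multiple of the
    densities and a large multiple of the density of the difference. *)
Lemma dens_form_cont e u v phi x : 0 < e -> bnd_fun u -> bnd_fun v -> bnd_fun phi ->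
  `|dens_form u phi x - dens_form v phi x| <=
    p * (e * (dens u x + dens v x + dens phi x)
         + e^-1 `^ (p - 1) * dens (fun y => u y - v y) x).
Proof.
move=> e0 bu bv bphi.
have mxl (a b : R) : a <= Num.max a b by rewrite le_max lexx.
have mxr (a b : R) : b <= Num.max a b by rewrite le_max lexx orbT.
apply: le_trans (dens_form_lip bu bv bphi (mxl _ (nabla v x)) (mxr _ _) (mxl _ `|v x|) (mxr _ _)) _.
rewrite ler_wpM2l ?(ltW p0)// /Hsp_density.
have H1 := lip_young e0 (nab0 u x) (nab0 v x) (nab0 (fun y => u y - v y) x) (nab0 phi x).
have := lip_young e0 (normr_ge0 (u x)) (normr_ge0 (v x)) (normr_ge0 (u x - v x)) (normr_ge0 (phi x)).
move: H1 => /[swap] /(ler_wpM2l (ltW (h_gt0 x))); move: (h x) => hx; gen_atoms; lra.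
Qed.

End Energy.

(** * The energy *)

Section TotalEnergy.
Context {R : realType} {V : countType} (G : weighted_graph R V).
Hypothesis Glf : locally_finite G.
Hypothesis Gsc : stochastically_complete G.
Variables (s p : R) (h : V -> R).
Hypothesis s01 : 0 < s < 1.
Hypothesis p2 : 2 <= p.
Hypothesis h_gt0 : forall x, 0 < h x.
Local Notation mu := (vmeas G).
Local Notation W := (frac_weight G s).
Local Notation nabla := (frac_grad_norm G s).
Local Notation dens := (Hsp_density G s p h).
Local Notation form := (dens_form G s p h).
Implicit Types (x y z : V) (u v w phi : V -> R) (a b c d e M N : R).

Let mu0 x : 0 < mu x := vmeas_gt0 G x.
Let p0 : 0 < p. Proof. exact: lt_le_trans p2. Qed.
Let p1 : 1 <= p. Proof. by apply: le_trans p2; rewrite ler1n. Qed.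
Let th0 : 0 <= p - 2. Proof. by rewrite subr_ge0. Qed.
Let nab0 u x : 0 <= nabla u x. Proof. exact: frac_grad_norm_ge0. Qed.

Local Opaque Hsp_density dens_form frac_grad_norm frac_grad_prod frac_weight.

Definition fin_energy u := asum [set: V] (fun x => dens u x * mu x).
(** The [p]-th power of the norm of the space. *)
Definition energy u : R := rsum [set: V] (fun x => dens u x * mu x).
Definition energy_form u phi : R := rsum [set: V] (fun x => form u phi x * mu x).

Let dmu0 u x : 0 <= dens u x * mu x.
Proof. by apply: mulr_ge0; [exact: dens_ge0|exact: ltW]. Qed.

Lemma energy_ge0 u : 0 <= energy u.
Proof. by apply: rsum_ge0. Qed.

Lemma fin_energyD u v : bnd_fun u -> bnd_fun v -> fin_energy u -> fin_energy v ->
  fin_energy (fun x => u x + v x) /\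
  energy (fun x => u x + v x) <= 2 `^ p * (energy u + energy v).
Proof.
move=> bu bv fu fv.
have H x : dens (fun x => u x + v x) x * mu x <= 2 `^ p * (dens u x * mu x + dens v x * mu x).
  by rewrite -mulrDl mulrA ler_wpM2r ?(ltW (mu0 x))//; exact: densD.
have sD := asumZ (2 `^ p) (asumD fu fv).
have fD : fin_energy (fun x => u x + v x).
  apply: le_asum sD => x _; rewrite !ger0_norm//.
  by rewrite mulr_ge0 ?powR_ge0 ?addr_ge0.
split; first exact: fD.
rewrite /energy -(rsumD fu fv) -(rsumZ (2 `^ p) (asumD fu fv)).
exact: (ler_rsum fD sD (fun x _ => H x)).
Qed.

Lemma fin_energyZ c u : bnd_fun u -> fin_energy u ->
  fin_energy (fun x => c * u x) /\ energy (fun x => c * u x) = `|c| `^ p * energy u.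
Proof.
move=> bu fu.
have H x : dens (fun x => c * u x) x * mu x = `|c| `^ p * (dens u x * mu x).
  by rewrite densZ// mulrA.
split; last by rewrite /energy -(rsumZ (`|c| `^ p) fu); apply: eq_rsum => x _.
have -> : fin_energy (fun x => c * u x) = asum setT (fun x => `|c| `^ p * (dens u x * mu x)).
  by congr asum; apply/funext => x; exact: H.
exact: (asumZ (`|c| `^ p) fu).
Qed.

Lemma fin_energyB u v : bnd_fun u -> bnd_fun v -> fin_energy u -> fin_energy v ->
  fin_energy (fun x => u x - v x) /\
  energy (fun x => u x - v x) <= 2 `^ p * (energy u + energy v).
Proof.
move=> bu bv fu fv; have [fNv eNv] := fin_energyZ (-1) bv fv.
have := fin_energyD bu (bnd_funZ (-1) bv) fu fNv.
rewrite eNv normrN1 powR1 mul1r.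
by have -> : (fun x => u x + -1 * v x) = (fun x => u x - v x) by apply/funext => x; ring.
Qed.

Lemma asum_form u phi : bnd_fun u -> bnd_fun phi -> fin_energy u -> fin_energy phi ->
  asum [set: V] (fun x => form u phi x * mu x).
Proof.
move=> bu bphi fu fphi; apply: le_asum (asumD fu fphi) => x _.
rewrite [leRHS]ger0_norm ?addr_ge0// normrM (gtr0_norm (mu0 x)) -mulrDl ler_wpM2r ?(ltW (mu0 x))//.
have := dens_young Glf Gsc s01 p2 h_gt0 x ltr01 bu bphi.
by rewrite mul1r invr1 powR1 mul1r.
Qed.

Lemma energy_formD u v w : bnd_fun u -> bnd_fun v -> bnd_fun w ->
  fin_energy u -> fin_energy v -> fin_energy w ->
  energy_form u (fun x => v x + w x) = energy_form u v + energy_form u w.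
Proof.
move=> *; rewrite /energy_form -rsumD; [|exact: asum_form..].
by apply: eq_rsum => x _; rewrite dens_formD// mulrDl.
Qed.

Lemma energy_formB u v w : bnd_fun u -> bnd_fun v -> bnd_fun w ->
  fin_energy u -> fin_energy v -> fin_energy w ->
  energy_form u (fun x => v x - w x) = energy_form u v - energy_form u w.
Proof.
move=> *; rewrite /energy_form -rsumB; [|exact: asum_form..].
by apply: eq_rsum => x _; rewrite dens_formB// mulrBl.
Qed.

Lemma energy_formZ c u v : bnd_fun u -> bnd_fun v ->
  fin_energy u -> fin_energy v ->
  energy_form u (fun x => c * v x) = c * energy_form u v.
Proof.
move=> *; rewrite /energy_form -rsumZ; last exact: asum_form.
by apply: eq_rsum => x _; rewrite dens_formZ// mulrA.
Qed.

Lemma energy_form_diag u : energy_form u u = energy u.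
Proof. by apply: eq_rsum => x _; rewrite dens_form_diag. Qed.

Lemma energy_convex u v : bnd_fun u -> bnd_fun v -> fin_energy u -> fin_energy v ->
  energy u + p * energy_form u (fun x => v x - u x) <= energy v.
Proof.
move=> bu bv fu fv; have [fB _] := fin_energyB bv bu fv fu; have bB := bnd_funB bv bu.
have sf := asum_form bu bB fu fB.
rewrite /energy /energy_form -(rsumZ p sf) -(rsumD fu (asumZ p sf)).
apply: (ler_rsum (asumD fu (asumZ p sf)) fv) => x _.
 rewrite mulrA -mulrDl ler_wpM2r ?(ltW (mu0 x))//.
exact: dens_convex.
Qed.

Lemma energy_clarkson u v : bnd_fun u -> bnd_fun v -> fin_energy u -> fin_energy v ->
  energy (fun x => 2^-1 * (u x + v x)) + energy (fun x => 2^-1 * (u x - v x))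
    <= (energy u + energy v) / 2.
Proof.
move=> bu bv fu fv.
have [fD _] := fin_energyD bu bv fu fv; have [fB _] := fin_energyB bu bv fu fv.
have [fD2 _] := fin_energyZ 2^-1 (bnd_funD bu bv) fD.
have [fB2 _] := fin_energyZ 2^-1 (bnd_funB bu bv) fB.
rewrite mulrC /energy -(rsumD fD2 fB2) -(rsumD fu fv) -(rsumZ 2^-1 (asumD fu fv)).
apply: (ler_rsum (asumD fD2 fB2) (asumZ 2^-1 (asumD fu fv))) => x _.
rewrite -!mulrDl mulrA ler_wpM2r ?(ltW (mu0 x))// [leRHS]mulrC.
exact: dens_clarkson.
Qed.

Lemma energy_form_young e u v : 0 < e -> bnd_fun u -> bnd_fun v ->
  fin_energy u -> fin_energy v ->
  `|energy_form u v| <= e * energy u + e^-1 `^ (p - 1) * energy v.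
Proof.
move=> e0 bu bv fu fv; have sf := asum_form bu bv fu fv.
apply: le_trans (ler_norm_rsum sf) _.
have s2 := asumD (asumZ e fu) (asumZ (e^-1 `^ (p - 1)) fv).
rewrite /energy -(rsumZ e fu) -(rsumZ (e^-1 `^ (p - 1)) fv).
rewrite -(rsumD (asumZ e fu) (asumZ (e^-1 `^ (p - 1)) fv)).
apply: (ler_rsum ((asum_norm _ _).1 sf) s2) => x _.
 rewrite normrM (gtr0_norm (mu0 x)) !mulrA -mulrDl ler_wpM2r ?(ltW (mu0 x))//.
exact: dens_young.
Qed.

Lemma energy_form_cont e u v phi : 0 < e -> bnd_fun u -> bnd_fun v -> bnd_fun phi ->
  fin_energy u -> fin_energy v -> fin_energy phi ->
  `|energy_form u phi - energy_form v phi| <=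
    p * (e * (energy u + energy v + energy phi)
         + e^-1 `^ (p - 1) * energy (fun x => u x - v x)).
Proof.
move=> e0 bu bv bphi fu fv fphi; have [fB _] := fin_energyB bu bv fu fv.
have s1 := asum_form bu bphi fu fphi; have s2 := asum_form bv bphi fv fphi.
rewrite /energy_form -(rsumB s1 s2); apply: le_trans (ler_norm_rsum (asumB s1 s2)) _.
pose c := e^-1 `^ (p - 1); have sE := asumD (asumD fu fv) fphi.
have sR := asumD (asumZ e sE) (asumZ c fB).
have -> : p * (e * (energy u + energy v + energy phi)
         + e^-1 `^ (p - 1) * energy (fun x => u x - v x)) =
   rsum [set: V] (fun x => p * (e * (dens u x * mu x + dens v x * mu x + dens phi x * mu x)
    + c * (dens (fun x => u x - v x) x * mu x))).
  rewrite (rsumZ p sR) (rsumD (asumZ e sE) (asumZ c fB)) (rsumZ e sE) (rsumZ c fB).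
  by rewrite (rsumD (asumD fu fv) fphi) (rsumD fu fv).
apply: (ler_rsum ((asum_norm _ _).1 (asumB s1 s2)) (asumZ p sR)) => x _.
rewrite -mulrBl normrM (gtr0_norm (mu0 x)).
have := ler_wpM2r (ltW (mu0 x)) (dens_form_cont Glf Gsc s01 p2 h_gt0 x e0 bu bv bphi).
move/le_trans; apply; rewrite le_eqVlt; apply/orP; left; apply/eqP.
rewrite -/c; clear sE sR; move: (dens u x) (dens v x) (dens phi x) (dens (fun y => u y - v y) x) c.
by move=> *; ring.
Qed.

Local Transparent Hsp_density.

Lemma fin_energy_mass u : fin_energy u ->
  asum [set: V] (fun x => h x * `|u x| `^ p * mu x) /\
  rsum [set: V] (fun x => h x * `|u x| `^ p * mu x) <= energy u.
Proof.
move=> fu.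
have H x : h x * `|u x| `^ p * mu x <= dens u x * mu x.
  by rewrite ler_wpM2r ?(ltW (mu0 x))// lerDr powR_ge0.
have H0 x : 0 <= h x * `|u x| `^ p * mu x.
  by rewrite mulr_ge0 ?(ltW (mu0 x))// mulr_ge0 ?powR_ge0// ltW.
have sm : asum [set: V] (fun x => h x * `|u x| `^ p * mu x).
  by apply: (le_asum (g := fun x => dens u x * mu x)) => [x _|//]; rewrite (ger0_norm (H0 x)) (ger0_norm (dmu0 u x)).
by split; [exact: sm|exact: (ler_rsum sm fu (fun x _ => H x))].
Qed.

Lemma fin_energy_grad u : fin_energy u ->
  asum [set: V] (fun x => nabla u x `^ p * mu x) /\
  rsum [set: V] (fun x => nabla u x `^ p * mu x) <= energy u.
Proof.
move=> fu.
have H x : nabla u x `^ p * mu x <= dens u x * mu x.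
  by rewrite ler_wpM2r ?(ltW (mu0 x))// lerDl mulr_ge0 ?powR_ge0// ltW.
have H0 x : 0 <= nabla u x `^ p * mu x.
  by rewrite mulr_ge0 ?(ltW (mu0 x))// powR_ge0.
have sm : asum [set: V] (fun x => nabla u x `^ p * mu x).
  by apply: (le_asum (g := fun x => dens u x * mu x)) => [x _|//]; rewrite (ger0_norm (H0 x)) (ger0_norm (dmu0 u x)).
by split; [exact: sm|exact: (ler_rsum sm fu (fun x _ => H x))].
Qed.

Local Opaque Hsp_density.

(** Lower semicontinuity: by convexity the energy lies above its tangents, and
    on a finite set the tangent terms vanish under uniform convergence. *)
Lemma energy_lsc (w : nat -> V -> R) u c :
  bnd_fun u -> (forall n, bnd_fun (w n)) ->
  (forall e, 0 < e -> exists N : nat, forall n, (N <= n)%N ->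
     (forall x, `|w n x - u x| <= e) /\ fin_energy (w n) /\ energy (w n) <= c) ->
  fin_energy u /\ energy u <= c.
Proof.
move=> bu bw H; apply: rsum_le_bound => [x _//|r ur _].
have [K K0 HK] : exists2 K : R, 0 <= K & forall phi M, 0 <= M -> (forall y, `|phi y| <= M) ->
    \sum_(x <- r) `|form u phi x| * mu x <= K * M.
  elim: r {ur} => [|x r [K K0 HK]].
    by exists 0 => // phi M M0 _; rewrite big_nil mul0r.
  have [L L0 HL] := dens_form_sup Glf Gsc s01 p2 h_gt0 x bu.
  exists (L * mu x + K); first by rewrite addr_ge0// mulr_ge0// ltW.
  move=> phi M M0 phiM; rewrite big_cons mulrDl lerD ?HK//.
  by rewrite mulrAC ler_wpM2r ?(ltW (mu0 x))// HL.
apply/ler_addgt0Pr => /= e e0.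
pose d : R := e / (p * (K + 1)).
have K1 : 0 < K + 1 by lra.
have d0 : 0 < d by rewrite divr_gt0// mulr_gt0.
have [N HN] := H d d0; have [wd [fw ew]] := HN N (leqnn N).
have s1 : \sum_(x <- r) dens (w N) x * mu x <= energy (w N) by apply: sum_le_rsum.
apply: (@le_trans _ _ (\sum_(x <- r) (dens (w N) x * mu x + p * (`|form u (fun x => w N x - u x) x| * mu x)))).
  apply: ler_sum => x _; rewrite mulrA -mulrDl ler_wpM2r ?(ltW (mu0 x))//.
  have := dens_convex Glf Gsc s01 p2 h_gt0 x bu (bw N).
  move/(le_trans _); rewrite -lerBlDr; apply.
  by rewrite lerD2l -mulrN ler_wpM2l ?(ltW p0)// lerNl -normrN ler_norm.
rewrite big_split/= -mulr_sumr; apply: lerD; first exact: le_trans s1 ew.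
have := HK _ d (ltW d0) wd; move=> /(ler_wpM2l (ltW p0))/le_trans; apply.
have -> : p * (K * d) = e * (K / (K + 1)) by rewrite /d; field; rewrite !gt_eqF.
by rewrite ler_piMr ?(ltW e0)// ler_pdivrMr//; lra.
Qed.

Local Transparent Hsp_density.

Section Bounds.
Variables m1 h1 : R.
Hypothesis m1_gt0 : 0 < m1.
Hypothesis h1_gt0 : 0 < h1.
Hypothesis m1P : forall x, m1 <= mu x.
Hypothesis h1P : forall x, h1 <= h x.

(** A single term of the sum bounds the value at one vertex, since [mu] and [h] are
    bounded below. *)
Lemma energy_sup u x : fin_energy u -> h1 * m1 * `|u x| `^ p <= energy u.
Proof.
move=> fu; have [sm le] := fin_energy_mass fu; apply: le_trans le.
apply: (@le_trans _ _ (h x * `|u x| `^ p * mu x)); last first.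
  apply: (@term_le_rsum R V setT (fun x => h x * `|u x| `^ p * mu x)) => // y _.
  by rewrite mulr_ge0 ?(ltW (mu0 y))// mulr_ge0 ?powR_ge0// ltW.
rewrite [leRHS]mulrAC; apply: ler_wpM2r; first exact: powR_ge0.
by apply: ler_pM => //; exact: ltW.
Qed.

(** At [x != z] the squared gradient is [W z x / (2 * mu x)]. The weights at [z] are
    bounded and [p / 2 >= 1], so its power [p / 2] is at most a multiple of [W z x],
    which is summable. *)
Lemma fin_energy_unit_at z : fin_energy (fun x => (x == z)%:R).
Proof.
have bz : bnd_fun (fun x => (x == z)%:R : R).
  by exists 1 => x; case: (x == z); rewrite ?normr1 ?normr0.
pose S := rsum [set~ z] (W z).
have sW : asum [set~ z] (W z) by exact: asum_frac_weight.
have W0 x y : 0 <= W x y by exact: frac_weight_ge0.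
have S0 : 0 <= S by apply: rsum_ge0 => x _.
pose K := S / (2 * m1); have K0 : 0 <= K by rewrite divr_ge0// mulr_ge0// ltW.
have Dx x : x != z -> dens (fun x => (x == z)%:R) x * mu x <= K `^ (p / 2 - 1) * W z x.
  move=> xz; rewrite /Hsp_density (negbTE xz) normr0 powR0 ?(gt_eqF p0)// mulr0 addr0.
  rewrite (sqr_powR_half p (nab0 _ _)) sqr_frac_grad_norm// frac_grad_prod_unit_at//.
  rewrite eqxx (negbTE xz) subr0 mulr1.
  have p21 : 1 <= p / 2 by rewrite ler_pdivlMr// mul1r.
  have q0 : 0 <= (2 * mu x)^-1 * W x z by rewrite mulr_ge0// invr_ge0 mulr_ge0// ltW.
  have qK : (2 * mu x)^-1 * W x z <= K.
    rewrite /K mulrC frac_weight_sym//; apply: ler_pM => //.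
    - by rewrite invr_ge0 mulr_ge0// ltW.
    - by apply: term_le_rsum => //=; exact/eqP.
    - by rewrite lef_pV2 ?posrE ?mulr_gt0// ler_wpM2l.
  rewrite -(powR_pred p21 q0) [in leRHS]mulrC -mulrA [_ `^ _ * mu x]mulrC mulrA.
  apply: ler_pM; rewrite ?powR_ge0//.
  - by rewrite mulr_ge0// ltW.
  - have -> : (2 * mu x)^-1 * W x z * mu x = W z x / 2.
      rewrite (frac_weight_sym Glf s x z); move: (W z x) => c.
      by field; rewrite gt_eqF.
    by have := W0 z x; move: (W z x) => c c0; lra.
  - by apply: le_powR => //; rewrite subr_ge0.
apply: (@asum_bound _ _ _ _ (dens (fun x => (x == z)%:R) z * mu z + K `^ (p / 2 - 1) * S)).
move=> r ur _; rewrite (eq_bigr (fun x => dens (fun x => (x == z)%:R) x * mu x)); last first.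
  by move=> x _; rewrite ger0_norm.
rewrite (bigID (pred1 z))/=; apply: lerD.
  rewrite -big_filter; have [zr|zr] := boolP (z \in r).
    rewrite (_ : [seq i <- r | i == z] = [:: z]) ?big_seq1//.
    by rewrite -(filter_pred1_uniq ur zr).
  by rewrite big1_seq// => x /andP[_]; rewrite mem_filter => /andP[/eqP ->]; rewrite (negbTE zr).
apply: (@le_trans _ _ (\sum_(x <- r | x != z) K `^ (p / 2 - 1) * W z x)).
  by apply: ler_sum => x; exact: Dx.
rewrite -mulr_sumr ler_wpM2l ?powR_ge0// -big_filter; apply: sum_le_rsum => //.
  exact: filter_uniq.
by move=> x; rewrite mem_filter => /andP[/eqP].
Qed.

End Bounds.

End TotalEnergy.

(** * A mountain pass lemma for finitely supported functions *)

Section Descent.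
Context {R : realType} {V : countType} (r : seq V).
Implicit Types (u v w : V -> R) (t e d M : R).

Definition supp_in u := forall x, x \notin r -> u x = 0.

Definition unif_cont_on_bounded (Q : (V -> R) -> R) := forall M e : R, 0 < e ->
  exists2 d : R, 0 < d & forall u v, supp_in u -> supp_in v ->
    (forall x, `|u x| <= M) -> (forall x, `|v x| <= M) ->
    (forall x, `|u x - v x| <= d) -> `|Q u - Q v| <= e.

Definition unif_diff_on_bounded (J : (V -> R) -> R) (g : (V -> R) -> V -> R) :=
  forall M e : R, 0 < e -> exists2 d : R, 0 < d & forall u v, supp_in u -> supp_in v ->
    (forall x, `|u x| <= M) -> (forall x, `|v x| <= d) ->
    `|J (fun x => u x + v x) - J u - \sum_(x <- r) g u x * v x|
       <= e * \sum_(x <- r) `|v x|.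

Let N u : R := \sum_(x <- r) `|u x|.

Let path_cont (c : R -> V -> R) :=
  (forall t, supp_in (c t)) /\ forall x, continuous (fun t => c t x).

Let leN u x : supp_in u -> `|u x| <= N u.
Proof.
move=> su; have [xr|xr] := boolP (x \in r); last by rewrite su// normr0 sumr_ge0.
by rewrite /N (big_rem x)//= lerDl sumr_ge0.
Qed.

Let continuous_sum (s : seq V) (F : V -> R -> R) :
  (forall x, continuous (F x)) -> continuous (fun t => \sum_(x <- s) F x t).
Proof.
move=> cF t; elim: s => [|x s IH].
  by under eq_fun do rewrite big_nil; exact: cvg_cst.
have -> : (fun t => \sum_(y <- x :: s) F y t) = (fun t => F x t + \sum_(y <- s) F y t).
  by apply/funext => t'; rewrite big_cons.
exact: cvgD (cF x t) IH.
Qed.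

Let path_contQ Q c : unif_cont_on_bounded Q -> path_cont c ->
  continuous (fun t => Q (c t)).
Proof.
move=> uQ [sc cc] t0; apply/cvgrPdist_le => /= e e0.
have [d d0 H] := uQ (N (c t0) + 1) e e0.
have cN : continuous (fun t => \sum_(x <- r) `|c t0 x - c t x|).
  apply: continuous_sum => x t; apply: cvg_norm; apply: cvgB; [exact: cvg_cst|exact: cc].
have := cN t0; rewrite /continuous_at [\sum_(x <- r) `|c t0 x - c t0 x|]big1; last first.
  by move=> x _; rewrite subrr normr0.
have m0 : 0 < Num.min d 1 by rewrite lt_min d0 ltr01.
move=> /cvgrPdist_le/(_ _ m0); apply: filterS => t.
rewrite sub0r normrN ger0_norm ?sumr_ge0// le_min => /andP[Hd H1].
have Hx x : `|c t0 x - c t x| <= \sum_(x <- r) `|c t0 x - c t x|.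
  by apply: (@leN (fun x => c t0 x - c t x)) => y yr; rewrite !sc// subrr.
apply: H => // x.
- by apply: le_trans (leN x (sc t0)) _; rewrite lerDl.
- have -> : c t x = c t0 x - (c t0 x - c t x) by ring.
  apply: le_trans (ler_normB _ _) _; apply: lerD; first exact: leN.
  exact: le_trans (Hx x) _.
- exact: le_trans (Hx x) _.
Qed.

Let unif_diff_cont (J : (V -> R) -> R) (g : (V -> R) -> V -> R) :
  (forall M : R, exists K : R, forall u, supp_in u -> (forall x, `|u x| <= M) ->
     forall x, x \in r -> `|g u x| <= K) ->
  unif_diff_on_bounded J g -> unif_cont_on_bounded J.
Proof.
move=> bg uJ M e e0.
pose n : R := (size r)%:R; have n0 : 0 <= n by rewrite ler0n.
have [d1 d10 H1] := uJ M 1 ltr01; have [L HL] := bg M.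
have L1 : 0 < (Num.max L 0 + 1) * (n + 1).
  rewrite mulr_gt0//; last by lra.
  by rewrite ltr_wpDl// le_max lexx orbT.
exists (Num.min d1 (e / ((Num.max L 0 + 1) * (n + 1)))).
  by rewrite lt_min d10 divr_gt0.
move=> u v su sv uM vM uv.
have sw : supp_in (fun x => v x - u x) by move=> x xr; rewrite su// sv// subrr.
have wd x : `|v x - u x| <= d1.
  by rewrite distrC; apply: le_trans (uv x) _; rewrite ge_min lexx.
have wd2 x : `|v x - u x| <= e / ((Num.max L 0 + 1) * (n + 1)).
  by rewrite distrC; apply: le_trans (uv x) _; rewrite ge_min lexx orbT.
have := H1 u _ su sw uM wd.
have -> : (fun x => u x + (v x - u x)) = v by apply/funext => x; ring.
set S := \sum_(x <- r) g u x * _; set W := \sum_(x <- r) _.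
have SW : `|S| <= Num.max L 0 * W.
  apply: le_trans (ler_norm_sum _ _ _) _; rewrite mulr_sumr big_seq [leRHS]big_seq.
  apply: ler_sum => x xr; rewrite normrM ler_wpM2r// le_max.
  by rewrite (HL u su uM x xr).
have WE : W <= n * (e / ((Num.max L 0 + 1) * (n + 1))).
  apply: (@le_trans _ _ (\sum_(x <- r) (e / ((Num.max L 0 + 1) * (n + 1))))).
    by apply: ler_sum => x _; exact: wd2.
  by rewrite big_const_seq iter_addr_0 count_predT mulr_natl.
have : (Num.max L 0 + 1) * W <= e.
  have L0 : 0 < Num.max L 0 + 1 by rewrite ltr_wpDl// le_max lexx orbT.
  have := ler_wpM2l (ltW L0) WE; move/le_trans; apply.
  have -> : (Num.max L 0 + 1) * (n * (e / ((Num.max L 0 + 1) * (n + 1)))) =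
    e * (n / (n + 1)) by field; lra.
  rewrite ler_piMr ?(ltW e0)// ler_pdivrMr; lra.
move: SW; move: (Num.max L 0) => L' SW HW; rewrite mul1r => H.
rewrite distrC; have -> : J v - J u = (J v - J u - S) + S by ring.
apply: le_trans (ler_normD _ _) _; apply: le_trans (lerD H SW) _.
by rewrite [leLHS](_ : _ = (L' + 1) * W)//; ring.
Qed.

(** A finite-dimensional mountain pass lemma without minimax over paths. The
    functional [J] is nonnegative on [{q <= rr}] and at least [rho] on
    [{q = rr}], so the set [B = {q < rr, J < rho}] traps every continuous
    descent. Iterate a continuous damped gradient step [T] along the segment
    from 0 to [z]: the parameters whose orbit enters [B] form an open set
    which contains 0 but not 1, so some orbit, starting at its supremum [ts],
    avoids [B] for ever while [J] stays nonnegative along it. Since the length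
    of an orbit is controlled by the decrease of [J], this orbit is bounded and
    must come across points where the gradient is small. *)
Lemma mountain_pass_descent (J q : (V -> R) -> R) (g : (V -> R) -> V -> R)
    (rr rho C : R) (z : V -> R) :
  (forall x, x \in r -> unif_cont_on_bounded (g ^~ x)) ->
  (forall M : R, exists K : R, forall u, supp_in u -> (forall x, `|u x| <= M) ->
     forall x, x \in r -> `|g u x| <= K) ->
  unif_diff_on_bounded J g -> unif_cont_on_bounded q ->
  q (fun=> 0) < rr -> J (fun=> 0) < rho ->
  (forall u, supp_in u -> q u <= rr -> 0 <= J u) ->
  (forall u, supp_in u -> q u = rr -> rho <= J u) ->
  supp_in z -> J z < 0 ->
  (forall t, 0 <= t <= 1 -> J (fun x => t * z x) <= C) ->
  forall eps : R, 0 < eps -> exists u, [/\ supp_in u, ~ (q u < rr /\ J u < rho),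
    0 <= J u <= C & \sum_(x <- r) g u x ^+ 2 <= eps].
Proof.
move=> ucg bg uJ ucq q0 J0 Jpos Jshell sz Jz JC eps eps0.
apply: contrapT => nex.
(* the damping vanishes where the squared gradient is below this value *)
pose ep : R := eps / 2; have ep0 : 0 < ep by rewrite divr_gt0.
pose s : R := Num.sqrt ep; have s0 : 0 < s by rewrite sqrtr_gt0.
have s2 : s ^+ 2 = ep by rewrite sqr_sqrtr// ltW.
pose n : R := (size r)%:R; have n0 : 0 <= n by rewrite ler0n.
pose G u := \sum_(x <- r) g u x ^+ 2.
have G0 u : 0 <= G u by apply: sumr_ge0 => x _; exact: sqr_ge0.
have gG u x : x \in r -> ep <= G u -> s * `|g u x| <= G u.
  move=> xr epG.
  have gx : `|g u x| ^+ 2 <= G u.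
    by rewrite real_normK ?num_real// /G (big_rem x)//= lerDl sumr_ge0// => y _; exact: sqr_ge0.
  rewrite -(@ler_pXn2r _ 2) ?nnegrE// ?mulr_ge0//; last exact: ltW.
  by rewrite exprMn s2 [leRHS]expr2 ler_pM ?(ltW ep0)// sqr_ge0.
have sumg u : ep <= G u -> s * N (g u) <= n * G u.
  move=> epG; rewrite mulr_sumr big_seq.
  apply: (@le_trans _ _ (\sum_(x <- r | x \in r) G u)).
    by apply: ler_sum => x xr; exact: gG.
  by rewrite -big_seq big_const_seq iter_addr_0 count_predT mulr_natl.
have C0 : 0 <= C.
  apply: le_trans (JC 0 _); last by rewrite lexx ler01.
  have -> : (fun x => 0 * z x) = (fun=> 0) by apply/funext => x; rewrite mul0r.
  by apply: Jpos; [move=> x _|exact: ltW].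
(* no orbit starting on the segment leaves the ball of this radius as long as
   the functional stays nonnegative *)
pose R0 := N z + 2 * n / s * C.
have Nz0 : 0 <= N z by rewrite sumr_ge0.
have R00 : 0 <= R0 by rewrite addr_ge0// mulr_ge0// divr_ge0 ?mulr_ge0// ltW.
have [K0 HK0] := bg (R0 + 1).
pose K : R := Num.max K0 0; have K_0 : 0 <= K by rewrite le_max lexx orbT.
have HK u : supp_in u -> N u <= R0 + 1 -> forall x, x \in r -> `|g u x| <= K.
  move=> su Nu x xr; rewrite le_max; apply/orP; left; apply: HK0 => // y.
  exact: le_trans (leN _ su) Nu.
have eJ0 : 0 < s / (2 * (n + 1)) by rewrite divr_gt0// mulr_gt0//; lra.
have [d d0 Hd] := uJ (R0 + 1) _ eJ0.
pose eta := d / (1 + n * K ^+ 2 * K).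
have den0 : 0 < 1 + n * K ^+ 2 * K by rewrite ltr_pwDl// !mulr_ge0// sqr_ge0.
have eta0 : 0 < eta by rewrite divr_gt0.
(* the cut-off confines the steps to a ball where the descent estimate is
   uniform *)
pose chi u : R := Num.max 0 (Num.min 1 (R0 + 1 - N u)).
have chi0 u : 0 <= chi u by rewrite le_max lexx.
have chi1 u : chi u <= 1 by rewrite ge_max ler01 ge_min lexx.
have chiN u : chi u != 0 -> N u <= R0 + 1.
  apply: contraNT; rewrite -ltNge => H; apply/eqP/max_idPl.
  by rewrite ge_min; apply/orP; right; lra.
have chiE u : N u <= R0 -> chi u = 1.
  move=> H; rewrite /chi (min_idPl _) ?(max_idPr _)//; lra.
pose c u := eta * (chi u * Num.max 0 (G u - ep)).
have c0 u : 0 <= c u by rewrite mulr_ge0 ?(ltW eta0)// mulr_ge0// le_max lexx.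
have cG u : c u != 0 -> ep <= G u.
  move=> cn0; rewrite leNgt; apply: contra cn0 => Gep.
  by rewrite /c (max_idPl _) ?mulr0//; lra.
pose gg u x := if x \in r then g u x else 0.
pose seg a u x := u x - a * c u * gg u x.
have sseg a u : supp_in u -> supp_in (seg a u).
  by move=> su x xr; rewrite /seg /gg (negbTE xr) su// mulr0 subr0.
have step (a : R) u : supp_in u -> 0 <= a <= 1 ->
    J (seg a u) <= J u - a * c u * G u / 2.
  move=> su /andP[a0 a1].
  have [cu0|cn0] := eqVneq (c u) 0.
    have -> : seg a u = u by apply/funext => x; rewrite /seg cu0 mulr0 mul0r subr0.
    by rewrite cu0 mulr0 !mul0r subr0.
  have epG := cG u cn0.
  have Nu : N u <= R0 + 1.
    by apply: chiN; apply: contra cn0 => /eqP h; rewrite /c h mul0r mulr0.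
  have Gb : G u <= n * K ^+ 2.
    rewrite /G big_seq; apply: (@le_trans _ _ (\sum_(x <- r | x \in r) K ^+ 2)).
      apply: ler_sum => x xr; rewrite -[g u x ^+ 2]real_normK ?num_real//.
      by rewrite ler_pXn2r ?nnegrE// HK.
    by rewrite -big_seq big_const_seq iter_addr_0 count_predT mulr_natl.
  have cb : c u * K <= d.
    have : c u <= eta * (n * K ^+ 2).
      rewrite ler_wpM2l ?(ltW eta0)//.
      apply: (@le_trans _ _ (1 * (n * K ^+ 2))); last by rewrite mul1r.
      apply: ler_pM => //; first by rewrite le_max lexx.
      by rewrite ge_max mulr_ge0 ?sqr_ge0//=; lra.
    move=> /(ler_wpM2r K_0)/le_trans; apply.
    have -> : eta * (n * K ^+ 2) * K = d * ((n * K ^+ 2 * K) / (1 + n * K ^+ 2 * K)).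
      by rewrite /eta; field; rewrite gt_eqF.
    by rewrite ler_piMr ?(ltW d0)// ler_pdivrMr//; lra.
  have ac0 : 0 <= a * c u by apply: mulr_ge0.
  pose v x := - (a * c u * gg u x).
  have sv : supp_in v by move=> x xr; rewrite /v /gg (negbTE xr) mulr0 oppr0.
  have vd x : `|v x| <= d.
    have [xr|xr] := boolP (x \in r); last by rewrite sv// normr0 ltW.
    rewrite /v /gg xr normrN normrM (ger0_norm ac0).
    apply: le_trans cb; apply: ler_pM => //; last exact: HK.
    by rewrite ler_piMl.
  have := Hd u v su sv (fun x => le_trans (leN x su) Nu) vd.
  have -> : (fun x => u x + v x) = seg a u by [].
  have -> : \sum_(x <- r) g u x * v x = - (a * c u * G u).
    rewrite /G mulr_sumr -sumrN big_seq [RHS]big_seq; apply: eq_bigr => x xr.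
    by rewrite /v /gg xr; ring.
  have -> : \sum_(x <- r) `|v x| = a * c u * N (g u).
    rewrite /N mulr_sumr big_seq [RHS]big_seq; apply: eq_bigr => x xr.
    by rewrite /v /gg xr normrN normrM (ger0_norm ac0).
  move=> /(le_trans (ler_norm _)).
  move: (a * c u) ac0 => b b0.
  have : s / (2 * (n + 1)) * (b * N (g u)) <= b * G u / 2.
    have -> : s / (2 * (n + 1)) * (b * N (g u)) = b * (s * N (g u)) / (2 * (n + 1)).
      by field; lra.
    rewrite ler_pdivrMr; last by lra.
    have -> : b * G u / 2 * (2 * (n + 1)) = b * ((n + 1) * G u) by field.
    rewrite ler_wpM2l//; apply: le_trans (sumg u epG) _.
    by rewrite ler_wpM2r//; lra.
  by lra.
pose T u := seg 1 u.
have sT u : supp_in u -> supp_in (T u) by exact: sseg.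
have stepT u : supp_in u -> J (T u) <= J u - c u * G u / 2.
  by move=> su; have := step 1 u su; rewrite mul1r; apply; rewrite ler01 lexx.
have ucJ := unif_diff_cont bg uJ.
have contN cc : path_cont cc -> continuous (fun t => N (cc t)).
  by move=> [_ h]; apply: continuous_sum => x t; apply: cvg_norm; exact: h.
have contg cc x : path_cont cc -> continuous (fun t => gg (cc t) x).
  move=> h; rewrite /gg; case: (boolP (x \in r)) => xr; last by move=> t; exact: cvg_cst.
  exact: (path_contQ (ucg x xr) h).
have contG cc : path_cont cc -> continuous (fun t => G (cc t)).
  move=> h; have -> : (fun t => G (cc t)) = (fun t => \sum_(x <- r) gg (cc t) x * gg (cc t) x).
    apply/funext => t; rewrite /G big_seq [RHS]big_seq; apply: eq_bigr => x xr.
    by rewrite /gg xr expr2.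
  by apply: continuous_sum => x t; apply: cvgM; exact: contg.
have contc cc : path_cont cc -> continuous (fun t => c (cc t)).
  move=> h t; apply: cvgM; first exact: cvg_cst.
  apply: cvgM.
    have : continuous (fun t => Num.max 0 (Num.min 1 (R0 + 1 - N (cc t)))).
      apply: (@max_fun_continuous _ R R (fun=> 0)
               (fun t => Num.min 1 (R0 + 1 - N (cc t)))).
        by move=> t'; exact: cvg_cst.
      apply: (@min_fun_continuous _ R R (fun=> 1) (fun t => R0 + 1 - N (cc t))).
        by move=> t'; exact: cvg_cst.
      by move=> t'; apply: cvgB; [exact: cvg_cst|exact: contN].
    exact.
  have : continuous (fun t => Num.max 0 (G (cc t) - ep)).
    apply: (@max_fun_continuous _ R R (fun=> 0) (fun t => G (cc t) - ep)).
      by move=> t'; exact: cvg_cst.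
    by move=> t'; apply: cvgB; [exact: contG|exact: cvg_cst].
  exact.
have pathT cc : path_cont cc -> path_cont (fun t => T (cc t)).
  move=> h; have [h1 h2] := h; split=> [t|x t]; first exact: sT.
  apply: cvgB; first exact: h2.
  apply: cvgM; last exact: contg.
  by apply: cvgM; [exact: cvg_cst|exact: contc].
pose gam k t := iter k T (fun x => t * z x).
have pgam k : path_cont (gam k).
  elim: k => [|k IH]; last exact: pathT.
  split=> [t x xr|x t]; first by rewrite /gam/= sz// mulr0.
  by apply: cvgM; [exact: cvg_id|exact: cvg_cst].
pose B u := q u < rr /\ J u < rho.
have BJ u : supp_in u -> B u -> 0 <= J u by move=> su [/ltW qu _]; exact: Jpos.
have BT u : supp_in u -> B u -> B (T u).
  move=> su [qu Ju]; split; last first.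
    by apply: le_lt_trans (stepT u su) _; rewrite ltrBlDr ltr_wpDr// divr_ge0//; apply: mulr_ge0.
  rewrite ltNge; apply/negP => qT.
  have pseg : path_cont (fun a => seg a u).
    split=> [a|x a]; first exact: sseg.
    apply: cvgB; first exact: cvg_cst.
    by apply: cvgM; [apply: cvgM; [exact: cvg_id|exact: cvg_cst]|exact: cvg_cst].
  have seg0 : seg 0 u = u by apply/funext => x; rewrite /seg !mul0r subr0.
  have [||a a01 qa] := @IVT R (fun a => q (seg a u)) 0 1 rr ler01.
  - by apply: continuous_subspaceT; exact: (path_contQ ucq pseg).
  - rewrite seg0 ge_min le_max; apply/andP; split; apply/orP; [left; exact: ltW|right; exact: qT].
  have := Jshell _ (sseg a u su) qa; apply/negP; rewrite -ltNge.
  have a01' : 0 <= a <= 1 by move: a01; rewrite in_itv.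
  apply: le_lt_trans (step a u su a01') _; rewrite ltrBlDr ltr_wpDr//.
  by rewrite divr_ge0//; apply: mulr_ge0 => //; apply: mulr_ge0 => //; case/andP: a01'.
have sgam k t : supp_in (gam k t) by case: (pgam k).
have gamS k j t : gam (j + k)%N t = iter j T (gam k t) by rewrite /gam iterD.
have Jmono k j t : J (gam (j + k)%N t) <= J (gam k t).
  elim: j => [//|j IH]; rewrite addSn; apply: le_trans IH.
  apply: le_trans (stepT _ (sgam _ _)) _.
  by rewrite lerBlDr lerDl divr_ge0//; apply: mulr_ge0.
have Bmono k j t : B (gam k t) -> B (gam (j + k)%N t).
  by move=> Bk; elim: j => [//|j IH]; rewrite addSn; apply: BT => //; exact: sgam.
pose A t := exists k, B (gam k t).
have Aopen t0 : A t0 -> \forall t \near t0, A t.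
  move=> [k [qk Jk]].
  have Hq : \forall t \near t0, q (gam k t) < rr.
    exact: (cvgr_lt _ (path_contQ ucq (pgam k) (x:=t0))).
  have HJ : \forall t \near t0, J (gam k t) < rho.
    exact: (cvgr_lt _ (path_contQ ucJ (pgam k) (x:=t0))).
  by near=> t; exists k; split; near: t.
have A0 : A 0.
  exists 0%N; rewrite /B /gam/=.
  have -> : (fun x => 0 * z x) = (fun=> 0) by apply/funext => x; rewrite mul0r.
  by split.
have A1 : ~ A 1.
  move=> [k Bk]; have := BJ _ (sgam _ _) Bk; apply/negP; rewrite -ltNge.
  have := Jmono 0%N k 1; rewrite addn0 => /le_lt_trans; apply.
  rewrite /gam/=; have -> : (fun x => 1 * z x) = z by apply/funext => x; rewrite mul1r.
  exact: Jz.
pose A' := [set t : R | 0 <= t <= 1 /\ A t].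
have hsA : has_sup A'.
  split; first by exists 0; split => //; rewrite lexx ler01.
  by exists 1 => t [/andP[_ ?] _].
pose ts : R := sup A'.
have leA t : 0 <= t <= 1 -> A t -> t <= ts.
  by move=> t01 At; apply: (ub_le_sup hsA.2); split.
have ts01 : 0 <= ts <= 1.
  apply/andP; split; first by apply: leA => //; rewrite lexx ler01.
  by apply: (ge_sup hsA.1) => t [/andP[_ ?] _].
have nAts : ~ A ts.
  move=> Ats; have [ts1|ts1] := eqVneq ts 1; first by apply: A1; rewrite -ts1.
  have tl1 : ts < 1 by rewrite lt_neqAle ts1; case/andP: ts01.
  have [dd /= dd0 H] := Aopen ts Ats.
  pose t := Num.min (ts + dd / 2) 1.
  have tst : ts < t by rewrite lt_min tl1 andbT; lra.
  have : t <= ts.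
    apply: leA.
      apply/andP; split; last by rewrite ge_min lexx orbT.
      by apply: ltW; apply: le_lt_trans tst; case/andP: ts01.
    apply: H => /=; rewrite distrC gtr0_norm ?subr_gt0//.
    have : t <= ts + dd / 2 by rewrite ge_min lexx.
    lra.
  by rewrite leNgt tst.
have Jts k : 0 <= J (gam k ts).
  rewrite leNgt; apply/negP => Jn.
  have : \forall t \near ts, J (gam k t) < 0.
    exact: (cvgr_lt _ (path_contQ ucJ (pgam k) (x:=ts))).
  move=> [dd /= dd0 H].
  have [t [t01 [j Bj]] ht] := sup_adherent dd0 hsA.
  have tle : t <= ts by apply: leA => //; exists j.
  have Jt : J (gam k t) < 0.
    apply: H => /=; rewrite ger0_norm ?subr_ge0//; move: ht; rewrite -/ts; lra.
  have := BJ _ (sgam _ _) (Bmono j k t Bj); apply/negP; rewrite -ltNge.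
  by rewrite addnC; apply: le_lt_trans Jt; exact: Jmono.
have Jts0 : J (gam 0%N ts) <= C by exact: JC.
have Gts k : eps < G (gam k ts).
  rewrite ltNge; apply/negP => Gk; apply: nex; exists (gam k ts); split => //.
  - by move=> Bk; apply: nAts; exists k.
  - rewrite Jts/=; apply: le_trans Jts0; have := Jmono 0%N k ts.
    by rewrite addn0.
have Nk k : N (gam k ts) <= N z + 2 * n / s * (J (gam 0%N ts) - J (gam k ts)).
  elim: k => [|k IH].
    rewrite subrr mulr0 addr0 /N; apply: ler_sum => x _; rewrite /gam/= normrM.
    by rewrite ler_piMl// ger0_norm; case/andP: ts01.
  have epG : ep <= G (gam k ts) by apply: le_trans (ltW (Gts k)); rewrite /ep; lra.
  have h1 : N (gam k.+1 ts) <= N (gam k ts) + c (gam k ts) * N (g (gam k ts)).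
    rewrite /N mulr_sumr -big_split/= big_seq [leRHS]big_seq; apply: ler_sum => x xr.
    rewrite /T /seg /gg xr mul1r; apply: le_trans (ler_normB _ _) _.
    by rewrite normrM (ger0_norm (c0 _)).
  have h2 := stepT _ (sgam k ts).
  have h3 : c (gam k ts) * N (g (gam k ts)) <= 2 * n / s * (c (gam k ts) * G (gam k ts) / 2).
    have -> : 2 * n / s * (c (gam k ts) * G (gam k ts) / 2) =
      c (gam k ts) * (n * G (gam k ts) / s) by field; rewrite gt_eqF.
    by rewrite ler_wpM2l// ler_pdivlMr// mulrC; exact: sumg.
  have h4 : 2 * n / s * (c (gam k ts) * G (gam k ts) / 2) <=
      2 * n / s * (J (gam k ts) - J (gam k.+1 ts)).
    rewrite ler_wpM2l//; last by rewrite [gam k.+1 ts]/=; move: h2; rewrite /gam /=; lra.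
    by rewrite divr_ge0 ?mulr_ge0// ltW.
  by lra.
have cts k : eta * ep <= c (gam k ts).
  rewrite ler_wpM2l ?(ltW eta0)// chiE ?mul1r.
    by rewrite le_max; apply/orP; right; have := Gts k; rewrite /ep; lra.
  apply: le_trans (Nk k) _; rewrite lerD2l ler_wpM2l//.
    by rewrite divr_ge0 ?mulr_ge0// ltW.
  by have := Jts k; lra.
have Jdec k : J (gam k ts) <= C - k%:R * (eta * ep * ep).
  elim: k => [|k IH]; first by rewrite mul0r subr0.
  have kS : k.+1%:R = k%:R + 1 :> R by rewrite natr1.
  apply: le_trans (stepT _ (sgam k ts)) _; rewrite kS mulrDl mul1r.
  have : eta * ep * ep <= c (gam k ts) * G (gam k ts) / 2.
    rewrite ler_pdivlMr//.
    have -> : eta * ep * ep * 2 = (eta * ep) * (ep * 2) by ring.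
    apply: ler_pM => //.
    - by apply: mulr_ge0; apply: ltW.
    - by apply: mulr_ge0 => //; apply: ltW.
    by have := Gts k; rewrite /ep; lra.
  by lra.
have ee0 : 0 < eta * ep * ep by apply: mulr_gt0 => //; apply: mulr_gt0.
have [k Hk] : exists k : nat, C / (eta * ep * ep) < k%:R.
  by eexists; apply: archi_boundP; rewrite divr_ge0// ltW.
have := le_trans (Jts k) (Jdec k); rewrite subr_ge0 -ler_pdivlMr//.
by rewrite leNgt Hk.
Unshelve. all: by end_near. Qed.

End Descent.

(** * The energy of finitely supported functions *)

Section FiniteSupport.
Context {R : realType} {V : countType} (G : weighted_graph R V).
Hypothesis Glf : locally_finite G.
Hypothesis Gsc : stochastically_complete G.
Variables (s p : R) (h : V -> R).
Hypothesis s01 : 0 < s < 1.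
Hypothesis p2 : 2 <= p.
Hypothesis h_gt0 : forall x, 0 < h x.
Variable m1 : R.
Hypothesis m1_gt0 : 0 < m1.
Hypothesis m1P : forall x, m1 <= vmeas G x.
Local Notation mu := (vmeas G).
Local Notation nabla := (frac_grad_norm G s).
Local Notation fin_energy := (fin_energy G s p h).
Local Notation energy := (energy G s p h).
Local Notation energy_form := (energy_form G s p h).
Implicit Types (x y z : V) (u v w phi : V -> R) (a b c d e M N : R) (r : seq V).

Let mu0 x : 0 < mu x := vmeas_gt0 G x.
Let p0 : 0 < p. Proof. exact: lt_le_trans p2. Qed.
Let nab0 u x : 0 <= nabla u x. Proof. exact: frac_grad_norm_ge0. Qed.

Definition unit_at z : V -> R := fun x => (x == z)%:R.

Lemma bnd_unit_at z : bnd_fun (unit_at z).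
Proof. by exists 1 => x; rewrite /unit_at; case: (x == z); rewrite ?normr1 ?normr0. Qed.

Lemma bnd_sum_unit_at r (c : V -> R) : bnd_fun (fun x => \sum_(z <- r) c z * unit_at z x).
Proof.
elim: r => [|z r IH].
  by exists 0 => x; rewrite big_nil normr0.
have := bnd_funD (bnd_funZ (c z) (bnd_unit_at z)) IH.
by congr bnd_fun; apply/funext => x; rewrite big_cons.
Qed.

Lemma supp_in_sum_unit_at r u : uniq r -> supp_in r u -> u = (fun x => \sum_(z <- r) u z * unit_at z x).
Proof.
move=> ur su; apply/funext => x; rewrite /unit_at.
have [xr|xr] := boolP (x \in r); last first.
  rewrite su// big1_seq// => z /andP[_ zr].
  by case: eqVneq => [xz|_]; [move: xr; rewrite xz zr|rewrite mulr0].
rewrite (big_rem x)//= eqxx mulr1 big1_seq ?addr0// => z /andP[_].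
by rewrite rem_filter// mem_filter /= eq_sym => /andP[/negbTE -> _]; rewrite mulr0.
Qed.

(** A common majorant of the gradients of the functions supported in [r] and
    bounded by 1. *)
Let psi r x : R := \sum_(z <- r) nabla (unit_at z) x.
Let chi r x : R := (x \in r)%:R.
Let Psi r x : R := psi r x `^ p + h x * chi r x `^ p.

Let psi0 r x : 0 <= psi r x. Proof. by apply: sumr_ge0. Qed.
Let chi0 r x : 0 <= chi r x. Proof. by rewrite /chi. Qed.
Let Psi0 r x : 0 <= Psi r x.
Proof. by rewrite addr_ge0 ?powR_ge0// mulr_ge0 ?powR_ge0// ltW. Qed.

Lemma grad_sum_unit_at r (c : V -> R) x :
  nabla (fun x => \sum_(z <- r) c z * unit_at z x) x <= \sum_(z <- r) `|c z| * nabla (unit_at z) x.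
Proof.
elim: r => [|z r IH].
  have -> : (fun x => \sum_(z <- [::]) c z * unit_at z x) = (fun x => 0 * unit_at x x).
    by apply/funext => y; rewrite big_nil mul0r.
  rewrite big_nil; have b1 : bnd_fun (fun x => unit_at x x).
    by exists 1 => y; rewrite /unit_at eqxx normr1.
  by rewrite (frac_grad_normZ Glf Gsc s01 0 x b1) normr0 mul0r.
have -> : (fun x => \sum_(z <- z :: r) c z * unit_at z x) =
    (fun x => c z * unit_at z x + \sum_(z <- r) c z * unit_at z x).
  by apply/funext => y; rewrite big_cons.
rewrite big_cons -(frac_grad_normZ Glf Gsc s01 (c z) x (bnd_unit_at z)).
apply: le_trans (frac_grad_normD Glf Gsc s01 x (bnd_funZ _ (bnd_unit_at z)) (bnd_sum_unit_at r c)) _.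
by rewrite lerD2l.
Qed.

Let grad_supp r u M x : uniq r -> supp_in r u -> (forall x, `|u x| <= M) ->
  nabla u x <= M * psi r x.
Proof.
move=> ur su uM; rewrite {1}(supp_in_sum_unit_at ur su).
apply: le_trans (grad_sum_unit_at r u x) _; rewrite /psi mulr_sumr.
by apply: ler_sum => z _; rewrite ler_wpM2r.
Qed.

Let val_supp r u M x : supp_in r u -> (forall x, `|u x| <= M) -> `|u x| <= M * chi r x.
Proof.
move=> su uM; rewrite /chi; have [xr|xr] := boolP (x \in r); first by rewrite mulr1.
by rewrite su// normr0 mulr0.
Qed.

Let asum_Psi r : uniq r -> asum [set: V] (fun x => Psi r x * mu x).
Proof.
move=> ur.
have s1 (q : seq V) : asum [set: V] (fun x => psi q x `^ p * mu x).
  elim: q => [|z q IH].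
    have [||sq _] := @rsum_seq R V setT (fun x => psi [::] x `^ p * mu x) [::] isT => // x _ _.
    by rewrite /psi big_nil powR0 ?mul0r// gt_eqF.
  have fz := fin_energy_unit_at Glf Gsc s01 p2 h_gt0 m1_gt0 m1P z.
  have [gz _] := fin_energy_grad h_gt0 fz.
  apply: (@le_asum _ _ _ _ (fun x => 2 `^ p * (nabla (unit_at z) x `^ p * mu x + psi q x `^ p * mu x))).
    move=> x _; rewrite !ger0_norm; last 2 first.
    - by rewrite mulr_ge0 ?powR_ge0// addr_ge0// mulr_ge0 ?powR_ge0// ltW.
    - by rewrite mulr_ge0 ?powR_ge0// ltW.
    rewrite -mulrDl mulrA ler_wpM2r ?(ltW (mu0 x))// /psi big_cons.
    exact: (powR_add_le (ltW p0) (nab0 (unit_at z) x) (psi0 q x)).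
  exact: (asumZ (2 `^ p) (asumD gz IH)).
have [||s2 _] := @rsum_seq R V setT (fun x => h x * chi r x `^ p * mu x) r ur => //.
  by move=> x _ /negbTE xr; rewrite /chi xr powR0 ?mulr0 ?mul0r// gt_eqF.
have -> : (fun x => Psi r x * mu x) = (fun x => psi r x `^ p * mu x + h x * chi r x `^ p * mu x).
  by apply/funext => x; rewrite mulrDl.
exact: (asumD (s1 r) s2).
Qed.

Lemma supp_in_bnd r u : supp_in r u -> bnd_fun u.
Proof. exact: bnd_fun_seq. Qed.

Lemma fin_energy_supp r u : uniq r -> supp_in r u -> fin_energy u.
Proof.
move=> ur su; have [M uM] := supp_in_bnd su.
have M0 : 0 <= Num.max M 0 by rewrite le_max lexx orbT.
have uM' x : `|u x| <= Num.max M 0 by rewrite le_max uM.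
apply: (@le_asum _ _ _ _ (fun x => Num.max M 0 `^ p * (Psi r x * mu x))); last first.
  exact: (asumZ (Num.max M 0 `^ p) (asum_Psi ur)).
move=> x _; rewrite !ger0_norm; last 2 first.
- by rewrite mulr_ge0 ?powR_ge0// mulr_ge0// ltW.
- by rewrite mulr_ge0 ?(ltW (mu0 x))// dens_ge0.
rewrite mulrA ler_wpM2r ?(ltW (mu0 x))// /Psi /Hsp_density mulrDr mulrCA -!powRM//.
apply: lerD; first by apply: le_powR; [exact: ltW|exact: nab0|exact: grad_supp].
by rewrite ler_wpM2l ?(ltW (h_gt0 x))//; apply: le_powR; [exact: ltW| |exact: val_supp].
Qed.

(** The gradients of all functions involved are bounded by multiples of the same
    function [psi], whose density is summable. *)
Lemma energy_form_lip_supp r : uniq r -> exists2 S : R, 0 <= S &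
  forall u v phi M d e, supp_in r u -> supp_in r v -> supp_in r phi ->
    0 <= M -> 0 <= d -> 0 <= e ->
    (forall x, `|u x| <= M) -> (forall x, `|v x| <= M) ->
    (forall x, `|u x - v x| <= d) -> (forall x, `|phi x| <= e) ->
    `|energy_form u phi - energy_form v phi| <= p * M `^ (p - 2) * d * e * S.
Proof.
move=> ur; exists (rsum [set: V] (fun x => Psi r x * mu x)).
  by apply: rsum_ge0 => x _; rewrite mulr_ge0// ltW.
move=> u v phi M d e su sv sphi M0 d0 e0 uM vM uvd phie.
have [bu [bv bphi]] : bnd_fun u /\ bnd_fun v /\ bnd_fun phi.
  by split; [exact: supp_in_bnd su|split; [exact: supp_in_bnd sv|exact: supp_in_bnd sphi]].
have fu := fin_energy_supp ur su; have fv := fin_energy_supp ur sv.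
have fphi := fin_energy_supp ur sphi.
have s1 := asum_form Glf Gsc s01 p2 h_gt0 bu bphi fu fphi.
have s2 := asum_form Glf Gsc s01 p2 h_gt0 bv bphi fv fphi.
have suv : supp_in r (fun x => u x - v x) by move=> x xr; rewrite su// sv// subrr.
pose k := p * M `^ (p - 2) * d * e.
have sP := asumZ k (asum_Psi ur).
rewrite -(rsumZ k (asum_Psi ur)) /energy_form -(rsumB s1 s2).
apply: le_trans (ler_norm_rsum (asumB s1 s2)) _.
apply: (ler_rsum ((asum_norm _ _).1 (asumB s1 s2)) sP) => x _.
rewrite -mulrBl normrM (gtr0_norm (mu0 x)) mulrA ler_wpM2r ?(ltW (mu0 x))//.
have H := dens_form_lip Glf Gsc s01 p2 h_gt0 bu bv bphi
  (grad_supp x ur su uM) (grad_supp x ur sv vM) (val_supp x su uM) (val_supp x sv vM).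
apply: le_trans H _.
have -> : k * Psi r x = p * (M `^ (p - 2) * (d * (e * Psi r x))) by rewrite /k; ring.
rewrite ler_wpM2l ?(ltW p0)//.
have powE a : 0 <= a -> (M * a) `^ (p - 2) * (d * a) * (e * a) = M `^ (p - 2) * (d * (e * a `^ p)).
  move=> a0; rewrite powRM//.
  have -> : a `^ p = a `^ (p - 2) * a ^+ 2.
    rewrite -powR_mulrn// -powRD; first by congr (_ `^ _); ring.
    by rewrite subrK (gt_eqF p0).
  by ring.
have t1 : (M * psi r x) `^ (p - 2) * nabla (fun y => u y - v y) x * nabla phi x <=
    M `^ (p - 2) * (d * (e * psi r x `^ p)).
  rewrite -powE//; apply: ler_pM => //; first by rewrite mulr_ge0 ?powR_ge0.
    by rewrite ler_wpM2l ?powR_ge0//; exact: grad_supp.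
  exact: grad_supp.
have t2 : (M * chi r x) `^ (p - 2) * `|u x - v x| * `|phi x| <=
    M `^ (p - 2) * (d * (e * chi r x `^ p)).
  rewrite -powE//; apply: ler_pM => //; first by rewrite mulr_ge0 ?powR_ge0.
    by rewrite ler_wpM2l ?powR_ge0//; exact: (val_supp x suv uvd).
  exact: val_supp.
apply: le_trans (lerD t1 (ler_wpM2l (ltW (h_gt0 x)) t2)) _.
by rewrite /Psi le_eqVlt; apply/orP; left; apply/eqP; gen_atoms; ring.
Qed.

End FiniteSupport.

(** * The nonlinearity *)

Section RealFunctions.
Context {R : realType}.
Implicit Types (k : R -> R) (y z v M e : R).

(** Compactness of the segment; the second point may leave it. *)
Lemma unif_cont_on_segment k M e : continuous k -> 0 < e ->
  exists2 d : R, 0 < d & forall y z, `|y| <= M -> `|y - z| <= d -> `|k y - k z| <= e.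
Proof.
move=> ck e0.
pose P (d : R) y := forall z, `|y - z| <= d -> `|k y - k z| <= e.
have := (@compact_near_coveringP R `[- M, M]%classic).1 (@segment_compact R (- M) M).
move=> /(_ R 0^'+ P _) H.
have : \forall d \near 0^'+, `[- M, M]%classic `<=` P d.
  apply: H => y _.
  have e2 : 0 < e / 2 by rewrite divr_gt0.
  have /cvgrPdist_le/(_ _ e2) [d /= d0 Hd] := ck y.
  exists ([set y' | `|y - y'| < d / 2], [set d' | d' < d / 2]).
    split => /=; first by exists (d / 2) => //=; rewrite divr_gt0.
    by apply: nbhs_right_lt; rewrite divr_gt0.
  move=> [y' d'] /= [h1 h2] z h3.
  have -> : k y' - k z = (k y - k z) - (k y - k y') by ring.
  apply: le_trans (ler_normB _ _) _.
  have a1 : `|k y - k y'| <= e / 2 by apply: Hd => /=; lra.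
  have a2 : `|k y - k z| <= e / 2.
    apply: Hd => /=; have -> : y - z = (y - y') + (y' - z) by ring.
    by apply: le_lt_trans (ler_normD _ _) _; lra.
  lra.
move=> Hn; have [d /= d0 Hd] := Hn.
exists (d / 2); first by rewrite divr_gt0.
move=> y z yM yz; apply: (Hd (d / 2)) => //=.
- by rewrite sub0r normrN gtr0_norm ?divr_gt0//; lra.
- by rewrite divr_gt0.
- by rewrite in_itv/= -ler_norml.
Qed.

(** The values at the [n] equally spaced points between 0 and [y] differ by at most
    1 from one to the next. *)
Lemma bounded_on_segment k M : continuous k ->
  exists2 C : R, 0 <= C & forall y, `|y| <= M -> `|k y| <= C.
Proof.
move=> ck; have [d d0 H] := unif_cont_on_segment M ck ltr01.
have [n Hn0] : exists n : nat, `|M / d| < n%:R.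
  by eexists; apply: archi_boundP; exact: normr_ge0.
have Hn : M / d < n%:R := le_lt_trans (ler_norm _) Hn0.
exists (`|k 0| + n%:R); first by rewrite addr_ge0.
move=> y yM.
have step (j : nat) : (j <= n)%N -> `|k (y * (j%:R / n%:R))| <= `|k 0| + j%:R.
  elim: j => [|j IH] jn; first by rewrite mul0r mulr0 addr0.
  have n0 : 0 < n%:R :> R by rewrite ltr0n; apply: leq_trans jn.
  have jn1 : j%:R / n%:R <= 1 :> R by rewrite ler_pdivrMr// mul1r ler_nat ltnW.
  have j0 : 0 <= j%:R / n%:R :> R by rewrite divr_ge0.
  have -> : k (y * (j.+1%:R / n%:R)) = k (y * (j%:R / n%:R)) -
     (k (y * (j%:R / n%:R)) - k (y * (j.+1%:R / n%:R))) by ring.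
  apply: le_trans (ler_normB _ _) _; rewrite -natr1 addrA lerD ?IH//; first exact: ltnW.
  apply: H.
    by rewrite normrM (ger0_norm j0); apply: le_trans yM; rewrite ler_piMr.
  have -> : y * (j%:R / n%:R) - y * ((j%:R + 1) / n%:R) = - (y / n%:R).
    by field; rewrite gt_eqF.
  rewrite normrN normrM normrV ?unitfE ?gt_eqF// (ger0_norm (ltW n0)) ler_pdivrMr//.
  by move: Hn; rewrite ltr_pdivrMr// => /ltW Hn; apply: le_trans yM _; rewrite mulrC.
case: n {Hn0} Hn step => [|n] Hn step.
  rewrite addr0; have M0 : M < 0 by move: Hn; rewrite ltr_pdivrMr// mul0r.
  by have := le_trans (normr_ge0 y) yM; rewrite leNgt M0.
by have := step n.+1 (leqnn _); rewrite divff ?mulr1// pnatr_eq0.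
Qed.

Lemma primitive_unif_diff k (K : R -> R) M e : continuous k ->
  (forall y, is_derive y 1 K (k y)) -> 0 < e ->
  exists2 d : R, 0 < d & forall y v, `|y| <= M -> `|v| <= d ->
    `|K (y + v) - K y - k y * v| <= e * `|v|.
Proof.
move=> ck dK e0; have [d d0 H] := unif_cont_on_segment M ck e0.
have cK : continuous K.
  move=> y; apply/differentiable_continuous; apply/derivable1_diffP.
  by have [] := dK y.
exists d => // y v yM vd.
have [c cyv ->] : exists2 c, `|y - c| <= `|v| & K (y + v) - K y = k c * v.
  have [v0|v0] := leP 0 v.
    have yv : y <= y + v by rewrite lerDl.
    have [|c] := @MVT_segment R K k y (y + v) yv (fun y _ => dK y).
      exact: continuous_subspaceT.
    rewrite in_itv/= => /andP[c1 c2] ->; exists c; last by congr (_ * _); ring.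
    by rewrite ler0_norm ?subr_le0// ger0_norm//; lra.
  have yv : y + v <= y by rewrite gerDl ltW.
  have [|c] := @MVT_segment R K k (y + v) y yv (fun y _ => dK y).
    exact: continuous_subspaceT.
  rewrite in_itv/= => /andP[c1 c2] E; exists c; last by rewrite -opprB E; ring.
  by rewrite ger0_norm ?subr_ge0// ltr0_norm//; lra.
rewrite -mulrBl normrM ler_wpM2r// distrC.
by apply: H => //; exact: le_trans cyv vd.
Qed.

End RealFunctions.

Section Nonlinearity.
Context {R : realType} {V : Type} (f : V -> R -> R) (alpha : R).
Hypothesis A1 : forall x : V, {within `[0, +oo[, continuous (f x)} /\ f x 0 = 0.
Hypothesis alpha_gt0 : 0 < alpha.
Hypothesis A3 : forall (x : V) (y : R), 0 < y -> 0 < alpha * primitive f x y <= y * f x y.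
Implicit Types (x : V) (y : R).

(** The truncation of the nonlinearity, which rules out negative minima of the
    solutions. *)
Definition fpos x y := f x (Num.max y 0).
Definition Fpos x y := primitive f x (Num.max y 0).

Lemma fpos_neg x y : y <= 0 -> fpos x y = 0.
Proof. by move=> y0; rewrite /fpos (max_idPr y0); case: (A1 x). Qed.

Lemma fposE x y : 0 <= y -> fpos x y = f x y.
Proof. by move=> y0; rewrite /fpos (max_idPl y0). Qed.

Lemma Fpos_neg x y : y <= 0 -> Fpos x y = 0.
Proof.
move=> y0; rewrite /Fpos (max_idPr y0) /primitive set_itv1 /Rintegral integral_set1.
by [].
Qed.

Lemma Fpos_gt0 x y : 0 < y -> 0 < Fpos x y.
Proof.
move=> y0; rewrite /Fpos (max_idPl (ltW y0)).
by have /andP[] := A3 x y0; rewrite pmulr_rgt0.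
Qed.

Lemma Fpos_ge0 x y : 0 <= Fpos x y.
Proof.
have [y0|y0] := leP y 0; first by rewrite Fpos_neg.
by apply: ltW; exact: Fpos_gt0.
Qed.

Lemma fpos_AR x y : alpha * Fpos x y <= y * fpos x y.
Proof.
have [y0|y0] := leP y 0; first by rewrite Fpos_neg// fpos_neg// !mulr0.
rewrite fposE ?(ltW y0)// /Fpos (max_idPl (ltW y0)).
by have /andP[] := A3 x y0.
Qed.

Lemma fpos_ge0 x y : 0 <= fpos x y.
Proof.
have [y0|y0] := leP y 0; first by rewrite fpos_neg.
have /lt_le_trans := mulr_gt0 alpha_gt0 (Fpos_gt0 x y0).
by move=> /(_ _ (fpos_AR x y)); rewrite pmulr_rgt0// => /ltW.
Qed.

Lemma continuous_fpos x : continuous (fpos x).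
Proof.
have [+ f0] := A1 x; move=> /continuous_within_itvcyP[cf f0r].
suff C (y : R) : fpos x z @[z --> y] --> fpos x y by exact: C.
have [yn|yp|y0] := ltgtP y 0.
- rewrite (fpos_neg x (ltW yn)); apply: cvg_near_cst; near=> z; apply: fpos_neg.
  by near: z; apply: lt_le_nbhsl.
- have cfy : {for y, continuous (f x)} by apply: cf; rewrite in_itv/= yp.
  rewrite (fposE x (ltW yp)).
  apply: cvg_trans cfy; apply: near_eq_cvg; near=> z.
  by rewrite fposE//; near: z; apply: filterS (lt_nbhsr yp) => w; exact: ltW.
- rewrite y0; apply/left_right_continuousP; split; last first.
    rewrite fposE//; apply: cvg_trans f0r; apply: near_eq_cvg; near=> z.
    by rewrite fposE//; near: z; exact: nbhs_right_ge.
  rewrite fpos_neg//; apply: cvg_near_cst; near=> z; apply: fpos_neg.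
  by near: z; exact: nbhs_left_le.
Unshelve. all: by end_near. Qed.

(** Starting the integral at a negative point makes the primitive a primitive on
    a neighbourhood of 0 as well. *)
Lemma Fpos_integral x (a : R) y : a <= 0 ->
  Fpos x y = \int[lebesgue_measure]_(t in `[a, y]) fpos x t.
Proof.
move=> a0; rewrite /Fpos /primitive /Rintegral; congr fine.
rewrite [LHS]integral_mkcond [RHS]integral_mkcond; congr integral.
apply/funext => t; rewrite !patchE !mem_setE !in_itv/=.
have [t0|t0] := ltP t 0.
  by rewrite fpos_neg ?(ltW t0)//; case: ifP.
rewrite (le_trans a0 t0)/= le_max (fposE x t0).
have [ty|yt] := leP t y => //=.
case: ifP => // t0'; have -> : t = 0 by apply: le_anti; rewrite t0' t0.
by case: (A1 x) => _ ->.
Qed.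

Lemma is_derive_Fpos x y : is_derive y 1 (Fpos x) (fpos x y).
Proof.
pose a := Num.min y 0 - 1.
have a0 : a <= 0 by have : Num.min y 0 <= 0; [rewrite ge_min lexx orbT|rewrite /a; lra].
have ay : a < y by have : Num.min y 0 <= y; [rewrite ge_min lexx|rewrite /a; lra].
have yy : y < y + 1 by rewrite ltrDl.
have intf : (@lebesgue_measure R).-integrable `[a, y + 1] (EFin \o fpos x).
  apply: continuous_compact_integrable; first exact: segment_compact.
  by apply: continuous_subspaceT; exact: continuous_fpos.
have [dF] := continuous_FTC1_closed yy intf ay (@continuous_fpos x y).
rewrite derive1E => FE.
have -> : Fpos x = (fun y => \int[lebesgue_measure]_(t in `[a, y]) fpos x t).
  by apply/funext => z; exact: Fpos_integral.
by split.
Qed.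

(** By the superlinearity condition the derivative of [Fpos x y * y^(-alpha)] is
    nonnegative for [y > 0]. *)
Lemma Fpos_growth x : exists2 c : R, 0 < c & forall y, 1 <= y -> c * y `^ alpha <= Fpos x y.
Proof.
exists (Fpos x 1); first exact: Fpos_gt0.
move=> y y1; have y0 : 0 < y by lra.
pose H (z : R) := Fpos x z * z `^ (- alpha).
pose dH (z : R) := fpos x z * z `^ (- alpha) + Fpos x z * (- alpha * z `^ (- alpha - 1)).
have dHP (z : R) : 0 < z -> is_derive z 1 H (dH z).
  move=> z0.
  have := is_deriveM (is_derive_Fpos x z) (@is_derive1_powR R (- alpha) z z0).
  rewrite /GRing.scale/= => D; apply: is_derive_eq D _.
  by rewrite /dH; ring.
have dH0 (z : R) : 0 < z -> 0 <= dH z.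
  move=> z0; rewrite /dH.
  have -> : z `^ (- alpha) = z * z `^ (- alpha - 1).
    rewrite -{2}(powRr1 (ltW z0)) -powRD; last by rewrite (gt_eqF z0) implybT.
    by congr (_ `^ _); ring.
  have -> : fpos x z * (z * z `^ (- alpha - 1)) + Fpos x z * (- alpha * z `^ (- alpha - 1)) =
     (z * fpos x z - alpha * Fpos x z) * z `^ (- alpha - 1) by ring.
  by rewrite mulr_ge0 ?powR_ge0// subr_ge0 fpos_AR.
have dHi (z : R) : z \in `]1, y[%R -> is_derive z 1 H (dH z).
  by rewrite in_itv/= => /andP[z1 _]; apply: dHP; lra.
have [|c] := @MVT_segment R H dH 1 y y1 dHi.
  apply: continuous_in_subspaceT => z; rewrite inE/= in_itv/= => /andP[z1 _].
  apply/differentiable_continuous; apply/derivable1_diffP.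
  have z0 : 0 < z by lra.
  by have [] := dHP z z0.
rewrite in_itv/= => /andP[c1 _] E.
have : H 1 <= H y.
  rewrite -subr_ge0 E mulr_ge0 ?subr_ge0//; apply: dH0; lra.
rewrite /H powR1 mulr1 powRN => h.
by rewrite -ler_pdivlMr ?powR_gt0.
Qed.

End Nonlinearity.

(** * The function space, the first eigenvalue and subcriticality *)

Lemma cvg_unif_seqP {R : realType} {V : countType} (u_ : nat -> V -> R) (u : V -> R) :
  {uniform, u_ @ \oo --> u} <-> forall e : R, 0 < e ->
    exists N : nat, forall n, (N <= n)%N -> forall x, `|u x - u_ n x| < e.
Proof.
split=> [cu e e0|H P /uniform_nbhs[E [entE EP]]].
  have [N _ HN] : \forall n \near \oo, forall x, `|u x - u_ n x| < e.
    apply: (cu [set g | forall x, `|u x - g x| < e]); apply/uniform_nbhs.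
    exists [set xy | ball xy.1 e xy.2]; split.
      by rewrite -entourage_from_ballE; exists e.
    by move=> g /= Hg x; have := Hg x I; rewrite -ball_normE.
  by exists N => n Nn x; exact: HN.
move: entE; rewrite -entourage_from_ballE => -[e /= e0 He].
have [N HN] := H e e0; exists N => // n /= Nn; apply: EP => x _ /=; apply: He => /=.
by rewrite -ball_normE /=; exact: HN.
Qed.

Section SpaceHsp.
Context {R : realType} {V : countType} (G : weighted_graph R V).
Hypothesis Glf : locally_finite G.
Hypothesis Gsc : stochastically_complete G.
Variables (s p : R) (h : V -> R).
Hypothesis s01 : 0 < s < 1.
Hypothesis p2 : 2 <= p.
Hypothesis h_gt0 : forall x, 0 < h x.
Variable m1 : R.
Hypothesis m1_gt0 : 0 < m1.
Hypothesis m1P : forall x, m1 <= vmeas G x.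
Local Notation mu := (vmeas G).
Local Notation dens := (Hsp_density G s p h).
Local Notation fin_energy := (fin_energy G s p h).
Local Notation energy := (energy G s p h).
Implicit Types (x y z : V) (u v w : V -> R) (a b c d e M : R) (r : seq V).

Let mu0 x : 0 < mu x := vmeas_gt0 G x.
Let p0 : 0 < p. Proof. exact: lt_le_trans p2. Qed.
Let dmu0 u x : 0 <= dens u x * mu x.
Proof. by rewrite mulr_ge0 ?(ltW (mu0 x))// dens_ge0. Qed.

Lemma Hsp_norm_ltP u e : 0 < e ->
  (Hsp_norm G s p h u < e%:E)%E <-> fin_energy u /\ energy u < e `^ p.
Proof.
move=> e0; have pV : p^-1 != 0 by rewrite invr_neq0// gt_eqF.
have fE : fin_energy u -> Hsp_norm G s p h u = (energy u `^ p^-1)%:E.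
  by move=> fu; rewrite /Hsp_norm -(rsum_ge0E (fun x _ => dmu0 u x) fu).
have powE a : 0 <= a -> (a < e `^ p) = (a `^ p^-1 < e).
  move=> a0; apply/idP/idP => H.
    have := @gt0_ltr_powR R p^-1 _ a (e `^ p); rewrite invr_gt0 p0 !nnegrE powR_ge0 a0.
    by move=> /(_ isT isT isT H); rewrite -powRrM divff ?gt_eqF// powRr1// ltW.
  have := @gt0_ltr_powR R p p0 (a `^ p^-1) e; rewrite !nnegrE powR_ge0 (ltW e0).
  by move=> /(_ isT isT H); rewrite -powRrM mulVf ?gt_eqF// powRr1.
split=> [H|[fu]].
  have fu : fin_energy u.
    have : (Hsp_norm G s p h u < +oo)%E by apply: lt_trans H _; exact: ltry.
    move=> /(lty_poweRy pV) lt; apply: le_lt_trans lt; apply: le_esum => x _ /=.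
    by rewrite lee_fin (ger0_norm (dmu0 u x)).
  split => //; rewrite powE; last exact: energy_ge0.
  by move: H; rewrite fE.
by rewrite fE// lte_fin powE//; exact: energy_ge0.
Qed.

Lemma finitely_supported_seq u : finitely_supported u ->
  exists2 r, uniq r & supp_in r u.
Proof.
move=> /finite_set_seq[r ur E]; exists r => // x xr.
apply/eqP/negPn/negP => ux; have : [set x | u x != 0] x by [].
by rewrite E /= (negbTE xr).
Qed.

Lemma supp_in_finitely_supported r u : supp_in r u -> finitely_supported u.
Proof.
move=> su; apply: (@sub_finite_set _ _ [set` r]); last exact: finite_seq.
by move=> x /=; apply: contraNT => xr; rewrite su.
Qed.

Lemma energy0 : energy (fun=> 0) = 0.
Proof.
have su : supp_in [::] (fun _ : V => 0 : R) by [].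
have fu := fin_energy_supp Glf Gsc s01 p2 h_gt0 m1_gt0 m1P (r := [::]) isT su.
have b0 : bnd_fun (fun _ : V => 0 : R) by exists 0 => x; rewrite normr0.
have [_ E] := fin_energyZ Glf Gsc s01 0 b0 fu.
have -> : (fun _ : V => 0 : R) = (fun x => 0 * (fun _ : V => 0 : R) x).
  by apply/funext => x; rewrite mulr0.
by rewrite E normr0 powR0 ?mul0r// gt_eqF.
Qed.

Lemma Hsp_supp r u : supp_in r u -> Hsp G s p h u.
Proof.
move=> su; exists (fun=> u); split.
- by move=> _; exact: supp_in_finitely_supported su.
- move=> e e0; near=> m n; apply/Hsp_norm_ltP => //.
  have -> : (fun x => u x - u x) = fun=> 0 by apply/funext => x; rewrite subrr.
  rewrite energy0 powR_gt0//; split => //.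
  by apply: (fin_energy_supp Glf Gsc s01 p2 h_gt0 m1_gt0 m1P (r := [::])).
- by apply/cvg_unif_seqP => e e0; exists 0%N => n _ x; rewrite subrr normr0.
Unshelve. all: by end_near. Qed.

(** Finitely supported functions compete in the infimum. *)
Lemma lambda_p_le r u : uniq r -> supp_in r u ->
  lambda_p G s p h * \sum_(x <- r) `|u x| `^ p * mu x <= energy u.
Proof.
move=> ur su.
have t0 x : 0 <= `|u x| `^ p * mu x by rewrite mulr_ge0 ?powR_ge0// ltW.
have tr x : setT x -> x \notin r -> `|u x| `^ p * mu x = 0.
  by move=> _ xr; rewrite su// normr0 powR0 ?mul0r// gt_eqF.
have [_ sE] := rsum_seq ur (fun _ _ => I) tr.
have S0 : 0 <= \sum_(x <- r) `|u x| `^ p * mu x by apply: sumr_ge0.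
have [->|Sn] := eqVneq (\sum_(x <- r) `|u x| `^ p * mu x) 0.
  by rewrite mulr0; exact: energy_ge0.
rewrite -ler_pdivlMr; last by rewrite lt_def Sn.
apply: ge_inf.
  exists 0 => _ [v _ <-]; apply: divr_ge0; first exact: energy_ge0.
  by apply: rsum_ge0 => x _; rewrite mulr_ge0 ?powR_ge0// ltW.
exists u; last by rewrite /intV sE.
split; first exact: Hsp_supp su.
apply: contrapT => H; move: Sn; rewrite big1 ?eqxx// => x _.
have -> : u x = 0 by apply/eqP/negPn/negP => ux; apply: H; exists x.
by rewrite normr0 powR0 ?mul0r// gt_eqF.
Qed.

End SpaceHsp.

Section Subcritical.
Context {R : realType} {V : countType} (f : V -> R -> R) (p alpha lam : R).
Hypothesis p2 : 2 <= p.
Hypothesis palpha : p < alpha.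
Hypothesis A1 : forall x : V, {within `[0, +oo[, continuous (f x)} /\ f x 0 = 0.
Hypothesis A2 : forall M : R, 0 < M -> exists C_M : R,
        forall (x : V) (y : R), 0 <= y <= M -> f x y <= C_M.
Hypothesis A3 : forall (x : V) (y : R), 0 < y -> 0 < alpha * primitive f x y <= y * f x y.
Hypothesis A4 : (limf_esup
  (fun y : R => ereal_sup (range (fun x : V => (f x y / y `^ (p - 1))%:E))) 0^'+ < lam%:E)%E.
Variable x0 : V.
Implicit Types (x : V) (y : R).

Let p0 : 0 < p. Proof. exact: lt_le_trans p2. Qed.
Let alpha0 : 0 < alpha. Proof. exact: lt_trans palpha. Qed.

(** Some neighbourhood of 0 already has its supremum below [lam]; this supremum is
    nonnegative because [f] is. *)
Lemma subcritical_near0 : exists lam' d : R, [/\ 0 <= lam', lam' < lam, 0 < d &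
  forall x y, `|y| <= d -> fpos f x y <= lam' * `|y| `^ (p - 1)].
Proof.
have [_ [U [d /= d0 dU] <-] lt] := ereal_inf_lt A4.
have dU' y : 0 < y < d -> U y.
  move=> /andP[y0 yd]; apply: dU => //=; first by rewrite sub0r normrN gtr0_norm.
set S := ereal_sup _ in lt.
have le x y : 0 < y < d -> ((f x y / y `^ (p - 1))%:E <= S)%E.
  move=> yd; apply: (@le_trans _ _ (ereal_sup (range (fun x : V => (f x y / y `^ (p - 1))%:E)))).
    by apply: ereal_sup_ubound; exists x.
  by apply: ereal_sup_ubound; exists y => //; exact: dU'.
have d2 : 0 < d / 2 < d by apply/andP; split; lra.
have f0 x y : 0 < y -> 0 <= f x y.
  by move=> y0; rewrite -(fposE f x (ltW y0)); exact: (fpos_ge0 A1 alpha0 A3).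
have S0 : (0 <= S)%E.
  apply: le_trans (le x0 _ d2); rewrite lee_fin divr_ge0 ?powR_ge0//.
  by apply: f0; case/andP: d2.
have SE : S = (fine S)%:E.
  by rewrite fineK// ge0_fin_numE//; apply: lt_trans lt _; exact: ltry.
exists (fine S), (d / 2); split.
- by rewrite fine_ge0.
- by rewrite -lte_fin -SE.
- by case/andP: d2.
move=> x y yd; have [y0|y0] := leP y 0.
  by rewrite (fpos_neg A1)// mulr_ge0 ?powR_ge0// fine_ge0.
move: yd; rewrite (gtr0_norm y0) fposE ?(ltW y0)// => yd.
rewrite -ler_pdivrMr ?powR_gt0// -lee_fin -SE; apply: le.
by rewrite y0/=; lra.
Qed.

(** Subcriticality gives the bound near 0, boundedness of [f] away from 0. *)
Lemma fpos_bound M : exists2 C : R, 0 <= C &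
  forall x y, `|y| <= M -> fpos f x y <= C * `|y| `^ (p - 1).
Proof.
have [l [d [l0 _ d0 H]]] := subcritical_near0.
have [|CM HM] := A2 (M := Num.max M 1); first by rewrite lt_max ltr01 orbT.
have dp : 0 < d `^ (p - 1) by rewrite powR_gt0.
exists (Num.max l (CM / d `^ (p - 1))); first by rewrite le_max l0.
move=> x y yM; have [yd|yd] := leP `|y| d.
  apply: le_trans (H x y yd) _; apply: ler_wpM2r; first exact: powR_ge0.
  by rewrite le_max lexx.
have [y0|y0] := leP y 0.
  by rewrite (fpos_neg A1)// mulr_ge0 ?powR_ge0// le_max l0.
rewrite fposE ?(ltW y0)//; move: yM yd; rewrite (gtr0_norm y0) => yM yd.
have fC : f x y <= CM by apply: HM; rewrite (ltW y0) le_max yM.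
apply: (@le_trans _ _ (CM / d `^ (p - 1) * y `^ (p - 1))); last first.
  by apply: ler_wpM2r; rewrite ?powR_ge0// le_max lexx orbT.
apply: le_trans fC _; rewrite -mulrA ler_peMr//.
  by apply: le_trans (HM x 0 _); [case: (A1 x) => _ ->|rewrite lexx le_max ler01 orbT].
rewrite mulrC ler_pdivlMr// mul1r; apply: le_powR; [move: p2; lra|exact: ltW|exact: ltW].
Qed.

End Subcritical.

(** * Regularity of the restricted functionals *)

Lemma finite_uniform_small {R : realType} {V : eqType} (r : seq V) (P : V -> R -> Prop) :
  (forall x d d', P x d -> d' <= d -> P x d') ->
  (forall x, x \in r -> exists2 d : R, 0 < d & P x d) ->
  exists2 d : R, 0 < d & forall x, x \in r -> P x d.
Proof.
move=> mono; elim: r => [|x r IH] H; first by exists 1.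
have [d d0 Hd] : exists2 d : R, 0 < d & forall x, x \in r -> P x d.
  by apply: IH => y yr; apply: H; rewrite inE yr orbT.
have [d' d'0 Hd'] := H x (mem_head _ _).
exists (Num.min d d'); first by rewrite lt_min d0.
move=> y; rewrite inE => /predU1P[->|yr].
  by apply: mono Hd' _; rewrite ge_min lexx orbT.
by apply: mono (Hd y yr) _; rewrite ge_min lexx.
Qed.

Lemma finite_uniform_large {R : realType} {V : eqType} (r : seq V) (P : V -> R -> Prop) :
  (forall x d d', P x d -> d <= d' -> P x d') ->
  (forall x, x \in r -> exists d : R, P x d) ->
  exists d : R, forall x, x \in r -> P x d.
Proof.
move=> mono; elim: r => [|x r IH] H; first by exists 1.
have [d Hd] : exists d : R, forall x, x \in r -> P x d.
  by apply: IH => y yr; apply: H; rewrite inE yr orbT.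
have [d' Hd'] := H x (mem_head _ _).
exists (Num.max d d') => y; rewrite inE => /predU1P[->|yr].
  by apply: mono Hd' _; rewrite le_max lexx orbT.
by apply: mono (Hd y yr) _; rewrite le_max lexx.
Qed.

Section FiniteProblem.
Context {R : realType} {V : countType} (G : weighted_graph R V).
Hypothesis Glf : locally_finite G.
Hypothesis Gsc : stochastically_complete G.
Variables (s p : R) (h : V -> R).
Hypothesis s01 : 0 < s < 1.
Hypothesis p2 : 2 <= p.
Hypothesis h_gt0 : forall x, 0 < h x.
Variable m1 : R.
Hypothesis m1_gt0 : 0 < m1.
Hypothesis m1P : forall x, m1 <= vmeas G x.
Variable f : V -> R -> R.
Hypothesis A1 : forall x : V, {within `[0, +oo[, continuous (f x)} /\ f x 0 = 0.
Local Notation mu := (vmeas G).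
Local Notation nabla := (frac_grad_norm G s).
Local Notation B := (frac_grad_prod G s).
Local Notation fin_energy := (fin_energy G s p h).
Local Notation energy := (energy G s p h).
Local Notation energy_form := (energy_form G s p h).
Implicit Types (x y z : V) (u v w phi : V -> R) (a b c d e M : R) (r : seq V).

Let mu0 x : 0 < mu x := vmeas_gt0 G x.
Let p0 : 0 < p. Proof. exact: lt_le_trans p2. Qed.
Let fsupp r u (ur : uniq r) (su : supp_in r u) : fin_energy u :=
  fin_energy_supp Glf Gsc s01 p2 h_gt0 m1_gt0 m1P ur su.
Let fcont x : continuous (fpos f x). Proof. exact: continuous_fpos A1 x. Qed.

(** Only the vertices of [r] enter the nonlinear term, while the energy keeps the
    interaction of [r] with its complement. *)
Definition functional r u : R :=
  energy u / p - \sum_(x <- r) mu x * Fpos f x (u x).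

Definition functional_grad u z : R :=
  energy_form u (unit_at z) - mu z * fpos f z (u z).

Local Notation J := functional.
Local Notation g := functional_grad.

Lemma supp_in_unit_at r z : z \in r -> supp_in r (unit_at z : V -> R).
Proof.
by move=> zr x xr; rewrite /unit_at; case: eqVneq => // E; move: xr; rewrite E zr.
Qed.

Let unit_at_le z x : `|unit_at z x| <= (1 : R).
Proof. by rewrite /unit_at; case: eqP; rewrite ?normr1 ?normr0. Qed.

Let supp_bound r v x : supp_in r v -> `|v x| <= \sum_(z <- r) `|v z|.
Proof.
move=> sv; have [xr|xr] := boolP (x \in r); last by rewrite sv// normr0 sumr_ge0.
by rewrite (big_rem x xr)/= lerDl sumr_ge0.
Qed.

Lemma energy_form0l phi : bnd_fun phi -> energy_form (fun=> 0) phi = 0.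
Proof.
move=> bphi; have b0 : bnd_fun (fun _ : V => 0 : R) by exists 0 => x; rewrite normr0.
have n0 x : nabla (fun=> 0) x = 0.
  have -> : (fun _ : V => 0 : R) = (fun x => 0 * (fun _ : V => 0 : R) x).
    by apply/funext => y; rewrite mulr0.
  by rewrite (frac_grad_normZ Glf Gsc s01)// normr0 mul0r.
have B0 x : B (fun=> 0) phi x = 0.
  apply/eqP; rewrite -normr_le0.
  by apply: le_trans (frac_grad_CS Glf Gsc s01 x b0 bphi) _; rewrite n0 mul0r.
rewrite /energy_form (@eq_rsum _ _ _ _ (fun=> 0)); last first.
  by move=> x _; rewrite /dens_form B0 !mulr0 !mul0r addr0 mul0r.
have [_ ->] := @rsum_seq R V setT (fun=> 0) [::] isT (fun _ _ => I) (fun _ _ _ => erefl).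
by rewrite big_nil.
Qed.

Lemma energy_form_sum u r (c : V -> R) : bnd_fun u -> fin_energy u -> uniq r ->
  energy_form u (fun x => \sum_(z <- r) c z * unit_at z x) =
  \sum_(z <- r) c z * energy_form u (unit_at z).
Proof.
move=> bu fu; elim: r => [|z r IH] /=.
  move=> _; rewrite big_nil.
  have -> : (fun x => \sum_(z <- [::]) c z * unit_at z x) = (fun=> 0 : R).
    by apply/funext => x; rewrite big_nil.
  have b0 : bnd_fun (fun _ : V => 0 : R) by exists 0 => x; rewrite normr0.
  have f0 : fin_energy (fun=> 0) by apply: (@fsupp [::]).
  have -> : (fun _ : V => 0 : R) = (fun x => 0 * (fun _ : V => 0 : R) x).
    by apply/funext => y; rewrite mulr0.
  by rewrite (energy_formZ Glf Gsc s01 p2 h_gt0 0 bu b0 fu f0) mul0r.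
move=> /andP[zr ur].
rewrite big_cons -IH//.
have -> : (fun x => \sum_(y <- z :: r) c y * unit_at y x) =
    (fun x => c z * unit_at z x + \sum_(y <- r) c y * unit_at y x).
  by apply/funext => x; rewrite big_cons.
have fz : fin_energy (unit_at z) by exact: (fin_energy_unit_at Glf Gsc s01 p2 h_gt0 m1_gt0 m1P).
have bz := bnd_unit_at z : bnd_fun (unit_at z : V -> R).
have [fcz _] := fin_energyZ Glf Gsc s01 (c z) bz fz.
have fs : fin_energy (fun x => \sum_(z <- r) c z * unit_at z x).
  apply: (@fsupp r) => // x xr; rewrite big1_seq// => y /= yr.
  by rewrite /unit_at; case: eqVneq => [E|]; rewrite ?mulr0//; move: xr; rewrite E yr.
rewrite (energy_formD Glf Gsc s01 p2 h_gt0 bu (bnd_funZ (c z) bz) (bnd_sum_unit_at r c) fu fcz fs).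
by rewrite (energy_formZ Glf Gsc s01 p2 h_gt0 (c z) bu bz fu fz).
Qed.

Lemma functional_grad_sum r u v : uniq r -> supp_in r u -> supp_in r v ->
  \sum_(x <- r) g u x * v x =
  energy_form u v - \sum_(x <- r) mu x * fpos f x (u x) * v x.
Proof.
move=> ur su sv.
rewrite [in energy_form u v](supp_in_sum_unit_at ur sv).
rewrite energy_form_sum//; [|exact: supp_in_bnd su|exact: fsupp su].
by rewrite -sumrB; apply: eq_bigr => x _; rewrite /g mulrBl mulrC.
Qed.

Let Lip r := energy_form_lip_supp Glf Gsc s01 p2 h_gt0 m1_gt0 m1P (r := r).
Let M0 M : 0 <= Num.max M 0. Proof. by rewrite le_max lexx orbT. Qed.
Let leM M (t : R) : t <= M -> t <= Num.max M 0. Proof. by rewrite le_max => ->. Qed.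
Let zero_supp r : supp_in r (fun _ : V => 0 : R). Proof. by []. Qed.

Let ler_norm_energy_form r : uniq r -> exists2 S : R, 0 <= S &
  forall u phi M e, supp_in r u -> supp_in r phi -> 0 <= M -> 0 <= e ->
    (forall x, `|u x| <= M) -> (forall x, `|phi x| <= e) ->
    `|energy_form u phi| <= p * M `^ (p - 2) * M * e * S.
Proof.
move=> ur; have [S S0 HS] := Lip ur; exists S => // u phi M e su sphi M0' e0 uM phie.
have := HS u (fun=> 0) phi M M e su (zero_supp (r := r)) sphi M0' M0' e0 uM.
rewrite energy_form0l; last by exists e.
rewrite subr0; apply => // x; rewrite ?normr0//.
by rewrite subr0.
Qed.

Lemma energy_unif_cont r : uniq r -> unif_cont_on_bounded r energy.
Proof.
move=> ur M e e0; have [S S0 HS] := ler_norm_energy_form ur.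
set M' := Num.max M 0; have M'0 : 0 <= M' by exact: M0.
pose K := p * (p * M' `^ (p - 2) * M' * S).
have K0 : 0 <= K.
  by apply: mulr_ge0; [exact: ltW|do ! apply: mulr_ge0 => //; rewrite ?powR_ge0// ltW].
have dpos : 0 < e / (K + 1) by rewrite divr_gt0// ltr_wpDl.
exists (e / (K + 1)) => // u v su sv uM vM uv.
have suv : supp_in r (fun x => u x - v x) by move=> x xr; rewrite su// sv// subrr.
have suv' : supp_in r (fun x => v x - u x) by move=> x xr; rewrite su// sv// subrr.
have bu := supp_in_bnd su; have bv := supp_in_bnd sv.
have c1 := energy_convex Glf Gsc s01 p2 h_gt0 bu bv (fsupp ur su) (fsupp ur sv).
have c2 := energy_convex Glf Gsc s01 p2 h_gt0 bv bu (fsupp ur sv) (fsupp ur su).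
have vu x : `|v x - u x| <= e / (K + 1) by rewrite distrC.
have l1 := HS u _ M' _ su suv' M'0 (ltW dpos) (fun x => leM (uM x)) vu.
have l2 := HS v _ M' _ sv suv M'0 (ltW dpos) (fun x => leM (vM x)) uv.
have Ke : K * (e / (K + 1)) <= e.
  by rewrite mulrA ler_pdivrMr ?ltr_wpDl// mulrC ler_wpM2l ?(ltW e0)// lerDl.
have KE : p * (p * M' `^ (p - 2) * M' * (e / (K + 1)) * S) = K * (e / (K + 1)).
  by rewrite /K; ring.
have n1 := ler_norm (- energy_form u (fun x => v x - u x)).
have n2 := ler_norm (- energy_form v (fun x => u x - v x)).
rewrite !normrN in n1 n2.
have q1 := ler_wpM2l (ltW p0) (le_trans n1 l1).
have q2 := ler_wpM2l (ltW p0) (le_trans n2 l2).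
rewrite KE !mulrN in q1 q2.
move: c1 c2 q1 q2 Ke.
move: (energy u) (energy v) (p * energy_form u _) (p * energy_form v _) (K * _) => a b c c' k.
by move=> c1 c2 q1 q2 Ke; rewrite ler_norml; apply/andP; split; lra.
Qed.

Lemma functional_grad_unif_cont r x : uniq r -> x \in r ->
  unif_cont_on_bounded r (g ^~ x).
Proof.
move=> ur xr M e e0; have [S S0 HS] := Lip ur.
set M' := Num.max M 0; have M'0 : 0 <= M' by exact: M0.
pose K := p * M' `^ (p - 2) * S.
have K0 : 0 <= K by do ! apply: mulr_ge0 => //; rewrite ?powR_ge0// ltW.
have e2 : 0 < e / 2 by lra.
have em : 0 < e / 2 / mu x by rewrite divr_gt0.
have [d d0 Hd] := unif_cont_on_segment M (@fcont x) em.
pose d' := Num.min d (e / 2 / (K + 1)).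
have dpos : 0 < e / 2 / (K + 1) by rewrite divr_gt0// ltr_wpDl.
have d'0 : 0 < d' by rewrite lt_min d0.
exists d' => // u v su sv uM vM uv.
have sx := supp_in_unit_at xr.
have := HS u v (unit_at x) M' d' 1 su sv sx M'0 (ltW d'0) ler01
  (fun x => leM (uM x)) (fun x => leM (vM x)) uv (unit_at_le x).
rewrite mulr1 => l1.
have l2 : `|fpos f x (u x) - fpos f x (v x)| <= e / 2 / mu x.
  apply: Hd; first exact: uM.
  by apply: le_trans (uv x) _; rewrite ge_min lexx.
have Ke : K * d' <= e / 2.
  apply: (@le_trans _ _ (K * (e / 2 / (K + 1)))).
    by rewrite ler_wpM2l// ge_min lexx orbT.
  by rewrite mulrA ler_pdivrMr ?ltr_wpDl// mulrC ler_wpM2l ?(ltW e2)// lerDl.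
rewrite /g.
have -> : energy_form u (unit_at x) - mu x * fpos f x (u x) -
    (energy_form v (unit_at x) - mu x * fpos f x (v x)) =
  (energy_form u (unit_at x) - energy_form v (unit_at x)) -
  mu x * (fpos f x (u x) - fpos f x (v x)) by ring.
apply: le_trans (ler_normB _ _) _; rewrite normrM (gtr0_norm (mu0 x)).
have l3 : mu x * `|fpos f x (u x) - fpos f x (v x)| <= e / 2.
  by move: l2; rewrite ler_pdivlMr// mulrC.
have l4 : p * M' `^ (p - 2) * d' * S = K * d' by rewrite /K; ring.
rewrite l4 in l1; lra.
Qed.

Lemma functional_grad_bounded r M : uniq r -> exists K : R, forall u, supp_in r u ->
  (forall x, `|u x| <= M) -> forall x, x \in r -> `|g u x| <= K.
Proof.
move=> ur; have [S S0 HS] := ler_norm_energy_form ur.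
set M' := Num.max M 0; have M'0 : 0 <= M' by exact: M0.
have [|x xr|K HK] := @finite_uniform_large R V r
    (fun x K => forall u, supp_in r u -> (forall x, `|u x| <= M) -> `|g u x| <= K).
- by move=> x d d' H dd' u su uM; apply: le_trans (H u su uM) dd'.
- have [C C0 HC] := bounded_on_segment M (@fcont x).
  exists (p * M' `^ (p - 2) * M' * 1 * S + mu x * C) => u su uM.
  apply: le_trans (ler_normB _ _) _; apply: lerD.
    apply: HS => //; first exact: supp_in_unit_at.
    by move=> y; exact: leM.
  by rewrite normrM (gtr0_norm (mu0 x)) ler_wpM2l ?(ltW (mu0 x))// HC.
by exists K => u su uM x xr; exact: HK.
Qed.

(** Convexity at [u] and at [u + v] squeezes the remainder of the energy between 0
    and the increment of its derivative, which is locally Lipschitz. *)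
Lemma functional_unif_diff r : uniq r -> unif_diff_on_bounded r (J r) g.
Proof.
move=> ur M e e0; have [S S0 HS] := Lip ur.
set M' := Num.max M 0; have M'0 : 0 <= M' by exact: M0.
pose K := p * (M' + 1) `^ (p - 2) * S.
have K0 : 0 <= K by do ! apply: mulr_ge0 => //; rewrite ?powR_ge0// ltW.
have e2 : 0 < e / 2 by lra.
have [|x xr|d d0 Hd] := @finite_uniform_small R V r
    (fun x d => forall y v : R, `|y| <= M -> `|v| <= d ->
       mu x * `|Fpos f x (y + v) - Fpos f x y - fpos f x y * v| <= e / 2 * `|v|).
- by move=> x d d' H dd' y v yM vd; apply: H => //; exact: le_trans vd dd'.
- have em : 0 < e / 2 / mu x by rewrite divr_gt0.
  have [d d0 Hd] := primitive_unif_diff M (@fcont x) (is_derive_Fpos A1 x) em.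
  exists d => // y v yM vd; have := Hd y v yM vd.
  by rewrite [_ / mu x * _]mulrAC ler_pdivlMr// [_ * mu x]mulrC.
have dpos : 0 < e / 2 / (K + 1) by rewrite divr_gt0// ltr_wpDl.
pose d' := Num.min 1 (Num.min d (e / 2 / (K + 1))).
have d'0 : 0 < d' by rewrite !lt_min ltr01 d0.
exists d' => // u v su sv uM vd.
set N := \sum_(x <- r) `|v x|; have N0 : 0 <= N by exact: sumr_ge0.
have suv : supp_in r (fun x => u x + v x) by move=> x xr; rewrite su// sv// addr0.
have bu := supp_in_bnd su; have buv := supp_in_bnd suv.
have uM1 x : `|u x| <= M' + 1 by apply: le_trans (leM (uM x)) _; rewrite lerDl.
have uvM1 x : `|u x + v x| <= M' + 1.
  apply: le_trans (ler_normD _ _) _; apply: lerD (leM (uM x)) _.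
  by apply: le_trans (vd x) _; rewrite ge_min lexx.
have M10 : 0 <= M' + 1 by rewrite addr_ge0.
have E1 : (fun x => u x + v x - u x) = v by apply/funext => x; ring.
have E2 : (fun x => u x - (u x + v x)) = (fun x => -1 * v x) by apply/funext => x; ring.
have c1 := energy_convex Glf Gsc s01 p2 h_gt0 bu buv (fsupp ur su) (fsupp ur suv).
have c2 := energy_convex Glf Gsc s01 p2 h_gt0 buv bu (fsupp ur suv) (fsupp ur su).
rewrite E1 in c1.
rewrite E2 (energy_formZ Glf Gsc s01 p2 h_gt0 (-1) buv (supp_in_bnd sv) (fsupp ur suv) (fsupp ur sv)) in c2.
have vd' x : `|u x + v x - u x| <= d' by rewrite addrAC subrr add0r.
have l1 := HS _ u v (M' + 1) d' N suv su sv M10 (ltW d'0) N0 uvM1 uM1 vd'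
  (fun x => supp_bound x sv).
have Ke : K * d' <= e / 2.
  apply: (@le_trans _ _ (K * (e / 2 / (K + 1)))).
    by rewrite ler_wpM2l// !ge_min lexx !orbT.
  by rewrite mulrA ler_pdivrMr ?ltr_wpDl// mulrC ler_wpM2l ?(ltW e2)// lerDl.
have l2 : `|energy_form (fun x => u x + v x) v - energy_form u v| <= e / 2 * N.
  apply: le_trans l1 _.
  have -> : p * (M' + 1) `^ (p - 2) * d' * N * S = K * d' * N by rewrite /K; ring.
  exact: ler_wpM2r.
have {}l2 := le_trans (ler_norm _) l2.
have E : `|energy (fun x => u x + v x) / p - energy u / p - energy_form u v| <= e / 2 * N.
  move: c1 c2 l2; move: (energy (fun x => u x + v x)) (energy u) (energy_form u v)
    (energy_form (fun x => u x + v x) v) (e / 2 * N) => a b A A' k c1 c2 l2.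
  have -> : a / p - b / p - A = (a - b - p * A) / p by field; rewrite gt_eqF.
  rewrite ger0_norm; last by apply: divr_ge0; [lra|exact: ltW].
  rewrite ler_pdivrMr//; have := ler_wpM2l (ltW p0) l2; lra.
have F : `|\sum_(x <- r) mu x * (Fpos f x (u x + v x) - Fpos f x (u x) - fpos f x (u x) * v x)|
    <= e / 2 * N.
  apply: le_trans (ler_norm_sum _ _ _) _; rewrite mulr_sumr.
  rewrite [leLHS]big_seq [leRHS]big_seq; apply: ler_sum => x xr.
  rewrite normrM (gtr0_norm (mu0 x)); apply: Hd => //.
  by apply: le_trans (vd x) _; rewrite !ge_min lexx orbT.
have -> : J r (fun x => u x + v x) - J r u - \sum_(x <- r) g u x * v x =
  (energy (fun x => u x + v x) / p - energy u / p - energy_form u v) -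
  \sum_(x <- r) mu x * (Fpos f x (u x + v x) - Fpos f x (u x) - fpos f x (u x) * v x).
  rewrite functional_grad_sum// /functional.
  have -> : \sum_(x <- r) mu x * (Fpos f x (u x + v x) - Fpos f x (u x) - fpos f x (u x) * v x) =
     \sum_(x <- r) mu x * Fpos f x (u x + v x) - \sum_(x <- r) mu x * Fpos f x (u x)
     - \sum_(x <- r) mu x * fpos f x (u x) * v x.
    by rewrite -!sumrB; apply: eq_bigr => x _; ring.
  ring.
apply: le_trans (ler_normB _ _) _; apply: le_trans (lerD E F) _.
by rewrite -mulrDl -splitr.
Qed.

End FiniteProblem.

(** * Mountain pass geometry *)

Section MountainPass.
Context {R : realType} {V : countType} (G : weighted_graph R V).
Hypothesis Glf : locally_finite G.
Hypothesis Gsc : stochastically_complete G.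
Variables (s p : R) (h : V -> R).
Hypothesis s01 : 0 < s < 1.
Hypothesis p2 : 2 <= p.
Hypothesis h_gt0 : forall x, 0 < h x.
Variables m1 h1 : R.
Hypothesis m1_gt0 : 0 < m1.
Hypothesis h1_gt0 : 0 < h1.
Hypothesis m1P : forall x, m1 <= vmeas G x.
Hypothesis h1P : forall x, h1 <= h x.
Variables (f : V -> R -> R) (alpha : R).
Hypothesis palpha : p < alpha.
Hypothesis A1 : forall x : V, {within `[0, +oo[, continuous (f x)} /\ f x 0 = 0.
Hypothesis A3 : forall (x : V) (y : R), 0 < y -> 0 < alpha * primitive f x y <= y * f x y.
Local Notation mu := (vmeas G).
Local Notation fin_energy := (fin_energy G s p h).
Local Notation energy := (energy G s p h).
Local Notation J := (functional G s p h f).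
Local Notation g := (functional_grad G s p h f).
Implicit Types (x z : V) (u v w phi : V -> R) (a b c d e M : R) (r : seq V).

Let mu0 x : 0 < mu x := vmeas_gt0 G x.
Let p0 : 0 < p. Proof. exact: lt_le_trans p2. Qed.
Let p1 : 1 <= p. Proof. by apply: le_trans p2; rewrite ler1n. Qed.
Let alpha0 : 0 < alpha. Proof. exact: lt_trans palpha. Qed.
Let fsupp r u (ur : uniq r) (su : supp_in r u) : fin_energy u :=
  fin_energy_supp Glf Gsc s01 p2 h_gt0 m1_gt0 m1P ur su.
Let F_ge0 x (y : R) : 0 <= Fpos f x y. Proof. exact: Fpos_ge0 alpha0 A3 x y. Qed.
Let energy_pos u : 0 <= energy u. Proof. exact: energy_ge0. Qed.

(** The superlinearity condition bounds the primitive by [alpha^-1 * y * f], and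
    [alpha > p] gives the factor [p^-1]. *)
Lemma Fpos_le_power l d x (y : R) : 0 <= l ->
  (forall x y, `|y| <= d -> fpos f x y <= l * `|y| `^ (p - 1)) ->
  `|y| <= d -> Fpos f x y <= l / p * `|y| `^ p.
Proof.
move=> l0 H yd; have [y0|y0] := leP y 0.
  by rewrite Fpos_neg// mulr_ge0 ?powR_ge0// divr_ge0// ltW.
have yp := powR_pred p1 (ltW y0).
have := H x y yd; rewrite (gtr0_norm y0) => fl.
have AR := fpos_AR A1 A3 x y.
have k1 : alpha * Fpos f x y <= l * y `^ p.
  apply: le_trans AR _; rewrite -yp mulrCA; apply: ler_wpM2l fl; exact: ltW.
have k2 : p * Fpos f x y <= alpha * Fpos f x y by apply: ler_wpM2r => //; exact: ltW.
rewrite mulrAC ler_pdivlMr// mulrC; exact: le_trans k2 k1.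
Qed.

(** As [lam] times the mass is at most the energy, the nonlinear term is at most
    the fraction [l / lam] of the energy term. *)
Lemma functional_ge r u l lam d : uniq r -> supp_in r u ->
  0 <= l -> l < lam -> (forall x y, `|y| <= d -> fpos f x y <= l * `|y| `^ (p - 1)) ->
  lam * \sum_(x <- r) `|u x| `^ p * mu x <= energy u ->
  (forall x, `|u x| <= d) -> (1 - l / lam) / p * energy u <= J r u.
Proof.
move=> ur su l0 llam H lamu ud; have lam0 : 0 < lam by exact: le_lt_trans llam.
have k : \sum_(x <- r) mu x * Fpos f x (u x) <= l / p * \sum_(x <- r) `|u x| `^ p * mu x.
  rewrite mulr_sumr; apply: ler_sum => x _.
  rewrite mulrA [leRHS]mulrC; apply: ler_wpM2l; first exact: ltW.
  exact: Fpos_le_power l0 H (ud x).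
rewrite /functional; set S := \sum_(x <- r) `|u x| `^ p * mu x in lamu k *.
have k2 : l / p * S <= l / p * (energy u / lam).
  by apply: ler_wpM2l; [rewrite divr_ge0// ltW|rewrite ler_pdivlMr// mulrC].
have -> : (1 - l / lam) / p * energy u = energy u / p - l / p * (energy u / lam) by ring.
by apply: lerB => //; exact: le_trans k2.
Qed.

(** Along a ray the energy grows like [T^p], the primitive like [T^alpha]. *)
Lemma functional_ray x0 : exists T : R, 0 < T /\
  forall r, uniq r -> x0 \in r -> J r (fun x => T * unit_at x0 x) < 0.
Proof.
have [c c0 Hc] := Fpos_growth A1 alpha0 A3 x0.
set E := energy (unit_at x0); have E0 : 0 <= E by exact: energy_pos.
(* [T^(alpha - p) = K] exceeds the value at which the two terms balance *)
pose K := E / (p * (mu x0 * c)) + 1.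
have K1 : 1 <= K by rewrite lerDr; do ! apply: mulr_ge0 => //; rewrite invr_ge0; do ! apply: mulr_ge0; exact: ltW.
have K0 : 0 < K by apply: lt_le_trans K1.
have ap : 0 < alpha - p by rewrite subr_gt0.
pose T := K `^ (alpha - p)^-1.
have T1 : 1 <= T.
  rewrite /T -[X in X <= _](powRr0 K); apply: ler_powR => //.
  by rewrite invr_ge0 ltW.
have T0 : 0 < T by apply: lt_le_trans T1.
have TK : T `^ (alpha - p) = K by rewrite /T -powRrM mulVf ?gt_eqF// powRr1 ?ltW.
have Ta : T `^ alpha = T `^ p * K.
  by rewrite -TK -powRD; [congr (_ `^ _); ring|rewrite (gt_eqF T0) implybT].
exists T; split => // r ur xr; rewrite /functional.
have fz : fin_energy (unit_at x0) by exact: (fin_energy_unit_at Glf Gsc s01 p2 h_gt0 m1_gt0 m1P).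
have [_ ->] := fin_energyZ Glf Gsc s01 T (bnd_unit_at x0) fz.
rewrite (gtr0_norm T0) -/E (big_rem x0 xr)/= /unit_at eqxx mulr1 big1_seq; last first.
  move=> y /=; rewrite mem_rem_uniq// inE => /andP[/negbTE -> _].
  by rewrite mulr0 Fpos_neg// mulr0.
rewrite addr0 subr_lt0; apply: (@lt_le_trans _ _ (mu x0 * (c * T `^ alpha))); last first.
  by apply: ler_wpM2l; [exact: ltW|exact: Hc].
have Tp : 0 < T `^ p by rewrite powR_gt0.
rewrite Ta.
have -> : mu x0 * (c * (T `^ p * K)) = T `^ p * (mu x0 * c * K) by ring.
rewrite -mulrA ltr_pM2l//.
have -> : mu x0 * c * K = E / p + mu x0 * c.
  by rewrite /K; field; rewrite !gt_eqF// ?mulr_gt0.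
by rewrite ltrDl mulr_gt0.
Qed.

Lemma norm_le_energy u x : fin_energy u -> `|u x| <= 1 + energy u / (h1 * m1).
Proof.
move=> fu; have e1 := energy_sup h_gt0 m1_gt0 h1_gt0 m1P h1P x fu.
have hm : 0 < h1 * m1 by rewrite mulr_gt0.
have [u1|u1] := leP `|u x| 1.
  by apply: le_trans u1 _; rewrite lerDl divr_ge0// ltW.
have : `|u x| <= `|u x| `^ p.
  rewrite -{1}(powRr1 (normr_ge0 (u x))); apply: ler_powR => //; exact: ltW.
move=> k; apply: le_trans k _; rewrite -[leLHS]add0r lerD// ler_pdivlMr// mulrC.
exact: e1.
Qed.

(** Subtracting from the functional [alpha^-1] times its derivative in the
    direction [u] leaves a positive multiple of the energy and, by the
    superlinearity condition, a nonnegative remainder. *)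
Lemma functional_AR r u e : uniq r -> supp_in r u ->
  \sum_(x <- r) `|g u x| <= e ->
  (p^-1 - alpha^-1) * energy u <= J r u + alpha^-1 * (e * (1 + energy u / (h1 * m1))).
Proof.
move=> ur su ge; have fu := fsupp ur su.
set K := 1 + energy u / (h1 * m1).
have K0 : 0 <= K by apply: addr_ge0 => //; apply: divr_ge0 => //; apply: mulr_ge0; exact: ltW.
have gs : - \sum_(x <- r) g u x * u x <= e * K.
  apply: le_trans (ler_norm _) _; rewrite normrN; apply: le_trans (ler_norm_sum _ _ _) _.
  apply: (@le_trans _ _ (\sum_(x <- r) `|g u x| * K)).
    apply: ler_sum => x _; rewrite normrM; apply: ler_wpM2l => //.
    exact: norm_le_energy.
  by rewrite -mulr_suml; apply: ler_wpM2r.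
have := functional_grad_sum Glf Gsc s01 p2 h_gt0 m1_gt0 m1P f ur su su.
rewrite (energy_form_diag Glf h s01 p2) => gE.
have AR : \sum_(x <- r) mu x * Fpos f x (u x) <=
    alpha^-1 * \sum_(x <- r) mu x * fpos f x (u x) * u x.
  rewrite mulr_sumr; apply: ler_sum => x _.
  have := fpos_AR A1 A3 x (u x); rewrite -ler_pdivlMl// => /(ler_wpM2l (ltW (mu0 x))).
  by move=> k; apply: le_trans k _; rewrite le_eqVlt; apply/orP; left; apply/eqP; ring.
have k1 : alpha^-1 * - \sum_(x <- r) g u x * u x <= alpha^-1 * (e * K).
  by rewrite ler_wpM2l// invr_ge0 ltW.
rewrite gE opprB mulrBr in k1; rewrite /functional mulrBl.
move: k1 AR; rewrite -/K [p^-1 * _]mulrC.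
move: (alpha^-1 * energy u) (alpha^-1 * (e * K)) (alpha^-1 * \sum_(x <- r) mu x * fpos f x (u x) * u x)
  (\sum_(x <- r) mu x * Fpos f x (u x)) => a b c t; lra.
Qed.

(** The radius of the sphere, the level on it and the end of the crossing segment
    are independent of [r], hence so are the bounds [r1] and [C1]. *)
Lemma palais_smale_exists x0 lam l d : 0 <= l -> l < lam -> 0 < d ->
  (forall x y, `|y| <= d -> fpos f x y <= l * `|y| `^ (p - 1)) ->
  (forall r u, uniq r -> supp_in r u ->
    lam * \sum_(x <- r) `|u x| `^ p * mu x <= energy u) ->
  exists r1 C1 : R, 0 < r1 /\ forall r e, uniq r -> x0 \in r -> 0 < e ->
    exists u, [/\ supp_in r u, r1 <= energy u, energy u <= C1 &
      \sum_(x <- r) `|g u x| <= e].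
Proof.
move=> l0 llam d0 H lamP; have lam0 : 0 < lam by exact: le_lt_trans llam.
have [T [T0 HT]] := functional_ray x0.
have hm : 0 < h1 * m1 by rewrite mulr_gt0.
pose kap := (1 - l / lam) / p.
have kap0 : 0 < kap by rewrite divr_gt0// subr_gt0 ltr_pdivrMr// mul1r.
pose rr := h1 * m1 * d `^ p; have rr0 : 0 < rr by rewrite mulr_gt0// powR_gt0.
pose rho := kap * rr; have rho0 : 0 < rho by rewrite mulr_gt0.
pose z := (fun x => T * unit_at x0 x) : V -> R.
pose C0 := energy z / p.
have C00 : 0 <= C0 by rewrite divr_ge0// ltW.
pose th := p^-1 - alpha^-1.
have th0 : 0 < th by rewrite subr_gt0 ltf_pV2.
(* small enough for the error term to be absorbed by the energy *)
pose e0 := th / 2 * (alpha * (h1 * m1)).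
have e00 : 0 < e0 by rewrite mulr_gt0 ?divr_gt0// mulr_gt0.
exists (Num.min rr (p * rho)), (2 / th * (C0 + alpha^-1 * e0)); split.
  by rewrite lt_min rr0 mulr_gt0.
move=> r e ur xr e_gt0.
have sz : supp_in r z by move=> x xnr; rewrite /z (supp_in_unit_at xr xnr) mulr0.
have small u : supp_in r u -> energy u <= rr -> forall x, `|u x| <= d.
  move=> su E x; have e1 := energy_sup h_gt0 m1_gt0 h1_gt0 m1P h1P x (fsupp ur su).
  rewrite leNgt; apply/negP => dx.
  have := @gt0_ltr_powR R p p0 d `|u x|; rewrite !nnegrE (ltW d0) normr_ge0.
  move=> /(_ isT isT dx); rewrite -(ltr_pM2l hm) => k.
  by have := lt_le_trans k (le_trans e1 E); rewrite ltxx.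
have low u : supp_in r u -> energy u <= rr -> kap * energy u <= J r u.
  move=> su E; apply: (functional_ge (d := d)) => //; last exact: small.
  exact: lamP.
pose e1 := Num.min e e0; have e1_gt0 : 0 < e1 by rewrite lt_min e_gt0.
pose eps : R := (e1 / (size r).+1%:R) ^+ 2.
have n0 : 0 < (size r).+1%:R :> R by rewrite ltr0n.
have eps0 : 0 < eps by rewrite exprn_gt0// divr_gt0.
have s0 : supp_in r (fun _ : V => 0 : R) by [].
have E0 := energy0 Glf Gsc s01 p2 h_gt0 m1_gt0 m1P.
have J0 : J r (fun=> 0) = 0.
  rewrite /functional E0 mul0r big1 ?subr0// => x _.
  by rewrite Fpos_neg// mulr0.
have [u [su out /andP[Ju0 JuC] gu]] : exists u, [/\ supp_in r u,
    ~ (energy u < rr /\ J r u < rho), 0 <= J r u <= C0 &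
    \sum_(x <- r) g u x ^+ 2 <= eps].
  apply: (@mountain_pass_descent R V r (J r) energy g rr rho C0 z) => //.
  - by move=> x xr'; exact: (functional_grad_unif_cont Glf Gsc s01 p2 h_gt0 m1_gt0 m1P).
  - by move=> M; exact: (functional_grad_bounded Glf Gsc s01 p2 h_gt0 m1_gt0 m1P).
  - exact: (functional_unif_diff Glf Gsc s01 p2 h_gt0 m1_gt0 m1P).
  - exact: (energy_unif_cont Glf Gsc s01 p2 h_gt0 m1_gt0 m1P).
  - by rewrite E0.
  - by rewrite J0.
  - move=> u su E; apply: le_trans (low u su E); apply: mulr_ge0 => //; exact: ltW.
  - by move=> u su E; rewrite /rho -E; apply: low => //; rewrite E.
  - exact: HT.
  move=> t /andP[t0 t1]; rewrite /functional.
  have [_ ->] := fin_energyZ Glf Gsc s01 t (supp_in_bnd sz) (fsupp ur sz).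
  apply: (@le_trans _ _ (`|t| `^ p * energy z / p)).
    rewrite lerBlDr lerDl; apply: sumr_ge0 => x _; apply: mulr_ge0 => //; exact: ltW.
  rewrite ler_wpM2r ?invr_ge0 ?(ltW p0)//.
  rewrite ler_piMl// (ger0_norm t0); apply: (@le_trans _ _ (1 `^ p)).
    by apply: le_powR => //; exact: ltW.
  by rewrite powR1.
have ge : \sum_(x <- r) `|g u x| <= e1.
  have k x : x \in r -> `|g u x| <= e1 / (size r).+1%:R.
    move=> xr'; have : g u x ^+ 2 <= eps.
      apply: le_trans gu; rewrite (big_rem x xr')/= lerDl.
      by apply: sumr_ge0 => y _; exact: sqr_ge0.
    by rewrite /eps -(real_normK (num_real (g u x))) ler_sqr// nnegrE divr_ge0// ltW.
  apply: (@le_trans _ _ (\sum_(x <- r) e1 / (size r).+1%:R)).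
    by rewrite [leLHS]big_seq [leRHS]big_seq; apply: ler_sum.
  rewrite big_const_seq count_predT iter_addr_0 -(mulr_natr (e1 / _) (size r)) mulrAC ler_pdivrMr//.
  by rewrite ler_wpM2l ?(ltW e1_gt0)// ler_nat.
have E_ge0 := energy_pos u.
exists u; split => //.
- have [Er|Er] := ltP (energy u) rr; last by rewrite ge_min Er.
  have Jr : rho <= J r u by rewrite leNgt; apply/negP => Jr; apply: out.
  rewrite ge_min; apply/orP; right; rewrite mulrC -(ler_pdivlMr _ _ p0).
  apply: le_trans Jr _; rewrite /functional lerBlDr lerDl.
  by apply: sumr_ge0 => x _; apply: mulr_ge0 => //; exact: ltW.
- have AR := functional_AR ur su ge.
  have k : alpha^-1 * (e1 * (1 + energy u / (h1 * m1))) <=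
      alpha^-1 * e0 + th / 2 * energy u.
    have -> : alpha^-1 * e0 + th / 2 * energy u =
        alpha^-1 * (e0 * (1 + energy u / (h1 * m1))).
      by rewrite /e0; field; rewrite !gt_eqF.
    rewrite ler_wpM2l ?invr_ge0 ?(ltW alpha0)// ler_wpM2r//.
      by apply: addr_ge0 => //; apply: divr_ge0 => //; exact: ltW.
    by rewrite ge_min lexx orbT.
  have k2 : th / 2 * energy u <= C0 + alpha^-1 * e0.
    move: AR JuC k; rewrite -/th; move: (alpha^-1 * _) (alpha^-1 * _) (J r u) => a b c.
    by move=> q1 q2 q3; lra.
  have -> : 2 / th * (C0 + alpha^-1 * e0) = (C0 + alpha^-1 * e0) / (th / 2).
    by field; rewrite !gt_eqF.
  by rewrite ler_pdivlMr ?divr_gt0// mulrC.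
- by apply: le_trans ge _; rewrite ge_min lexx.
Qed.

End MountainPass.

(** * Compactness *)

(** All the sequences converge along one ultrafilter finer than the cofinite
    filter, and finitely many of its sets meet beyond any rank. *)
Lemma ultra_limit {R : realType} {I : eqType} (a : I -> nat -> R) :
  (forall i, exists M : R, forall n, `|a i n| <= M) ->
  exists l : I -> R, forall (r : seq I) (e : R) (N : nat), 0 < e ->
    exists2 k : nat, (N <= k)%N & forall i, i \in r -> `|a i k - l i| <= e.
Proof.
move=> aM; have [U [UU UF]] := @ultraFilterLemma nat \oo _.
have cl i : exists l : R, forall e : R, 0 < e -> U [set n | `|a i n - l| <= e].
  have [M HM] := aM i.
  have HU : U (a i @^-1` `[- M, M]%classic).
    by apply: filterE => n /=; rewrite in_itv/= -ler_norml.
  have [l [_ cl]] := @segment_compact R (- M) M (a i @ U) _ HU.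
  exists l => e e0; have [//|Uc] := in_ultra_setVsetC [set n | `|a i n - l| <= e] UU.
  have [y [yc yb]] := cl (~` [set y | `|y - l| <= e]) (ball l e) Uc (nbhsx_ballx l e e0).
  exfalso; apply: yc => /=; move: yb; rewrite -ball_normE /= distrC; exact: ltW.
have [l Hl] := choice cl; exists l => r e N e0.
have : U (fun n => (N <= n)%N /\ forall i, i \in r -> `|a i n - l i| <= e).
  elim: r => [|i r IH].
    by apply: UF; exists N.
  apply: filterS2 IH (Hl i e e0) => n [Nn H] Hi; split => // j.
  by rewrite inE => /predU1P[->|/H].
by move=> /filter_ex[k [Nk Hk]]; exists k.
Qed.

Lemma ler_sum_subset {R : numDomainType} {V : eqType} (r s : seq V) (F : V -> R) :
  uniq r -> uniq s -> {subset r <= s} -> (forall x, 0 <= F x) ->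
  \sum_(x <- r) F x <= \sum_(x <- s) F x.
Proof.
move=> ur us rs F0; rewrite [leRHS](bigID (mem r))/= -[leLHS]addr0 lerD ?sumr_ge0//.
rewrite -[leRHS]big_filter (perm_big [seq x <- s | x \in r])//.
apply: uniq_perm; rewrite ?filter_uniq// => x; rewrite mem_filter.
by case: (boolP (x \in r)) => // /rs ->.
Qed.

Section Sublevel.
Context {R : realType} {V : countType} (G : weighted_graph R V).
Hypothesis Gconn : connected_graph G.
Hypothesis Glf : locally_finite G.

Lemma finite_has_walk (x : V) n : finite_set [set y | has_walk G x y n].
Proof.
elim: n => [|n IH].
  apply: (@sub_finite_set _ _ [set x]); last exact: finite_set1.
  by move=> y [q [_ <-]] /eqP; rewrite size_eq0 => /eqP ->.
apply: (@sub_finite_set _ _ (\bigcup_(y in [set y | has_walk G x y n]) [set z | edge G y z])).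
  move=> z [q [+ + sq]]; case/lastP: q sq => [//|q w].
  rewrite size_rcons rcons_path last_rcons => -[sq] /andP[pq e] <-.
  by exists (last x q) => //; exists q.
by apply: bigcup_finite => // y _; exact: Glf.
Qed.

Lemma has_walk_sym (x y : V) n : has_walk G x y n -> has_walk G y x n.
Proof.
move=> [q [pq <- <-]]; exists (rev (belast x q)); split.
- rewrite -rev_path in pq; move: pq; rewrite (eq_path (e' := edge G))// => a b.
  by rewrite edge_sym.
- by case: q {pq} => //= a q; rewrite rev_cons last_rcons.
- by rewrite size_rev size_belast.
Qed.

(** The function [h] is large outside a ball, and balls are finite. *)
Lemma finite_sublevel (h : V -> R) (x0 : V) :
  (forall M : R, exists N : nat, forall x, (N <= gdist G x x0)%N -> M <= h x) ->
  forall L : R, finite_set [set x | h x < L].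
Proof.
move=> hinf L; have [N HN] := hinf L.
apply: (@sub_finite_set _ _ (\bigcup_(n in `I_N) [set y | has_walk G x0 y n])).
  move=> x /= hx; have gN : (gdist G x x0 < N)%N.
    by rewrite ltnNge; apply/negP => /HN; rewrite leNgt hx.
  exists (gdist G x x0) => //=; apply: has_walk_sym.
  rewrite /gdist; case: pselect => [e|[]]; first by case: ex_minnP => m /asboolP.
  have [q [pq lq]] := Gconn x x0; exists (size q); apply/asboolP; exists q; split => //.
by apply: bigcup_finite => [|n _]; [exact: finite_II|exact: finite_has_walk].
Qed.

End Sublevel.

Section LpCompactness.
Context {R : realType} {V : countType} (mu h : V -> R) (p C M : R).
Hypothesis mu0 : forall x, 0 < mu x.
Hypothesis h0 : forall x, 0 < h x.
Hypothesis p0 : 0 < p.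
Hypothesis hL : forall L : R, finite_set [set x | h x < L].
Variables (v : nat -> V -> R) (b : nat -> R) (K : R).
Hypothesis vM : forall n x, `|v n x| <= M.
Hypothesis bK : forall n, `|b n| <= K.
Hypothesis vC : forall n (r : seq V), uniq r ->
  \sum_(x <- r) h x * `|v n x| `^ p * mu x <= C.

(** Pointwise convergence suffices on the finite set where [h < L]; elsewhere the
    mass is at most [L^-1] times the mass weighted by [h], which is bounded. The
    auxiliary sequence [b] is made to converge along the same indices. *)
Lemma weighted_lp_compact : exists (u : V -> R) (l : R), (forall x, `|u x| <= M) /\
  forall (e : R) (N : nat), 0 < e -> exists k, [/\ (N <= k)%N, `|b k - l| <= e &
    forall r : seq V, uniq r -> \sum_(x <- r) `|v k x - u x| `^ p * mu x <= e].
Proof.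
(* the index [None] stands for the auxiliary sequence *)
pose a (i : option V) n := if i is Some x then v n x else b n.
have [|l Hl] := @ultra_limit R _ a.
  by move=> [x|]; [exists M => n; exact: vM|exists K => n; exact: bK].
pose u x := l (Some x); exists u, (l None); split.
  move=> x; apply/ler_addgt0Pr => e e0.
  have [k _ Hk] := Hl [:: Some x] e 0%N e0.
  have /= k1 := Hk (Some x) (mem_head _ _).
  have -> : u x = v k x - (v k x - u x) by ring.
  by apply: le_trans (ler_normB _ _) _; apply: lerD.
have wgt (r : seq V) (w : V -> R) (e : R) N : 0 < e -> (forall x, 0 <= w x) ->
    exists k, [/\ (N <= k)%N, `|b k - l None| <= e &
      \sum_(x <- r) w x * `|v k x - u x| `^ p <= e].
  move=> e0 w0; pose S := \sum_(x <- r) w x.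
  have S0 : 0 <= S by apply: sumr_ge0.
  have S1 : 0 < S + 1 by rewrite ltr_wpDl.
  pose d := (e / (S + 1)) `^ p^-1.
  have d0 : 0 < d by rewrite powR_gt0// divr_gt0.
  have dp : d `^ p = e / (S + 1).
    by rewrite /d -powRrM mulVf ?gt_eqF// powRr1// ltW// divr_gt0.
  have [|k Nk Hk] := Hl (None :: map Some r) (Num.min e d) N; first by rewrite lt_min e0.
  exists k; split => //.
    by have := Hk None (mem_head _ _); rewrite /= le_min => /andP[].
  apply: (@le_trans _ _ (\sum_(x <- r) w x * (e / (S + 1)))).
    rewrite [leLHS]big_seq [leRHS]big_seq; apply: ler_sum => x xr.
    apply: ler_wpM2l => //; rewrite -dp; apply: le_powR => //; first exact: ltW.
    have := Hk (Some x); rewrite inE /= map_f ?orbT// => /(_ isT).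
    by rewrite le_min => /andP[].
  rewrite -mulr_suml -/S mulrA ler_pdivrMr// mulrC ler_wpM2l ?(ltW e0)//.
  by rewrite lerDl.
have tp : 0 < 2 `^ p :> R by rewrite powR_gt0.
have C0 : 0 <= C by have := @vC 0%N [::] isT; rewrite big_nil.
pose C2 := 2 `^ p * (1 + C); have C20 : 0 <= C2 by rewrite mulr_ge0 ?(ltW tp)// addr_ge0.
have uC (r : seq V) : uniq r -> \sum_(x <- r) h x * `|u x| `^ p * mu x <= C2.
  move=> ur; have [|k [_ _ Hk]] := wgt r (fun x => h x * mu x) 1 0%N ltr01.
    by move=> x; rewrite mulr_ge0// ltW.
  apply: (@le_trans _ _ (\sum_(x <- r) (2 `^ p * (h x * mu x * `|v k x - u x| `^ p)
      + 2 `^ p * (h x * `|v k x| `^ p * mu x)))).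
    apply: ler_sum => x _.
    have -> : 2 `^ p * (h x * mu x * `|v k x - u x| `^ p) + 2 `^ p * (h x * `|v k x| `^ p * mu x)
      = h x * (2 `^ p * (`|v k x - u x| `^ p + `|v k x| `^ p)) * mu x by ring.
    apply: ler_wpM2r; first exact: ltW.
    apply: ler_wpM2l; first exact: ltW.
    apply: (le_trans _ (powR_add_le _ _ _)) => //; last exact: ltW.
    apply: le_powR => //; first exact: ltW.
    have {1}-> : u x = v k x - (v k x - u x) by ring.
    by apply: le_trans (ler_normB _ _) _; rewrite addrC.
  rewrite big_split/= -!mulr_sumr -mulrDr ler_wpM2l ?(ltW tp)//.
  by apply: lerD => //; exact: vC.
move=> e N e0.
(* the part of the mass outside the sublevel of height [L] is at most [e / 2] *)
pose L := 2 * (2 `^ p * (C + C2)) / e + 1.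
have L0 : 0 < L.
  by rewrite ltr_wpDl// divr_ge0 ?(ltW e0)// mulr_ge0// mulr_ge0 ?(ltW tp)// addr_ge0.
have [sL usL sLE] := finite_set_seq (hL L).
have e2 : 0 < e / 2 by lra.
have [k [Nk bk Hk]] := wgt sL mu (e / 2) N e2 (fun x => ltW (mu0 x)).
exists k; split => //; first by apply: le_trans bk _; lra.
move=> r ur; rewrite (bigID (mem sL))/= (splitr e); apply: lerD.
  apply: le_trans Hk; rewrite -big_filter.
  under [leRHS]eq_bigr do rewrite mulrC.
  apply: ler_sum_subset; rewrite ?filter_uniq//.
    by move=> x; rewrite mem_filter => /andP[].
  by move=> x; rewrite mulr_ge0 ?powR_ge0// ltW.
apply: (@le_trans _ _ (L^-1 * \sum_(x <- r) (2 `^ p * (h x * `|v k x| `^ p * mu x)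
     + 2 `^ p * (h x * `|u x| `^ p * mu x)))).
  rewrite mulr_sumr [leLHS]big_mkcond/=; apply: ler_sum => x _.
  have pos : 0 <= L^-1 * (2 `^ p * (h x * `|v k x| `^ p * mu x) + 2 `^ p * (h x * `|u x| `^ p * mu x)).
    apply: mulr_ge0; first by rewrite invr_ge0 ltW.
    have hm (c : R) : 0 <= h x * `|c| `^ p * mu x.
      by apply: mulr_ge0; [apply: mulr_ge0; [exact: ltW|exact: powR_ge0]|exact: ltW].
    by apply: addr_ge0; apply: mulr_ge0 => //; exact: ltW.
  case: ifPn => [xs|//].
  have hx : L <= h x.
    rewrite leNgt; apply/negP => hx; move/negP: xs; apply.
    by have : [set x | h x < L] x := hx; rewrite sLE.
  have -> : L^-1 * (2 `^ p * (h x * `|v k x| `^ p * mu x) + 2 `^ p * (h x * `|u x| `^ p * mu x))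
    = (h x / L) * (2 `^ p * (`|v k x| `^ p + `|u x| `^ p)) * mu x by ring.
  apply: ler_wpM2r; first exact: ltW.
  rewrite -[leLHS]mul1r; apply: ler_pM => //; rewrite ?powR_ge0//.
    by rewrite ler_pdivlMr// mul1r.
  apply: (le_trans _ (powR_add_le _ _ _)) => //; last exact: ltW.
  by apply: le_powR => //; [exact: ltW|exact: ler_normB].
rewrite mulrC ler_pdivrMr// big_split/= -!mulr_sumr -mulrDr.
apply: (@le_trans _ _ (2 `^ p * (C + C2))).
  by rewrite ler_wpM2l ?(ltW tp)// lerD ?uC ?vC.
have -> : e / 2 * L = 2 `^ p * (C + C2) + e / 2 by rewrite /L; field; rewrite gt_eqF.
by rewrite lerDl ltW.
Qed.

End LpCompactness.

(** * Approximation in the function space *)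

Section HspApproximation.
Context {R : realType} {V : countType} (G : weighted_graph R V).
Hypothesis Glf : locally_finite G.
Hypothesis Gsc : stochastically_complete G.
Variables (s p : R) (h : V -> R).
Hypothesis s01 : 0 < s < 1.
Hypothesis p2 : 2 <= p.
Hypothesis h_gt0 : forall x, 0 < h x.
Variable m1 : R.
Hypothesis m1_gt0 : 0 < m1.
Hypothesis m1P : forall x, m1 <= vmeas G x.
Local Notation fin_energy := (fin_energy G s p h).
Local Notation energy := (energy G s p h).
Implicit Types (u phi psi : V -> R) (e : R) (r : seq V).

Let p0 : 0 < p. Proof. exact: lt_le_trans p2. Qed.

Lemma Hsp_bnd phi : Hsp G s p h phi -> bnd_fun phi.
Proof.
move=> [u_ [us _ /cvg_unif_seqP/(_ _ ltr01)[N HN]]].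
have [r ur sr] := finitely_supported_seq (us N).
have [M HM] := supp_in_bnd sr; exists (1 + M) => x.
have -> : phi x = (phi x - u_ N x) + u_ N x by ring.
by apply: le_trans (ler_normD _ _) _; apply: lerD => //; apply: ltW; exact: HN.
Qed.

(** By lower semicontinuity of the energy the Cauchy condition passes to the limit
    in one of its two indices. *)
Lemma Hsp_approx phi e : Hsp G s p h phi -> 0 < e -> exists r psi,
  [/\ uniq r, supp_in r psi, fin_energy (fun x => phi x - psi x) &
      energy (fun x => phi x - psi x) <= e].
Proof.
move=> Hphi e0; have bphi := Hsp_bnd Hphi; move: Hphi => [u_ [us uc /cvg_unif_seqP uu]].
have d0 : 0 < e `^ p^-1 by rewrite powR_gt0.
have dp : (e `^ p^-1) `^ p = e by rewrite -powRrM mulVf ?gt_eqF// powRr1// ltW.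
have [[A B] /= [[N1 _ HA] [N2 _ HB]] AB] := uc _ d0.
pose N := maxn N1 N2.
have E m : (N <= m)%N -> fin_energy (fun x => u_ m x - u_ N x) /\
    energy (fun x => u_ m x - u_ N x) <= e.
  move=> Nm; have ABm : (A `*` B) (m, N).
    by split; [apply: HA|apply: HB] => /=; rewrite ?leq_maxr// (leq_trans (leq_maxl _ _) Nm).
  have /(Hsp_norm_ltP G s p2 h_gt0 _ d0) [fm] := AB _ ABm.
  by rewrite dp => em; split => //; exact: ltW.
have bu m : bnd_fun (u_ m).
  by have [r _ sr] := finitely_supported_seq (us m); exact: supp_in_bnd sr.
have [r ur sr] := finitely_supported_seq (us N); exists r, (u_ N).
have [|||f1 f2] := energy_lsc Glf Gsc s01 p2 h_gt0 (w := fun m x => u_ m x - u_ N x)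
   (u := fun x => phi x - u_ N x) (c := e); last by split.
- exact: bnd_funB.
- by move=> n; exact: bnd_funB.
move=> d d_gt0; have [N' HN'] := uu d d_gt0; exists (maxn N N') => n.
rewrite geq_max => /andP[Nn N'n]; split; last exact: E.
move=> x; have -> : u_ n x - u_ N x - (phi x - u_ N x) = - (phi x - u_ n x) by ring.
by rewrite normrN; apply: ltW; exact: HN'.
Qed.

Lemma Hsp_fin_energy phi : Hsp G s p h phi -> fin_energy phi.
Proof.
move=> Hphi; have [r [psi [ur sr fd _]]] := Hsp_approx Hphi ltr01.
have fpsi := fin_energy_supp Glf Gsc s01 p2 h_gt0 m1_gt0 m1P ur sr.
have bpsi := supp_in_bnd sr; have bd := bnd_funB (Hsp_bnd Hphi) bpsi.
have -> : phi = (fun x => (phi x - psi x) + psi x) by apply/funext => x; ring.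
exact: (fin_energyD Glf Gsc s01 p2 h_gt0 bd bpsi fd fpsi).1.
Qed.

Lemma Hsp_of_limit (w : nat -> V -> R) u :
  (forall j, exists2 r, uniq r & supp_in r (w j)) ->
  (forall e, 0 < e -> exists N, forall i j, (N <= i)%N -> (N <= j)%N ->
     energy (fun x => w i x - w j x) <= e) ->
  (forall e, 0 < e -> exists N, forall i, (N <= i)%N -> forall x, `|w i x - u x| <= e) ->
  Hsp G s p h u.
Proof.
move=> ws wc wu; exists w; split.
- by move=> j; have [r _ sr] := ws j; exact: supp_in_finitely_supported sr.
- move=> e e0; have ep : 0 < e `^ p / 2 by rewrite divr_gt0// powR_gt0.
  have [N HN] := wc _ ep.
  exists ([set n | (N <= n)%N], [set n | (N <= n)%N]); first by split; exists N.
  move=> [m n] /= [Nm Nn]; apply/Hsp_norm_ltP => //; split.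
    have [r ur sr] := ws m; have [r' ur' sr'] := ws n.
    have fE q f := fin_energy_supp Glf Gsc s01 p2 h_gt0 m1_gt0 m1P (r := q) (u := f).
    exact: (fin_energyB Glf Gsc s01 p2 h_gt0 (supp_in_bnd sr) (supp_in_bnd sr')
      (fE _ _ ur sr) (fE _ _ ur' sr')).1.
  apply: (@le_lt_trans _ _ (e `^ p / 2)); last by rewrite ltr_pdivrMr// ltr_pMr ?powR_gt0// ltr1n.
  exact: HN.
- apply/cvg_unif_seqP => e e0; have e2 : 0 < e / 2 by lra.
  have [N HN] := wu _ e2; exists N => n Nn x; rewrite distrC.
  apply: le_lt_trans (HN n Nn x) _; lra.
Qed.

End HspApproximation.

(** * Limits of almost critical points *)

Section StrongLimit.
Context {R : realType} {V : countType} (G : weighted_graph R V).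
Hypothesis Glf : locally_finite G.
Hypothesis Gsc : stochastically_complete G.
Variables (s p : R) (h : V -> R).
Hypothesis s01 : 0 < s < 1.
Hypothesis p2 : 2 <= p.
Hypothesis h_gt0 : forall x, 0 < h x.
Variables m1 h1 : R.
Hypothesis m1_gt0 : 0 < m1.
Hypothesis h1_gt0 : 0 < h1.
Hypothesis m1P : forall x, m1 <= vmeas G x.
Hypothesis h1P : forall x, h1 <= h x.
Hypothesis hL : forall L : R, finite_set [set x | h x < L].
Variable k : V -> R -> R.
Hypothesis k_ge0 : forall x (y : R), 0 <= k x y.
Hypothesis k_bound : forall M : R, exists2 C : R, 0 <= C &
  forall x (y : R), `|y| <= M -> k x y <= C * `|y| `^ (p - 1).
Hypothesis k_cont : forall x, continuous (k x).
Local Notation mu := (vmeas G).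
Local Notation fin_energy := (fin_energy G s p h).
Local Notation energy := (energy G s p h).
Local Notation energy_form := (energy_form G s p h).
Implicit Types (x z : V) (u w phi : V -> R) (a b c d e M : R) (r : seq V).

Let mu0 x : 0 < mu x := vmeas_gt0 G x.
Let p0 : 0 < p. Proof. exact: lt_le_trans p2. Qed.
Let p1 : 1 <= p. Proof. by apply: le_trans p2; rewrite ler1n. Qed.
Let fsupp r u (ur : uniq r) (su : supp_in r u) : fin_energy u :=
  fin_energy_supp Glf Gsc s01 p2 h_gt0 m1_gt0 m1P ur su.
Let energy_pos u : 0 <= energy u. Proof. exact: energy_ge0. Qed.

Lemma mass_le_energy r u : uniq r -> fin_energy u ->
  \sum_(x <- r) `|u x| `^ p * mu x <= energy u / h1.
Proof.
move=> ur fu; have [sm le] := fin_energy_mass h_gt0 fu.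
rewrite ler_pdivlMr// mulrC mulr_sumr; apply: le_trans le.
have k0 x : setT x -> 0 <= h x * `|u x| `^ p * mu x.
  by move=> _; apply: mulr_ge0; [apply: mulr_ge0; [exact: ltW|exact: powR_ge0]|exact: ltW].
apply: le_trans (sum_le_rsum k0 sm ur (fun _ _ => I)).
apply: ler_sum => x _; rewrite -mulrA; apply: ler_wpM2r => //.
by apply: mulr_ge0; [exact: powR_ge0|exact: ltW].
Qed.

Lemma nonlinear_sum_le r u phi C e : 0 <= C -> 0 < e ->
  (forall x, k x (u x) <= C * `|u x| `^ (p - 1)) ->
  \sum_(x <- r) mu x * k x (u x) * `|phi x| <=
  C * (e * \sum_(x <- r) `|u x| `^ p * mu x
       + e^-1 `^ (p - 1) * \sum_(x <- r) `|phi x| `^ p * mu x).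
Proof.
move=> C0 e0 H; rewrite !mulr_sumr -big_split/= mulr_sumr; apply: ler_sum => x _.
have y := powR_young p1 e0 (normr_ge0 (u x)) (normr_ge0 (phi x)).
apply: (@le_trans _ _ (mu x * (C * `|u x| `^ (p - 1)) * `|phi x|)).
  by apply: ler_wpM2r => //; apply: ler_wpM2l; [exact: ltW|exact: H].
have -> : mu x * (C * `|u x| `^ (p - 1)) * `|phi x| =
  mu x * C * (`|u x| `^ (p - 1) * `|phi x|) by ring.
have -> : C * (e * (`|u x| `^ p * mu x) + e^-1 `^ (p - 1) * (`|phi x| `^ p * mu x)) =
  mu x * C * (e * `|u x| `^ p + e^-1 `^ (p - 1) * `|phi x| `^ p) by ring.
by apply: ler_wpM2l y; apply: mulr_ge0 => //; exact: ltW.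
Qed.

Variables (rn : nat -> seq V) (v : nat -> V -> R) (C1 : R).
Hypothesis rn_uniq : forall n, uniq (rn n).
Hypothesis rn_mono : forall n m, (n <= m)%N -> {subset rn n <= rn m}.
Hypothesis v_supp : forall n, supp_in (rn n) (v n).
Hypothesis v_energy : forall n, energy (v n) <= C1.
Hypothesis v_crit : forall n,
  \sum_(x <- rn n) `|energy_form (v n) (unit_at x) - mu x * k x (v n x)| <= n.+1%:R^-1.

Let M := 1 + C1 / (h1 * m1).
Let hm : 0 < h1 * m1. Proof. exact: mulr_gt0. Qed.
Let vM n x : `|v n x| <= M.
Proof.
apply: le_trans (norm_le_energy p2 h_gt0 m1_gt0 h1_gt0 m1P h1P x (fsupp (rn_uniq n) (@v_supp n))) _.
by rewrite lerD2l ler_pM2r ?invr_gt0.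
Qed.
Let M_ge0 : 0 <= M.
Proof.
apply: addr_ge0 => //; apply: divr_ge0; last exact: ltW.
by apply: le_trans (v_energy 0); exact: energy_pos.
Qed.
Let C1_ge0 : 0 <= C1. Proof. by apply: le_trans (v_energy 0); exact: energy_pos. Qed.

Lemma near_critical n phi e : supp_in (rn n) phi -> 0 <= e -> (forall x, `|phi x| <= e) ->
  `|energy_form (v n) phi - \sum_(x <- rn n) mu x * k x (v n x) * phi x| <= e / n.+1%:R.
Proof.
move=> sphi e0 phie; have ur := rn_uniq n; have sv := @v_supp n.
rewrite {1}(supp_in_sum_unit_at ur sphi).
rewrite (energy_form_sum Glf Gsc s01 p2 h_gt0 m1_gt0 m1P phi (supp_in_bnd sv) (fsupp ur sv) ur).
rewrite -sumrB; apply: le_trans (ler_norm_sum _ _ _) _.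
apply: (@le_trans _ _ (\sum_(x <- rn n) e * `|energy_form (v n) (unit_at x) - mu x * k x (v n x)|)).
  apply: ler_sum => x _.
  have -> : phi x * energy_form (v n) (unit_at x) - mu x * k x (v n x) * phi x =
    phi x * (energy_form (v n) (unit_at x) - mu x * k x (v n x)) by ring.
  by rewrite normrM; apply: ler_wpM2r.
by rewrite -mulr_sumr; apply: ler_wpM2l.
Qed.

(** Clarkson's inequality bounds the energy of the half difference by the gap
    between the mean of the energies and the energy of the midpoint. The tangent
    at [v m] bounds the latter from below, up to the derivative at [v m] in the
    direction [v n - v m]. As [n <= m] this direction is supported in [rn m],
    where [v m] is almost critical, so that the derivative is close to the
    nonlinear term, which is controlled by the [l^p] distance [S]. *)
Lemma energy_dist_almost_critical n m C e (S : R) : (n <= m)%N -> 0 <= C -> 0 < e ->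
  (forall x (y : R), `|y| <= M -> k x y <= C * `|y| `^ (p - 1)) ->
  (forall r, uniq r -> \sum_(x <- r) `|v n x - v m x| `^ p * mu x <= S) ->
  energy (fun x => v n x - v m x) <= 2 `^ p * ((energy (v n) - energy (v m)) / 2 +
    p / 2 * (C * (e * (C1 / h1) + e^-1 `^ (p - 1) * S) + 2 * M / m.+1%:R)).
Proof.
move=> nm C0 e0 HC HS; set a := v n; set b := v m; set r := rn m.
have ur : uniq r by exact: rn_uniq.
have sb : supp_in r b by exact: v_supp.
have sa : supp_in r a.
  by move=> x xr; apply: v_supp; apply: contra xr; exact: rn_mono.
have sab : supp_in r (fun x => a x - b x) by move=> x xr; rewrite sa// sb// subrr.
have ba := supp_in_bnd sa; have bb := supp_in_bnd sb; have bab := supp_in_bnd sab.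
have fa := fsupp ur sa; have fb := fsupp ur sb; have fab := fsupp ur sab.
have clark := energy_clarkson Glf Gsc s01 p2 h_gt0 ba bb fa fb.
have bh : bnd_fun (fun x => 2^-1 * (a x + b x)) by apply: bnd_funZ; exact: bnd_funD.
have fh : fin_energy (fun x => 2^-1 * (a x + b x)).
  by apply: (fsupp ur) => x xr; rewrite sa// sb// addr0 mulr0.
have conv := energy_convex Glf Gsc s01 p2 h_gt0 bb bh fb fh.
have E1 : (fun x => 2^-1 * (a x + b x) - b x) = (fun x => 2^-1 * (a x - b x)).
  by apply/funext => x; field.
rewrite E1 (energy_formZ Glf Gsc s01 p2 h_gt0 _ bb bab fb fab) in conv.
have [_ E2] := fin_energyZ Glf Gsc s01 2^-1 bab fab.
rewrite E2 in clark.
have crit := near_critical sab (mulr_ge0 (ler0n _ 2) M_ge0) _.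
have {}crit : `|energy_form b (fun x => a x - b x) -
    \sum_(x <- r) mu x * k x (b x) * (a x - b x)| <= 2 * M / m.+1%:R.
  apply: crit => x; apply: le_trans (ler_normB _ _) _.
  by rewrite mulr_natl mulr2n; apply: lerD; exact: vM.
have nl : `|\sum_(x <- r) mu x * k x (b x) * (a x - b x)| <=
    C * (e * (C1 / h1) + e^-1 `^ (p - 1) * S).
  apply: le_trans (ler_norm_sum _ _ _) _.
  apply: (@le_trans _ _ (\sum_(x <- r) mu x * k x (b x) * `|a x - b x|)).
    apply: ler_sum => x _; rewrite normrM ger0_norm//.
    by apply: mulr_ge0 => //; exact: ltW.
  apply: le_trans (nonlinear_sum_le r (fun x => a x - b x) C0 e0 (fun x => HC x (b x) (vM m x))) _.
  apply: ler_wpM2l => //; apply: lerD; apply: ler_wpM2l; rewrite ?powR_ge0// ?(ltW e0)//.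
    apply: le_trans (mass_le_energy ur fb) _.
    by rewrite ler_pM2r ?invr_gt0//; exact: v_energy.
  exact: HS.
have tp : 0 < 2 `^ p :> R by rewrite powR_gt0.
have half : (2^-1 : R) `^ p = (2 `^ p)^-1.
  rewrite -[RHS]mul1r; apply: (canRL (mulfK (lt0r_neq0 tp))).
  by rewrite -powRM// mulVf// powR1.
rewrite normrV ?unitfE// normr_nat half in clark.
rewrite -ler_pdivrMl//.
have n1 := ler_norm (- energy_form b (fun x => a x - b x)).
rewrite normrN in n1.
have n2 : `|energy_form b (fun x => a x - b x)| <=
    C * (e * (C1 / h1) + e^-1 `^ (p - 1) * S) + 2 * M / m.+1%:R.
  rewrite -(subrK (\sum_(x <- r) mu x * k x (b x) * (a x - b x)) (energy_form b _)).
  apply: le_trans (ler_normD _ _) _; rewrite addrC; exact: lerD.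
have n3 := ler_wpM2l (ltW p0) (le_trans n1 n2).
move: clark conv n3 => {n1 n2 crit nl E2}.
move: ((2 `^ p)^-1 * _) (energy_form b _) (energy (fun x => 2^-1 * _)) (energy a) (energy b).
move: (C * _ + _) => Q A F H ea eb; lra.
Qed.

(** The energies converge along the subsequence that converges in [l^p], so the
    previous estimate makes it a Cauchy sequence in energy. *)
Lemma strong_limit : exists (u : V -> R) (n_ : nat -> nat),
  [/\ forall j, (j <= n_ j)%N, forall x, `|u x| <= M,
      forall e, 0 < e -> exists N, forall i j, (N <= i)%N -> (N <= j)%N ->
        energy (fun x => v (n_ i) x - v (n_ j) x) <= e,
      forall e, 0 < e -> exists N, forall i, (N <= i)%N -> forall x, `|v (n_ i) x - u x| <= e
    & forall e, 0 < e -> exists N, forall i, (N <= i)%N ->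
        fin_energy (fun x => v (n_ i) x - u x) /\ energy (fun x => v (n_ i) x - u x) <= e].
Proof.
have vC n r : uniq r -> \sum_(x <- r) h x * `|v n x| `^ p * mu x <= C1.
  move=> ur; have fv := fsupp (rn_uniq n) (@v_supp n).
  have [sm le] := fin_energy_mass h_gt0 fv.
  apply: le_trans (v_energy n); apply: le_trans le.
  apply: sum_le_rsum => // x _.
  by apply: mulr_ge0; [apply: mulr_ge0; [exact: ltW|exact: powR_ge0]|exact: ltW].
have bE n : `|energy (v n)| <= C1 by rewrite ger0_norm.
have [u [l [uM Hu]]] := weighted_lp_compact mu0 h_gt0 p0 hL vM bE vC.
have inv_gt0 (j : nat) : 0 < j.+1%:R^-1 :> R by rewrite invr_gt0 ltr0n.
have [n_ Hn] := choice (fun j => Hu _ j (inv_gt0 j)).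
have inv_le (N j : nat) : (N <= j)%N -> j.+1%:R^-1 <= N.+1%:R^-1 :> R.
  by move=> Nj; rewrite lef_pV2 ?posrE ?ltr0n// ler_nat ltnS.
have small Q e : 0 <= Q -> 0 < e -> exists N : nat, Q * N.+1%:R^-1 <= e.
  move=> Q0 e0; have [N HN] : exists N : nat, Q / e < N%:R.
    by eexists; apply: archi_boundP; apply: divr_ge0 => //; exact: ltW.
  exists N; rewrite ler_pdivrMr ?ltr0n// mulrC -ler_pdivrMr//.
  by apply: le_trans (ltW HN) _; rewrite ler_nat.
have unif e : 0 < e -> exists N, forall i, (N <= i)%N -> forall x, `|v (n_ i) x - u x| <= e.
  move=> e0; have ep : 0 < m1 * e `^ p by rewrite mulr_gt0// powR_gt0.
  have [N HN] := small 1 _ ler01 ep; exists N => i Ni x.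
  have [_ _ /(_ [:: x] isT)] := Hn i; rewrite big_seq1 => k1.
  rewrite leNgt; apply/negP => ex.
  have := @gt0_ltr_powR R p p0 e `|v (n_ i) x - u x|.
  rewrite !nnegrE (ltW e0) normr_ge0 => /(_ isT isT ex) k2.
  have : m1 * e `^ p < m1 * e `^ p; last by rewrite ltxx.
  apply: (@lt_le_trans _ _ (mu x * `|v (n_ i) x - u x| `^ p)); last first.
    by rewrite mulrC; apply: le_trans k1 _; rewrite mul1r in HN; exact: le_trans (inv_le _ _ Ni) HN.
  apply: (@le_lt_trans _ _ (mu x * e `^ p)); last by rewrite ltr_pM2l.
  by apply: ler_wpM2r; [exact: powR_ge0|exact: m1P].
have cauchy e : 0 < e -> exists N, forall i j, (N <= i)%N -> (N <= j)%N ->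
    energy (fun x => v (n_ i) x - v (n_ j) x) <= e.
  move=> e0; have [C C0 HC] := k_bound M.
  have tp : 0 < 2 `^ p :> R by rewrite powR_gt0.
  pose d := e / 2 / (2 `^ p * (p / 2 * (C * (C1 / h1))) + 1).
  have D0 : 0 <= 2 `^ p * (p / 2 * (C * (C1 / h1))).
    do ! apply: mulr_ge0 => //; rewrite ?invr_ge0 ?powR_ge0//; exact: ltW.
  have d0 : 0 < d by rewrite !divr_gt0// ltr_wpDl.
  pose K := d^-1 `^ (p - 1); have K0 : 0 <= K by exact: powR_ge0.
  pose Q := 2 `^ p * (1 + p / 2 * (C * (K * (2 `^ p * 2)) + 2 * M)).
  have Q0 : 0 <= Q.
    apply: mulr_ge0; first exact: ltW.
    apply: addr_ge0 => //; apply: mulr_ge0; first by rewrite divr_ge0// ltW.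
    apply: addr_ge0; last by rewrite mulr_ge0.
    by do ! apply: mulr_ge0 => //; exact: ltW.
  have e2 : 0 < e / 2 by lra.
  have [N HN] := small Q _ Q0 e2; exists N.
  set t := N.+1%:R^-1 in HN.
  have main i j : (N <= i)%N -> (N <= j)%N -> (n_ i <= n_ j)%N ->
      energy (fun x => v (n_ i) x - v (n_ j) x) <= e.
    move=> Ni Nj nij; have [_ ei Li] := Hn i; have [jn ej Lj] := Hn j.
    have it := inv_le _ _ Ni; have jt := inv_le _ _ Nj; rewrite -/t in it jt.
    have HS r : uniq r -> \sum_(x <- r) `|v (n_ i) x - v (n_ j) x| `^ p * mu x <= 2 `^ p * 2 * t.
      move=> ur.
      apply: (@le_trans _ _ (\sum_(x <- r) (2 `^ p * (`|v (n_ i) x - u x| `^ p * mu x)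
          + 2 `^ p * (`|v (n_ j) x - u x| `^ p * mu x)))).
        apply: ler_sum => x _; rewrite -mulrDr -mulrDl mulrA; apply: ler_wpM2r; first exact: ltW.
        apply: (le_trans _ (powR_add_le _ _ _)) => //; last exact: ltW.
        apply: le_powR => //; first exact: ltW.
        have -> : v (n_ i) x - v (n_ j) x = (v (n_ i) x - u x) - (v (n_ j) x - u x) by ring.
        exact: ler_normB.
      rewrite big_split/= -!mulr_sumr -mulrDr -mulrA ler_wpM2l ?(ltW tp)//.
      have l1 := le_trans (Li r ur) it; have l2 := le_trans (Lj r ur) jt; lra.
    apply: le_trans (energy_dist_almost_critical nij C0 d0 HC HS) _.
    have q1 : (energy (v (n_ i)) - energy (v (n_ j))) / 2 <= t.
      have {}ei := le_trans ei it; have {}ej := le_trans ej jt.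
      move: ei ej; rewrite !ler_norml; move: (energy _) (energy _) t {HN it jt HS}.
      by move=> a b t /andP[_ a1] /andP[a2 _]; lra.
    have q2 : 2 * M / (n_ j).+1%:R <= 2 * M * t.
      apply: ler_wpM2l; first by rewrite mulr_ge0.
      by apply: inv_le; exact: leq_trans jn.
    have q3 : 2 `^ p * (p / 2 * (C * (C1 / h1))) * d <= e / 2.
      rewrite /d mulrA ler_pdivrMr ?ltr_wpDl// mulrC ler_wpM2l ?(ltW e2)//.
      by rewrite lerDl.
    apply: (@le_trans _ _ (2 `^ p * (t + p / 2 * (C * (d * (C1 / h1) + K * (2 `^ p * 2 * t)) + 2 * M * t)))).
      apply: ler_wpM2l; first exact: ltW.
      apply: lerD => //; apply: ler_wpM2l; first by rewrite divr_ge0// ltW.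
      exact: lerD.
    have -> : 2 `^ p * (t + p / 2 * (C * (d * (C1 / h1) + K * (2 `^ p * 2 * t)) + 2 * M * t)) =
      2 `^ p * (p / 2 * (C * (C1 / h1))) * d + Q * t by rewrite /Q; ring.
    by rewrite [leRHS](splitr e); exact: lerD.
  move=> i j Ni Nj; have [nij|/ltnW nji] := leqP (n_ i) (n_ j); first exact: main.
  have -> : (fun x => v (n_ i) x - v (n_ j) x) = (fun x => -1 * (v (n_ j) x - v (n_ i) x)).
    by apply/funext => x; ring.
  have fv n := fsupp (rn_uniq n) (@v_supp n).
  have bv n : bnd_fun (v n) by exact: supp_in_bnd (@v_supp n).
  have [fB _] := fin_energyB Glf Gsc s01 p2 h_gt0 (bv (n_ j)) (bv (n_ i)) (fv _) (fv _).
  have [_ ->] := fin_energyZ Glf Gsc s01 (-1) (bnd_funB (bv (n_ j)) (bv (n_ i))) fB.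
  by rewrite normrN1 powR1 mul1r; exact: main.
exists u, n_; split => // [j|e e0]; first by have [] := Hn j.
have [N HN] := cauchy e e0; exists N => i Ni.
have fv n := fsupp (rn_uniq n) (@v_supp n).
have bv n : bnd_fun (v n) by exact: supp_in_bnd (@v_supp n).
have bu : bnd_fun u by exists M.
apply: (energy_lsc Glf Gsc s01 p2 h_gt0 (w := fun j x => v (n_ i) x - v (n_ j) x)).
- exact: bnd_funB.
- by move=> n; exact: bnd_funB.
move=> d d0; have [N' HN'] := unif d d0; exists (maxn N N') => n.
rewrite geq_max => /andP[Nn N'n]; split; last split.
- move=> x; have -> : v (n_ i) x - v (n_ n) x - (v (n_ i) x - u x) =
    - (v (n_ n) x - u x) by ring.
  by rewrite normrN; exact: HN'.
- exact: (fin_energyB Glf Gsc s01 p2 h_gt0 (bv (n_ i)) (bv (n_ n)) (fv _) (fv _)).1.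
- exact: HN.
Qed.

Hypothesis rn_cover : forall z, exists n, z \in rn n.
Variable r1 : R.
Hypothesis r1_gt0 : 0 < r1.
Hypothesis v_low : forall n, r1 <= energy (v n).

Let rn_covers r : exists N, {subset r <= rn N}.
Proof.
elim: r => [|z r [N HN]]; first by exists 0%N.
have [n zn] := rn_cover z; exists (maxn n N) => x; rewrite inE => /predU1P[->|/HN xN].
  exact: rn_mono (leq_maxl _ _) _ zn.
exact: rn_mono (leq_maxr _ _) _ xN.
Qed.

Let fv n : fin_energy (v n). Proof. exact: fsupp (rn_uniq n) (@v_supp n). Qed.
Let bv n : bnd_fun (v n). Proof. exact: supp_in_bnd (@v_supp n). Qed.

Let nonlin (u phi : V -> R) x := mu x * k x (u x) * phi x.

Let critical_limit_supp u (n_ : nat -> nat) r phi :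
  (forall j, (j <= n_ j)%N) -> bnd_fun u -> fin_energy u ->
  (forall e, 0 < e -> exists N, forall i, (N <= i)%N -> forall x, `|v (n_ i) x - u x| <= e) ->
  (forall e, 0 < e -> exists N, forall i, (N <= i)%N -> energy (fun x => v (n_ i) x - u x) <= e) ->
  uniq r -> supp_in r phi -> energy_form u phi = \sum_(x <- r) nonlin u phi x.
Proof.
move=> n_j bu fu vu Evu ur sphi.
have bphi := supp_in_bnd sphi; have fphi := fsupp ur sphi.
have cA : (fun i => energy_form (v (n_ i)) phi) @ \oo --> energy_form u phi.
  apply/cvgrPdist_le => e e0.
  pose D := p * (C1 + energy u + energy phi).
  have D0 : 0 <= D by apply: mulr_ge0; [exact: ltW|rewrite !addr_ge0].
  pose d := e / 2 / (D + 1); have d0 : 0 < d by rewrite !divr_gt0// ltr_wpDl.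
  pose K := d^-1 `^ (p - 1); have K0 : 0 <= K by exact: powR_ge0.
  have pK : 0 < p * K + 1 by rewrite ltr_wpDl// mulr_ge0// ltW.
  have [N HN] := Evu (e / 2 / (p * K + 1)) ltac:(by rewrite !divr_gt0).
  exists N => // i /= Ni; rewrite distrC.
  apply: le_trans (energy_form_cont Glf Gsc s01 p2 h_gt0 d0 (bv (n_ i)) bu bphi (fv _) fu fphi) _.
  rewrite mulrDr (splitr e); apply: lerD.
    apply: (@le_trans _ _ (D * d)); last first.
      by rewrite /d mulrA ler_pdivrMr ?ltr_wpDl// mulrC ler_wpM2l ?lerDl//; lra.
    rewrite /D -mulrA ler_wpM2l ?(ltW p0)// mulrC ler_wpM2r ?(ltW d0)//.
    by rewrite lerD2r lerD2r.
  apply: (@le_trans _ _ (p * K * (e / 2 / (p * K + 1)))).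
    rewrite mulrA; apply: ler_wpM2l; first by rewrite mulr_ge0// ltW.
    exact: HN.
  by rewrite mulrA ler_pdivrMr// mulrC ler_wpM2l ?lerDl//; lra.
have cS : (fun i => \sum_(x <- r) nonlin (v (n_ i)) phi x) @ \oo --> \sum_(x <- r) nonlin u phi x.
  elim: (r) => [|x r' IH].
    rewrite big_nil (_ : (fun i => _) = (fun=> 0)); first exact: cvg_cst.
    by apply/funext => i; rewrite big_nil.
  rewrite big_cons (_ : (fun i => _) = (fun i => nonlin (v (n_ i)) phi x +
    \sum_(y <- r') nonlin (v (n_ i)) phi y)); last by apply/funext => i; rewrite big_cons.
  apply: cvgD => //; apply: cvgM; last exact: cvg_cst.
  apply: cvgM; first exact: cvg_cst.
  apply: (@continuous_cvg _ _ _ _ _ _ (k x)); first exact: k_cont.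
  apply/cvgrPdist_le => e e0; have [N HN] := vu e e0.
  by exists N => // i /= Ni; rewrite distrC; exact: HN.
have cD : (fun i => energy_form (v (n_ i)) phi - \sum_(x <- r) nonlin (v (n_ i)) phi x)
    @ \oo --> (0 : R).
  have [b phib] := bphi; have [N HN] := rn_covers r.
  have b0 : 0 <= Num.max b 0 by rewrite le_max lexx orbT.
  have phib' x : `|phi x| <= Num.max b 0 by rewrite le_max phib.
  apply/cvgr0Pnorm_le => e e0.
  have [N' HN'] : exists N' : nat, Num.max b 0 / e < N'%:R.
    by eexists; apply: archi_boundP; apply: divr_ge0 => //; exact: ltW.
  exists (maxn N N') => // i /=; rewrite geq_max => /andP[Ni N'i].
  have sub : {subset r <= rn (n_ i)}.
    by move=> x /HN; apply: rn_mono; exact: leq_trans Ni (n_j i).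
  have sphi' : supp_in (rn (n_ i)) phi.
    by move=> x xr; apply: sphi; apply: contra xr; exact: sub.
  have z0 q : supp_in q phi -> forall x, setT x -> x \notin q -> nonlin (v (n_ i)) phi x = 0.
    by move=> sq x _ xq; rewrite /nonlin sq// mulr0.
  have [_ <-] := rsum_seq ur (fun _ _ => I) (z0 _ sphi).
  have [_ ->] := rsum_seq (rn_uniq (n_ i)) (fun _ _ => I) (z0 _ sphi').
  apply: le_trans (near_critical sphi' b0 phib') _.
  rewrite ler_pdivrMr ?ltr0n// mulrC -ler_pdivrMr//; apply: le_trans (ltW HN') _.
  by rewrite ler_nat; apply: leq_trans N'i _; exact: leq_trans (n_j i) _.
have cE : (fun i => energy_form (v (n_ i)) phi - \sum_(x <- r) nonlin (v (n_ i)) phi x)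
    @ \oo --> energy_form u phi - \sum_(x <- r) nonlin u phi x by apply: cvgB.
have E : energy_form u phi - \sum_(x <- r) nonlin u phi x = 0.
  by rewrite -(cvg_lim (@Rhausdorff R) cE) (cvg_lim (@Rhausdorff R) cD).
by apply/eqP; rewrite -subr_eq0 E.
Qed.

(** The equation holds against finitely supported functions by strong convergence,
    and against the whole space by density, both sides being continuous for the
    energy; the lower bound on the energies keeps the limit away from 0. *)
Lemma critical_limit : exists u, [/\ Hsp G s p h u, 0 < energy u &
  forall phi, Hsp G s p h phi -> asum [set: V] (fun x => mu x * k x (u x) * phi x) /\
    energy_form u phi = rsum [set: V] (fun x => mu x * k x (u x) * phi x)].
Proof.
have [u [n_ [n_j uM cau unif strong]]] := strong_limit.
have Hu : Hsp G s p h u.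
  apply: (Hsp_of_limit Glf Gsc s01 p2 h_gt0 m1_gt0 m1P (w := fun j => v (n_ j))) => //.
  by move=> j; exists (rn (n_ j)).
have bu : bnd_fun u by exists M.
have fu : fin_energy u := Hsp_fin_energy Glf Gsc s01 p2 h_gt0 m1_gt0 m1P Hu.
have tp : 0 < 2 `^ p :> R by rewrite powR_gt0.
have Eu : 0 < energy u.
  have e0 : 0 < r1 / 2 / 2 `^ p by rewrite !divr_gt0.
  have [N HN] := strong _ e0; have [fd Ed] := HN N (leqnn N).
  have [_] := fin_energyD Glf Gsc s01 p2 h_gt0 (bnd_funB (bv (n_ N)) bu) bu fd fu.
  have -> : (fun x => v (n_ N) x - u x + u x) = v (n_ N) by apply/funext => x; ring.
  rewrite mulrDr => le; have low := v_low (n_ N).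
  have k1 : 2 `^ p * energy (fun x => v (n_ N) x - u x) <= r1 / 2.
    by move: Ed; rewrite ler_pdivlMr// mulrC.
  rewrite -(pmulr_rgt0 _ tp); move: le low k1.
  move: (2 `^ p * _) (2 `^ p * _) (energy _) => a b c; move: r1_gt0; lra.
exists u; split => // phi Hphi.
have bphi := Hsp_bnd Hphi.
have fphi : fin_energy phi := Hsp_fin_energy Glf Gsc s01 p2 h_gt0 m1_gt0 m1P Hphi.
have [C C0 HC] := k_bound M.
have nl psi e r : uniq r -> fin_energy psi -> 0 < e ->
    \sum_(x <- r) `|nonlin u psi x| <=
    C * (e * (energy u / h1) + e^-1 `^ (p - 1) * (energy psi / h1)).
  move=> ur fpsi e0.
  apply: (@le_trans _ _ (\sum_(x <- r) mu x * k x (u x) * `|psi x|)).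
    apply: ler_sum => x _; rewrite normrM ger0_norm//.
    by apply: mulr_ge0 => //; exact: ltW.
  apply: le_trans (nonlinear_sum_le r psi C0 e0 (fun x => HC x (u x) (uM x))) _.
  apply: ler_wpM2l => //; apply: lerD; apply: ler_wpM2l; rewrite ?powR_ge0// ?(ltW e0)//;
    exact: mass_le_energy.
have snl psi : fin_energy psi -> asum [set: V] (nonlin u psi).
  by move=> fpsi; apply: asum_bound => r ur _; exact: nl ur fpsi ltr01.
have rnl psi e : fin_energy psi -> 0 < e -> `|rsum [set: V] (nonlin u psi)| <=
    C * (e * (energy u / h1) + e^-1 `^ (p - 1) * (energy psi / h1)).
  move=> fpsi e0; apply: le_trans (ler_norm_rsum (snl psi fpsi)) _.
  apply: (rsum_le_bound (D := [set: V]) (g := fun x => `|nonlin u psi x|) _ _).2 => //.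
  by move=> r ur _; exact: nl ur fpsi e0.
split; first exact: snl.
apply/eqP; rewrite -subr_eq0 -normr_le0; apply/ler_addgt0Pr => e e0; rewrite add0r.
pose Q := (energy u + 1) + C * (energy u / h1 + h1^-1).
have Q0 : 0 <= Q.
  by apply: addr_ge0; [apply: addr_ge0|apply: mulr_ge0 => //; apply: addr_ge0;
    rewrite ?invr_ge0 ?divr_ge0// ltW].
pose d := e / (Q + 1); have d0 : 0 < d by rewrite divr_gt0// ltr_wpDl.
pose K := d^-1 `^ (p - 1); have K0 : 0 <= K by exact: powR_ge0.
have K1 : 0 < K + 1 by rewrite ltr_wpDl.
have [r [psi [ur spsi fd Ed]]] := Hsp_approx Glf Gsc s01 p2 h_gt0 Hphi (divr_gt0 d0 K1).
have bpsi := supp_in_bnd spsi; have fpsi := fsupp ur spsi.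
have strong' e' : 0 < e' -> exists N, forall i, (N <= i)%N ->
    energy (fun x => v (n_ i) x - u x) <= e'.
  by move=> e'0; have [N HN] := strong e' e'0; exists N => i /HN[].
have eqpsi := critical_limit_supp n_j bu fu unif strong' ur spsi.
have [_ spsiE] : asum [set: V] (nonlin u psi) /\
    rsum [set: V] (nonlin u psi) = \sum_(x <- r) nonlin u psi x.
  by apply: rsum_seq => // x _ xr; rewrite /nonlin spsi// mulr0.
have KE : K * energy (fun x => phi x - psi x) <= d.
  apply: (@le_trans _ _ (K * (d / (K + 1)))); first exact: ler_wpM2l.
  by rewrite mulrA ler_pdivrMr// mulrC ler_wpM2l ?(ltW d0)// lerDl.
have fB := energy_formB Glf Gsc s01 p2 h_gt0 bu bphi bpsi fu fphi fpsi.
have nB : rsum [set: V] (nonlin u (fun x => phi x - psi x)) =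
    rsum [set: V] (nonlin u phi) - rsum [set: V] (nonlin u psi).
  rewrite -(rsumB (snl phi fphi) (snl psi fpsi)); apply: eq_rsum => x _.
  by rewrite /nonlin mulrBr.
have -> : energy_form u phi - rsum [set: V] (fun x => mu x * k x (u x) * phi x) =
    energy_form u (fun x => phi x - psi x) - rsum [set: V] (nonlin u (fun x => phi x - psi x)).
  rewrite fB nB eqpsi -spsiE -/(nonlin u phi); ring.
apply: le_trans (ler_normB _ _) _.
have a1 := energy_form_young Glf Gsc s01 p2 h_gt0 d0 bu (bnd_funB bphi bpsi) fu fd.
have a2 := rnl _ d fd d0.
apply: le_trans (lerD a1 a2) _; rewrite -/K.
apply: (@le_trans _ _ (Q * d)); last first.
  by rewrite /d mulrA ler_pdivrMr ?ltr_wpDl// mulrC ler_wpM2l ?(ltW e0)// lerDl.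
have -> : Q * d = (d * energy u + d) + C * (d * (energy u / h1) + d / h1) by rewrite /Q; ring.
apply: lerD; first by rewrite lerD2l.
by apply: ler_wpM2l => //; rewrite lerD2l mulrA ler_pM2r ?invr_gt0.
Qed.

End StrongLimit.

(** * Pointwise equation and positivity *)

Lemma seq_argmin {R : realType} {V : eqType} (u : V -> R) (r : seq V) x0 : x0 \in r ->
  exists2 z, z \in r & forall x, x \in r -> u z <= u x.
Proof.
elim: r x0 => // y r IH x0 _; case: r IH => [|y' r] IH.
  by exists y; rewrite ?mem_head// => x; rewrite inE => /eqP ->.
have [z zr Hz] := IH y' (mem_head _ _).
have [yz|zy] := leP (u y) (u z).
  exists y; first exact: mem_head.
  by move=> x; rewrite inE => /predU1P[->//|/Hz]; exact: le_trans.
exists z; first by rewrite inE zr orbT.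
by move=> x; rewrite inE => /predU1P[->|/Hz//]; exact: ltW.
Qed.

Section Positivity.
Context {R : realType} {V : countType} (G : weighted_graph R V).
Hypothesis Gconn : connected_graph G.
Hypothesis Glf : locally_finite G.
Hypothesis Gsc : stochastically_complete G.
Variables (s p : R) (h : V -> R).
Hypothesis s01 : 0 < s < 1.
Hypothesis p2 : 2 <= p.
Hypothesis h_gt0 : forall x, 0 < h x.
Variable m1 : R.
Hypothesis m1_gt0 : 0 < m1.
Hypothesis m1P : forall x, m1 <= vmeas G x.
Local Notation mu := (vmeas G).
Local Notation W := (frac_weight G s).
Local Notation B := (frac_grad_prod G s).
Local Notation nabla := (frac_grad_norm G s).
Local Notation form := (dens_form G s p h).
Local Notation energy := (energy G s p h).
Local Notation energy_form := (energy_form G s p h).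
Implicit Types (x y z : V).

Let mu0 x : 0 < mu x := vmeas_gt0 G x.
Let p0 : 0 < p. Proof. exact: lt_le_trans p2. Qed.

Variable u : V -> R.
Hypothesis Hu : Hsp G s p h u.
Let bu : bnd_fun u. Proof. exact: Hsp_bnd Hu. Qed.

Let term z y : R := W z y * (nabla u z `^ (p - 2) + nabla u y `^ (p - 2)) * (u z - u y).

(** The term at [z] of the energy form yields the part of the [p]-Laplacian with
    the gradient at [z]; the terms at [y != z], by symmetry of the weight, yield
    the part with the gradients at [y]. *)
Lemma energy_form_unit_at z : asum [set~ z] (term z) /\
  energy_form u (unit_at z) =
  mu z * (frac_plaplacian G s p u z + h z * `|u z| `^ (p - 2) * u z).
Proof.
have bz := bnd_unit_at z : bnd_fun (unit_at z : V -> R).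
have fu := Hsp_fin_energy Glf Gsc s01 p2 h_gt0 m1_gt0 m1P Hu.
have fz := fin_energy_unit_at Glf Gsc s01 p2 h_gt0 m1_gt0 m1P z.
have sf := asum_form Glf Gsc s01 p2 h_gt0 bu bz fu fz.
have [sf' sE] := rsum_setC1 z sf.
have st1 : asum [set~ z] (fun y => nabla u z `^ (p - 2) * (W z y * (u z - u y))).
  apply: asumZ; apply: eq_asum (asum_grad_term Glf Gsc s01 z bu bz) => y /= /eqP/negbTE yz.
  by rewrite /unit_at eqxx yz subr0 mulr1.
have t2E y : [set~ z] y ->
    form u (unit_at z) y * mu y = 2^-1 * (nabla u y `^ (p - 2) * (W z y * (u z - u y))).
  move=> /eqP yz; rewrite /dens_form (frac_grad_prod_unit_at G s u yz).
  rewrite /unit_at (negbTE yz) mulr0 addr0 [W y z](frac_weight_sym Glf).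
  by field; rewrite gt_eqF.
have st2 : asum [set~ z] (fun y => nabla u y `^ (p - 2) * (W z y * (u z - u y))).
  have := asumZ 2 (eq_asum t2E sf'); apply: eq_asum => y _.
  by field.
have tE y : term z y = nabla u z `^ (p - 2) * (W z y * (u z - u y)) +
    nabla u y `^ (p - 2) * (W z y * (u z - u y)).
  by rewrite /term -mulrDl mulrCA mulrA.
have st : asum [set~ z] (term z).
  by apply: eq_asum (asumD st1 st2) => y _; rewrite tE.
have alg (m a b c : R) : 0 < m ->
    ((2 * m)^-1 * a + c) * m + 2^-1 * b = m * ((2 * m)^-1 * (a + b) + c).
  by move=> m_gt0; field; exact: lt0r_neq0.
split => //; rewrite /energy_form sE (eq_rsum t2E) (rsumZ 2^-1 st2).
rewrite /frac_plaplacian -/(term z) (eq_rsum (fun y _ => tE y)) (rsumD st1 st2).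
have BE : nabla u z `^ (p - 2) * B u (unit_at z) z = (2 * mu z)^-1 *
    rsum [set~ z] (fun y => nabla u z `^ (p - 2) * (W z y * (u z - u y))).
  have s0 := asum_grad_term Glf Gsc s01 z bu bz.
  rewrite /frac_grad_prod mulrCA -(rsumZ (nabla u z `^ (p - 2)) s0); congr (_ * _).
  apply: eq_rsum => y /= /eqP/negbTE yz.
  by rewrite /unit_at eqxx yz subr0 mulr1.
have z1 : unit_at z z = 1 :> R by rewrite /unit_at eqxx.
have formE : form u (unit_at z) z = (2 * mu z)^-1 *
    rsum [set~ z] (fun y => nabla u z `^ (p - 2) * (W z y * (u z - u y)))
    + h z * `|u z| `^ (p - 2) * u z.
  by rewrite /dens_form BE z1 [_ * 1]mulr1.
rewrite formE; apply: alg; exact: mu0.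
Qed.

Variable k : V -> R -> R.
Hypothesis k_neg : forall x (y : R), y <= 0 -> k x y = 0.
Hypothesis weak_unit : forall z, energy_form u (unit_at z) = mu z * k z (u z).

Lemma pointwise_equation z :
  frac_plaplacian G s p u z + h z * `|u z| `^ (p - 2) * u z = k z (u z).
Proof.
have [_ E] := energy_form_unit_at z.
by apply: (mulfI (lt0r_neq0 (mu0 z))); rewrite -E.
Qed.

Let coef_ge0 z y : 0 <= W z y * (nabla u z `^ (p - 2) + nabla u y `^ (p - 2)).
Proof.
by apply: mulr_ge0; [exact: frac_weight_ge0|rewrite addr_ge0// powR_ge0].
Qed.

(** All the terms of the operator are nonpositive at a minimum. *)
Let plap_min z : (forall y, u z <= u y) ->
  frac_plaplacian G s p u z <= 0 /\
  (frac_plaplacian G s p u z = 0 -> forall y, y != z -> term z y = 0).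
Proof.
move=> umin; have [st _] := energy_form_unit_at z.
have t0 y : 0 <= - term z y.
  by rewrite oppr_ge0 /term; apply: mulr_ge0_le0 => //; rewrite subr_le0.
have mz : 0 < (2 * mu z)^-1 by rewrite invr_gt0 mulr_gt0.
have rE := rsumN st; have r0 := rsum_ge0 (fun y (_ : [set~ z] y) => t0 y).
rewrite rE oppr_ge0 in r0; rewrite /frac_plaplacian -/(term z); split.
  by apply: mulr_ge0_le0 => //; exact: ltW.
move=> /eqP; rewrite mulf_eq0 (gt_eqF mz)/= => /eqP r1 y yz.
have := term_le_rsum (fun y (_ : [set~ z] y) => t0 y) (asumN st) (x := y).
rewrite rE r1 oppr0 => /(_ (elimN eqP yz)) ty.
by apply/eqP; rewrite -oppr_eq0 eq_le ty t0.
Qed.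

(** As [u] tends to 0 at infinity, a negative value forces a negative minimum. There
    the operator is nonpositive, the zero order term is negative and the
    right-hand side is 0. *)
Lemma solution_ge0 x : 0 <= u x.
Proof.
rewrite leNgt; apply/negP => ux.
have [r rP] : exists r : seq V, forall y, y \notin r -> `|u y| < - u x.
  have [u_ [us _ /cvg_unif_seqP uu]] := Hu.
  have ux' : 0 < - u x by rewrite oppr_gt0.
  have [N HN] := uu _ ux'; have [r _ sr] := finitely_supported_seq (us N).
  by exists r => y /sr yr; have := HN N (leqnn N) y; rewrite yr subr0.
have xr : x \in r.
  by apply: contraT => /rP; rewrite ltr0_norm// ltxx.
have [z zr zmin] := seq_argmin u xr.
have uz : u z < 0 by apply: le_lt_trans ux; exact: zmin.
have umin y : u z <= u y.
  have [/zmin//|/rP] := boolP (y \in r).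
  rewrite ltr_norml opprK => /andP[/ltW uy _]; apply: le_trans uy; exact: zmin.
have := pointwise_equation z; rewrite k_neg ?ltW// => E.
have [le _] := plap_min umin.
have : h z * `|u z| `^ (p - 2) * u z < 0.
  by rewrite pmulr_rlt0// mulr_gt0// powR_gt0// normr_gt0 lt_eqF.
by move: E le; move: (frac_plaplacian _ _ _ _ _) (_ * u z) => a b; lra.
Qed.

(** At a zero, which is a minimum, every term of the operator vanishes. If [u y > 0]
    the gradient at [y] is positive, and so is the term along the edge. *)
Lemma zero_propagates z y : u z = 0 -> edge G z y -> u y = 0.
Proof.
move=> uz e; have [->//|yz] := eqVneq y z.
have umin x : u z <= u x by rewrite uz; exact: solution_ge0.
have := pointwise_equation z; rewrite k_neg ?uz// mulr0 addr0 => E.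
have [_ /(_ E) t0] := plap_min umin; have := t0 y yz.
rewrite /term uz sub0r => /eqP; rewrite mulrN oppr_eq0 mulf_eq0 => /orP[|/eqP//].
have Wzy : 0 < W z y by apply: (frac_weight_gt0 Glf Gsc s01 e); rewrite eq_sym.
rewrite mulf_eq0 (gt_eqF Wzy)/= => /eqP n0.
apply: contraTeq isT => uy.
have uy0 : 0 < u y by rewrite lt_def uy solution_ge0.
have Bpos : 0 < B u u y.
  rewrite /frac_grad_prod pmulr_rgt0; last by rewrite invr_gt0 mulr_gt0.
  have sB := asum_grad_term Glf Gsc s01 y bu bu.
  have B0 x : [set~ y] x -> 0 <= W y x * (u y - u x) * (u y - u x).
    move=> _; rewrite -mulrA; apply: mulr_ge0; first exact: frac_weight_ge0.
    by rewrite -expr2 sqr_ge0.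
  apply: lt_le_trans (term_le_rsum B0 sB (x := z) _); last by apply/eqP; rewrite eq_sym.
  rewrite uz subr0 [W y z](frac_weight_sym Glf).
  exact: mulr_gt0 (mulr_gt0 Wzy uy0) uy0.
have ny : 0 < nabla u y.
  rewrite lt_def frac_grad_norm_ge0 andbT; apply: contraTneq Bpos => n1.
  by rewrite -(sqr_frac_grad_norm Glf s01) n1 expr0n ltxx.
have : 0 < nabla u z `^ (p - 2) + nabla u y `^ (p - 2).
  by rewrite ltr_wpDl ?powR_ge0// powR_gt0.
by rewrite n0 ltxx.
Qed.

Lemma solution_gt0 : 0 < energy u -> forall x, 0 < u x.
Proof.
move=> Eu x; rewrite lt_def solution_ge0 andbT; apply/negP => /eqP ux.
suff u0 : u = fun=> 0.
  by move: Eu; rewrite u0 (energy0 Glf Gsc s01 p2 h_gt0 m1_gt0 m1P) ltxx.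
apply/funext => y; have [q [pq <-]] := Gconn x y.
elim: q x ux pq => //= a q IH x ux /andP[e pq].
by apply: IH pq; exact: zero_propagates ux e.
Qed.

End Positivity.

(** * Existence of a strictly positive solution *)

(** The infimum of a set that is empty or unbounded below is 0. *)
Lemma inf_gt0_lbound {R : realType} {V : Type} (g : V -> R) :
  0 < inf (range g) -> (exists x : V, True) /\ forall x, inf (range g) <= g x.
Proof.
move=> g0; have [[_ [x _ _]] lb] : has_inf (range g).
  by apply: contrapT => H; move: g0; rewrite inf_out// ltxx.
by split; [exists x|move=> y; apply: ge_inf => //; exists y].
Qed.

Theorem theorem4 (R : realType) (V : countType) (G : weighted_graph R V)
    (s p : R) (h : V -> R) (f : V -> R -> R)
    (Gconn : connected_graph G)
    (Glf : locally_finite G)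
    (Gsc : stochastically_complete G)
    (s01 : 0 < s < 1)
    (p2 : 2 <= p)
    (mu_inf : 0 < inf (range (vmeas G)))
    (h_inf : 0 < inf (range h))
    (h_infty : forall (x0 : V) (M : R), exists N : nat,
        forall x : V, (N <= gdist G x x0)%N -> M <= h x)
    (A1 : forall x : V,
        {within `[0, +oo[, continuous (f x)} /\ f x 0 = 0)
    (A2 : forall M : R, 0 < M -> exists C_M : R,
        forall (x : V) (y : R), 0 <= y <= M -> f x y <= C_M)
    (A3 : exists alpha : R, p < alpha /\
        forall (x : V) (y : R), 0 < y -> 0 < alpha * primitive f x y <= y * f x y)
    (A4 : (limf_esup
             (fun y : R => ereal_sup (range (fun x : V => (f x y / y `^ (p - 1))%:E)))
             0^'+ < (lambda_p G s p h)%:E)%E) :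
  exists u : V -> R,
    [/\ weak_solution G s p h f u, pointwise_solution G s p h f u
      & forall x : V, 0 < u x].
Proof.
have [[x0 _] m1P] := inf_gt0_lbound mu_inf; have [_ h1P] := inf_gt0_lbound h_inf.
set m1 := inf (range (vmeas G)) in mu_inf m1P; set h1 := inf (range h) in h_inf h1P.
have h_gt0 x : 0 < h x by exact: lt_le_trans (h1P x).
have hL := finite_sublevel Gconn Glf (h_infty x0).
have [alpha [palpha A3']] := A3.
have p0 : 0 < p by exact: lt_le_trans p2.
have alpha0 : 0 < alpha by exact: lt_trans palpha.
have [l [d [l0 llam d0 near0]]] := subcritical_near0 p2 palpha A1 A3' A4 x0.
have kbound := fpos_bound p2 palpha A1 A2 A3' A4 x0.
have kneg x (y : R) : y <= 0 -> fpos f x y = 0 by exact: fpos_neg.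
have [r1 [C1 [r1_gt0 PS]]] := palais_smale_exists Glf Gsc s01 p2 h_gt0 mu_inf h_inf
  m1P h1P palpha A1 A3' x0 l0 llam d0 near0
  (fun r u ur su => lambda_p_le Glf Gsc s01 p2 h_gt0 mu_inf m1P ur su).
(* an exhaustion of the vertices along their enumeration; it contains [x0] from
   the start, so that the crossing segment is always available *)
pose rn n : seq V := undup (x0 :: pmap (@choice.unpickle V) (iota 0 n)).
have rn_uniq n : uniq (rn n) by exact: undup_uniq.
have x0rn n : x0 \in rn n by rewrite mem_undup mem_head.
have rn_mono n m : (n <= m)%N -> {subset rn n <= rn m}.
  move=> nm x; rewrite !mem_undup !inE => /orP[->//|]; rewrite !mem_pmap.
  move=> /mapP[i]; rewrite mem_iota => /andP[_ im] E; apply/orP; right.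
  by apply/mapP; exists i => //; rewrite mem_iota/=; exact: leq_trans im _.
have rn_cover z : exists n, z \in rn n.
  exists (choice.pickle z).+1; rewrite mem_undup inE mem_pmap; apply/orP; right.
  by apply/mapP; exists (choice.pickle z); rewrite ?choice.pickleK// mem_iota/= add0n.
have inv_gt0 n : 0 < n.+1%:R^-1 :> R by rewrite invr_gt0 ltr0n.
have [v Hv] := choice (fun n => PS (rn n) _ (rn_uniq n) (x0rn n) (inv_gt0 n)).
have v_supp n : supp_in (rn n) (v n) by have [] := Hv n.
have v_low n : r1 <= energy G s p h (v n) by have [] := Hv n.
have v_energy n : energy G s p h (v n) <= C1 by have [] := Hv n.
have v_crit n : \sum_(x <- rn n) `|energy_form G s p h (v n) (unit_at x) -
    vmeas G x * fpos f x (v n x)| <= n.+1%:R^-1 by have [] := Hv n.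
have [u [Hu Eu weak]] := critical_limit Glf Gsc s01 p2 h_gt0 mu_inf h_inf m1P h1P hL
  (fpos_ge0 A1 alpha0 A3') kbound (fun x => @continuous_fpos _ _ f A1 x)
  rn_uniq rn_mono v_supp v_energy v_crit rn_cover r1_gt0 v_low.
have weak_unit z : energy_form G s p h u (unit_at z) = vmeas G z * fpos f z (u z).
  have sz := @supp_in_unit_at R V [:: z] z (mem_head _ _).
  have [_ ->] := weak _ (Hsp_supp Glf Gsc s01 p2 h_gt0 mu_inf m1P sz).
  have [_ ->] : asum [set: V] (fun x => vmeas G x * fpos f x (u x) * unit_at z x) /\
      rsum [set: V] (fun x => vmeas G x * fpos f x (u x) * unit_at z x) =
      \sum_(x <- [:: z]) vmeas G x * fpos f x (u x) * unit_at z x.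
    by apply: rsum_seq => // x _ xz; rewrite (sz x xz) mulr0.
  by rewrite big_seq1 /unit_at eqxx mulr1.
have u_gt0 := solution_gt0 Gconn Glf Gsc s01 p2 h_gt0 mu_inf m1P Hu kneg weak_unit Eu.
have fE x : fpos f x (u x) = f x (u x) by rewrite fposE// ltW.
exists u; split => //.
- split=> // phi Hphi /=.
  have [sr E] := weak phi Hphi.
  have bu := Hsp_bnd Hu; have bphi := Hsp_bnd Hphi.
  have fu := Hsp_fin_energy Glf Gsc s01 p2 h_gt0 mu_inf m1P Hu.
  have fphi := Hsp_fin_energy Glf Gsc s01 p2 h_gt0 mu_inf m1P Hphi.
  have rhsE x : [set: V] x -> vmeas G x * fpos f x (u x) * phi x =
      f x (u x) * phi x * vmeas G x by move=> _; rewrite fE -mulrA mulrC.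
  split.
  + by have := asum_form Glf Gsc s01 p2 h_gt0 bu bphi fu fphi; rewrite asumE.
  + by have := eq_asum rhsE sr; rewrite asumE.
  by rewrite /intV -(eq_rsum rhsE) -E.
- by move=> x; rewrite (pointwise_equation Glf Gsc s01 p2 h_gt0 mu_inf m1P Hu weak_unit).
Qed.
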